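(* Let $(A,a_0)$ be a well-pointed $A_\infty$-space (that is, a $1$-monoid). Then the quotient map $C(I,\{0\};A)\to C(I,\partial I;A)=B_1(A)$ is canonically homeomorphic to Stasheff's universal arrow $E(A)\to B(A)$; that is, there are canonical homeomorphisms $C(I,\{0\};A)\cong E(A)$ and $C(I,\partial I;A)\cong B(A)$ compatible with the two maps. Here $I=[0,1]$.
   Context: Spaces are compactly generated weak Hausdorff; colimits are taken in that category. A cofibration is a retract of a generalized (relative) CW-inclusion; a pointed space is well-pointed if the inclusion of the base point is a cofibration. Fulton–MacPherson spaces. For a smooth $n$-manifold $M$ without boundary, $C^0_k(M)$ is the space of ordered $k$-tuples of distinct points, and $C_k(M)$ is the closure of its image in $M^k\times\prod_{S\subseteq\{1,\dots,k\},\#S\ge2}\mathrm{Bl}_\Delta(M^S)$, where $\mathrm{Bl}_\Delta$ is the oriented real blow-up along the small diagonal; $b:C_k(M)\to M^k$ is the blow-down; $C_0(M)$ is a point. A point of $C_k(M)$ is the same as: distinct points $P_1,\dots,P_l\in M$ (macroscopic locations), for each $i$ a rooted tree whose vertices of valence $m$ (necessarily $\ge 2$) are labelled by elements of $C^0_m(\tau_{P_i}M)/G(n)$ ($\tau$ = tangent space, $G(n)$ = group of translations and positive dilatations), and a numbering of all the twigs (leaves) by $1,\dots,k$. If $M$ has boundary, embed $M\hookrightarrow M'$ in a boundaryless $n$-manifold and let $C_k(M)\subset C_k(M')$ consist of the configurations macroscopically located in $M$. The operad $F_n$ has $F_n(k)=b^{-1}(0,\dots,0)\subset C_k(\mathbb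 R^n)$ for $k\ge1$, $F_n(0)=$ point, with composition by grafting of trees (composition with $F_n(0)$ forgets points). An $n$-monoid is an $F_n$-algebra $(A,\rho)$, with base point $a_0=\rho(F_n(0))$. One has $F_1(k)=K_k\times\Sigma_k$ with $K_k$ Stasheff's associahedron, so a $1$-monoid is an $A_\infty$-space with strict unit $a_0$, i.e. an algebra over the non-symmetric operad $K$ ($K_0=K_1=$ point), with structure maps $m_s:K_s\times A^s\to A$. Relative configuration spaces (here $M=I$, with the standard trivialization of its tangent bundle, and $N=\{0\}$ or $\partial I$). For a pointed space $(X,x_0)$ let $C(M;X)=\coprod_kC_k(M)\times_{\Sigma_k}X^k/\!\sim$, where twigs labelled by $x_0$ may be forgotten. Let $C(M,N)(X)$ be the quotient of $C(M;X)$ identifying two elements whose labelled trees located at points of $M-N$ coincide. Let $F_n^*(X)=\coprod_kF_n(k)\times_{\Sigma_k}X^k/\!\sim$, where again twigs labelled by $x_0$ are forgotten. Grafting of trees gives $\lambda:C(M,N)F_n^*(X)\to C(M,N)(X)$. For an $n$-monoid $(A,\rho)$, $C(M,N;A)$ is the coequalizer of $C(M,N)(\rho),\lambda_A: C(M,N)(F_n^*(A))\rightrightarrows C(M,N)(A)$. Stasheff's construction. For $r,s\ge2$ and $1\le j\le r$ let $\circ_j:K_r\times K_s\to K_{r+s-1}$ be the face maps (partial compositions), and let $\sigma_i:K_k\to K_{k-1}$ be the degeneracies (composition with $K_0$ at the $i$-th input). $B(A)$ is the quotient of $\coprod_{k\ge2}K_k\times A^{k-2}$, whose elements are written $(\kappa;a_2,\dots,a_{k-1})$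 (inputs $2,\dots,k-1$ labelled, inputs $1$ and $k$ unlabelled), by the relations, for $k=r+s-1$: (i) $(\kappa\circ_j\kappa';a_2,\dots,a_{k-1})\sim(\kappa;a_2,\dots,a_{j-1},m_s(\kappa';a_j,\dots,a_{j+s-1}),a_{j+s},\dots,a_{k-1})$ for $1<j<r$; (ii) $(\kappa\circ_1\kappa';a_2,\dots,a_{k-1})\sim(\kappa;a_{s+1},\dots,a_{k-1})$ and $(\kappa\circ_r\kappa';a_2,\dots,a_{k-1})\sim(\kappa;a_2,\dots,a_{r-1})$; (iii) if $a_i=a_0$ is the base point for some $2\le i\le k-1$, then $(\kappa;a_2,\dots,a_{k-1})\sim(\sigma_i\kappa;a_2,\dots,\widehat{a_i},\dots,a_{k-1})$. $E(A)$ is the quotient of $\coprod_{k\ge2}K_k\times A^{k-1}$, with elements $(\kappa;a_2,\dots,a_k)$ (input $k$ is now also labelled), by the analogous relations: (i) for all $1<j\le r$, the first relation of (ii) (the block containing input $1$ is discarded), and (iii) for $2\le i\le k-1$. The arrow $E(A)\to B(A)$ forgets the last label $a_k$. *)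

(* Defs.v *)
From HB Require Import structures.
From mathcomp Require Import all_boot all_order all_algebra all_fingroup.
From mathcomp Require Import generic_quotient.
From mathcomp Require Import zify.
From mathcomp Require Import all_classical all_reals topology normedtype.

Set Implicit Arguments.
Unset Strict Implicit.
Unset Printing Implicit Defensive.

Import Order.TTheory GRing.Theory Num.Theory.
Import numFieldNormedType.Exports.

Local Open Scope classical_set_scope.
Local Open Scope ring_scope.

Lemma cvg_prod_topology (X : Type) (F : set_system X) (FF : Filter F) (I : Type)
    (K : I -> topologicalType) (f : X -> prod_topology K) (l : prod_topology K) :
  (forall i, f x i @[x --> F] --> l i) -> f @ F --> l.
Proof.
move=> cvf; apply/cvg_sup => i U [V [[W oW <-] Wl] WU].
exact: (filterS WU) (cvf i _ (open_nbhs_nbhs (conj oW Wl))).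
Qed.

Lemma continuous_prod_topology (X : topologicalType) (I : Type)
    (K : I -> topologicalType) (f : X -> prod_topology K) :
  (forall i, continuous (fun x => f x i)) -> continuous f.
Proof. by move=> cf x; apply: cvg_prod_topology => i; exact: cf. Qed.

Lemma continuous_coord (I : Type) (K : I -> topologicalType) i :
  continuous (fun f : prod_topology K => f i).
Proof. exact: (@proj_continuous {classic I} K i). Qed.

Lemma image_closure (X Y : topologicalType) (f : X -> Y) (A : set X) (B : set Y)
    (x : X) : continuous f -> (forall a, A a -> closure B (f a)) ->
  closure A x -> closure B (f x).
Proof.
move=> cf AB Ax.
have cB : closed (f @^-1` closure B).
  by apply: preimage_closed => [y _|]; [exact: cf|exact: closed_closure].
by apply: cB; exact: (closure_subset AB) Ax.
Qed.

Section Configurations.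
Variable R : realType.

(* A configuration of points indexed by T: the macroscopic locations, and for
   each S with at least two elements a point of the exceptional divisor
   S(R^S / diagonal) = (R^S - diagonal) / G(1).  A class modulo translations
   and positive dilatations is represented by its unique member with minimum 0
   and maximum 1.  A point of the oriented blow-up of R^S along the diagonal is
   a pair (x, u) in R^S x S(R^S / diagonal) with x in the ray of u modulo the
   diagonal; in C_k its component x is the restriction of the locations to S,
   so only u is recorded.  The entries of u outside S, and all entries when S
   has fewer than two elements, are 0. *)
Definition conf (T : finType) : topologicalType :=
  ({ptws T -> R} * prod_topology (fun _ : {set T} => {ptws T -> R}))%type.

Definition direction (T : finType) (x : T -> R) (S : {set T}) (i : T) : R :=
  if (1 < #|S|)%N && (i \in S)
  then (x i - \big[Order.min/x i]_(j in S) x j) /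
       (\big[Order.max/x i]_(j in S) x j - \big[Order.min/x i]_(j in S) x j)
  else 0.

Definition config_of (T : finType) (x : T -> R) : conf T := (x, direction x).

Definition distinct_configs (T : finType) : set (conf T) :=
  [set config_of x | x in [set x : T -> R | injective x]].

(* Configurations in C_T(R) macroscopically located in L: this is C_k(I) for
   L = I embedded in the line, and F_1(k) = b^-1(0,..,0) for L = {0}. *)
Definition FM (L : set R) (T : finType) : set (conf T) :=
  [set c | closure (distinct_configs (T := T)) c /\ forall i, L (c.1 i)].

(* For injective f: twig i of the result is twig f i of c, and the twigs of c
   that are not in the image of f are forgotten. *)
Definition pull_raw (T' T : finType) (f : T' -> T) (c : conf T) : conf T' :=
  (c.1 \o f, fun (S : {set T'}) i => if i \in S then c.2 (f @: S) (f i) else 0).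

(* The root tree of d i is grafted on twig i of c.  If S meets several of the
   grafted trees, its points are seen as the points of c they are grafted on,
   possibly with multiplicities, which do not change minimum and maximum. *)
Definition graft_raw (T : finType) (J : T -> finType) (c : conf T)
    (d : forall i, conf (J i)) : conf {i : T & J i} :=
  (fun s => c.1 (tag s),
   fun (S : {set {i : T & J i}}) s =>
     if s \notin S then 0
     else if (1 < #|tag @: S|)%N
     then c.2 (tag @: S) (tag s)
     else (d (tag s)).2 [set j | Tagged J j \in S]%SET (tagged s)).

Lemma cvg_conf (X : Type) (F : set_system X) (FF : Filter F) (T : finType)
    (f : X -> conf T) (l : conf T) :
  (forall i, (f x).1 i @[x --> F] --> l.1 i) ->
  (forall S i, (f x).2 S i @[x --> F] --> l.2 S i) -> f @ F --> l.
Proof.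
move=> f1 f2.
have c1 : (fun x => (f x).1) @ F --> l.1.
  exact: (@cvg_prod_topology X F FF T (fun=> R) (fun x => (f x).1) l.1).
have c2 : (fun x => (f x).2) @ F --> l.2.
  apply: (@cvg_prod_topology X F FF _ (fun=> {ptws T -> R}) (fun x => (f x).2)).
  move=> S.
  exact: (@cvg_prod_topology X F FF T (fun=> R) (fun x => (f x).2 S) (l.2 S)).
have -> : f = fun x => ((f x).1, (f x).2) by apply/funext => x; case: (f x).
have := @cvg_pair _ _ _ F (nbhs l.1) (nbhs l.2) FF _ _ _ _ c1 c2.
by case: l {f1 f2 c1 c2} => l1 l2 /=; apply.
Qed.

Lemma continuous_location (T : finType) i : continuous (fun c : conf T => c.1 i).
Proof.
move=> c; apply: (@continuous_comp (conf T) {ptws T -> R} R fst (fun x => x i)).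
  exact: cvg_fst.
exact: (@continuous_coord _ (fun=> R)).
Qed.

Lemma continuous_screen (T : finType) (S : {set T}) i :
  continuous (fun c : conf T => c.2 S i).
Proof.
move=> c; pose Y := prod_topology (fun _ : {set T} => {ptws T -> R}).
apply: (@continuous_comp (conf T) Y R snd (fun x => x S i)).
  exact: cvg_snd.
apply: (@continuous_comp Y {ptws T -> R} R (fun x => x S) (fun x => x i)).
  exact: (@continuous_coord _ (fun=> {ptws T -> R})).
exact: (@continuous_coord _ (fun=> R)).
Qed.

Lemma continuous_conf (X : topologicalType) (T : finType) (f : X -> conf T) :
  (forall i, continuous (fun x => (f x).1 i)) ->
  (forall S i, continuous (fun x => (f x).2 S i)) -> continuous f.
Proof.
move=> f1 f2 x; apply: (@cvg_conf X (nbhs x) _ T f (f x)).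
  by move=> i; exact: f1.
by move=> S i; exact: f2.
Qed.

Lemma pull_raw_continuous (T' T : finType) (f : T' -> T) :
  continuous (@pull_raw T' T f).
Proof.
apply: continuous_conf => [i|S i]; first exact: (@continuous_location T (f i)).
rewrite /pull_raw /=; case: (i \in S); last exact: (@cst_continuous _ R 0).
exact: (@continuous_screen T (f @: S) (f i)).
Qed.

Lemma graft_raw_continuous_l (T : finType) (J : T -> finType)
    (d : forall i, conf (J i)) : continuous (fun c : conf T => graft_raw c d).
Proof.
apply: continuous_conf => [i|S i].
  exact: (@continuous_location T (tag i)).
rewrite /graft_raw /=; case: (i \notin S); first exact: (@cst_continuous _ R 0).
case: (1 < _)%N; last exact: (@cst_continuous _ R).
exact: (@continuous_screen T (tag @: S) (tag i)).
Qed.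

Lemma graft_raw_continuous_r (T : finType) (J : T -> finType) (c : conf T) :
  continuous (fun d : prod_topology (fun i => conf (J i)) => graft_raw c d).
Proof.
apply: continuous_conf => [i|S i]; first exact: (@cst_continuous _ R).
rewrite /graft_raw /=; case: (i \notin S); first exact: (@cst_continuous _ R 0).
case: (1 < _)%N => d; first exact: (@cst_continuous _ R).
apply: (@continuous_comp _ (conf (J (tag i))) R
  (fun d : prod_topology (fun i => conf (J i)) => d (tag i))
  (fun c => c.2 [set j | Tagged J j \in S]%SET (tagged i))).
  exact: (@continuous_coord _ (fun i => conf (J i))).
exact: continuous_screen.
Qed.

Lemma bigmin_imset (T' T : finType) (f : T' -> T) (x : T -> R) (S : {set T'}) i :
  \big[Order.min/x (f i)]_(j in f @: S) x j =
  \big[Order.min/x (f i)]_(j in S) x (f j).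
Proof.
apply/eqP; rewrite eq_le; apply/andP; split; apply/bigmin_geP; split.
- exact: bigmin_le_id.
- by move=> j jS; apply: bigmin_le_cond; exact: imset_f.
- exact: bigmin_le_id.
- by move=> _ /imsetP[j jS ->]; exact: bigmin_le_cond.
Qed.

Lemma bigmax_imset (T' T : finType) (f : T' -> T) (x : T -> R) (S : {set T'}) i :
  \big[Order.max/x (f i)]_(j in f @: S) x j =
  \big[Order.max/x (f i)]_(j in S) x (f j).
Proof.
apply/eqP; rewrite eq_le; apply/andP; split; apply/bigmax_leP; split.
- exact: bigmax_ge_id.
- by move=> _ /imsetP[j jS ->]; exact: (@le_bigmax_cond _ _ _ _ j).
- exact: bigmax_ge_id.
- by move=> j jS; apply: le_bigmax_cond; exact: imset_f.
Qed.

Lemma direction_affine (T : finType) (x y : T -> R) (c t : R) (S : {set T}) i :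
  0 < t -> (forall j, j \in S -> y j = c + t * x j) ->
  direction y S i = direction x S i.
Proof.
move=> t0 yE; rewrite /direction; case: ifP => // /andP[_ iS].
have -> : \big[Order.min/y i]_(j in S) y j =
    c + t * \big[Order.min/x i]_(j in S) x j.
  rewrite (yE _ iS) (eq_bigr _ yE).
  apply: (big_ind2 (fun a b => a = c + t * b)) => // a b a' b' -> ->.
  by rewrite -addr_minr minr_pMr // ltW.
have -> : \big[Order.max/y i]_(j in S) y j =
    c + t * \big[Order.max/x i]_(j in S) x j.
  rewrite (yE _ iS) (eq_bigr _ yE).
  apply: (big_ind2 (fun a b => a = c + t * b)) => // a b a' b' -> ->.
  by rewrite -addr_maxr maxr_pMr // ltW.
have affB a b : c + t * a - (c + t * b) = t * (a - b).
  by rewrite opprD addrACA subrr add0r mulrBr.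
by rewrite (yE _ iS) !affB -mulf_div divff ?mul1r // gt_eqF.
Qed.

Lemma direction_imset (T' T : finType) (f : T' -> T) (x : T -> R)
    (S : {set T'}) i : (1 < #|f @: S|)%N -> i \in S ->
  direction (x \o f) S i = direction x (f @: S) (f i).
Proof.
move=> fS iS; rewrite /direction fS iS imset_f //=.
by rewrite (leq_trans fS (leq_imset_card _ _)) bigmin_imset bigmax_imset.
Qed.

Lemma direction_embed (T' T : finType) (f : T' -> T) (x : T -> R) :
  injective f ->
  direction (x \o f) = fun S i => if i \in S then direction x (f @: S) (f i) else 0.
Proof.
move=> finj; apply/funext => S; apply/funext => i; case: ifP => iS; last first.
  by rewrite /direction iS andbF.
case: (ltnP 1 #|S|) => [S1|S1]; last first.
  by rewrite /direction card_imset // ltnNge S1.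
by apply: direction_imset => //; rewrite card_imset.
Qed.

Lemma pull_raw_config_of (T' T : finType) (f : T' -> T) (x : T -> R) :
  injective f -> pull_raw f (config_of x) = config_of (x \o f).
Proof. by move=> finj; rewrite /pull_raw /config_of /= direction_embed. Qed.

Lemma FM_pull (L : set R) (T' T : finType) (f : T' -> T) (c : conf T) :
  injective f -> FM L c -> FM L (pull_raw f c).
Proof.
move=> finj [Dc Lc]; split; last by move=> i; exact: Lc.
apply: (image_closure (@pull_raw_continuous _ _ f)) Dc => _ [x xinj <-].
apply: subset_closure; rewrite pull_raw_config_of //.
by exists (x \o f) => //; exact: inj_comp.
Qed.

Lemma bigmin_cvg (X : Type) (F : set_system X) (FF : Filter F) (I : finType)
    (P : pred I) (x : X -> I -> R) (l : I -> R) i :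
  (forall j, x t j @[t --> F] --> l j) ->
  \big[Order.min/x t i]_(j | P j) x t j @[t --> F] -->
    \big[Order.min/l i]_(j | P j) l j.
Proof.
move=> xl; rewrite [X in _ --> X](_ : _ = \big[Order.min/l i]_(j <- enum P) l j).
  rewrite (_ : (fun t => _) = fun t => \big[Order.min/x t i]_(j <- enum P) x t j).
    elim: (enum P) => [|j s IH].
      by under eq_fun do rewrite big_nil; rewrite big_nil; exact: xl.
    under eq_fun do rewrite big_cons; rewrite big_cons.
    apply: (@continuous2_cvg _ R R R F FF _ _ (fun a b => Order.min a b)) => //.
    exact: (@min_continuous _ R (l j, _)).
  by apply/funext => t; rewrite big_enum.
by rewrite big_enum.
Qed.

Lemma bigmax_cvg (X : Type) (F : set_system X) (FF : Filter F) (I : finType)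
    (P : pred I) (x : X -> I -> R) (l : I -> R) i :
  (forall j, x t j @[t --> F] --> l j) ->
  \big[Order.max/x t i]_(j | P j) x t j @[t --> F] -->
    \big[Order.max/l i]_(j | P j) l j.
Proof.
move=> xl; rewrite [X in _ --> X](_ : _ = \big[Order.max/l i]_(j <- enum P) l j).
  rewrite (_ : (fun t => _) = fun t => \big[Order.max/x t i]_(j <- enum P) x t j).
    elim: (enum P) => [|j s IH].
      by under eq_fun do rewrite big_nil; rewrite big_nil; exact: xl.
    under eq_fun do rewrite big_cons; rewrite big_cons.
    apply: (@continuous2_cvg _ R R R F FF _ _ (fun a b => Order.max a b)) => //.
    exact: (@max_continuous _ R (l j, _)).
  by apply/funext => t; rewrite big_enum.
by rewrite big_enum.
Qed.

Lemma direction_cvg (X : Type) (F : set_system X) (FF : Filter F) (T : finType)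
    (x : X -> T -> R) (l : T -> R) (S : {set T}) i a b :
  a \in S -> b \in S -> l a != l b ->
  (forall j, x t j @[t --> F] --> l j) ->
  direction (x t) S i @[t --> F] --> direction l S i.
Proof.
move=> aS bS lab xl; rewrite /direction; case: ifP => [/andP[_ iS]|_]; last exact: cvg_cst.
apply: cvgM; first by apply: cvgB; [exact: xl|exact: bigmin_cvg].
apply: cvgV; last by apply: cvgB; [exact: bigmax_cvg|exact: bigmin_cvg].
rewrite subr_eq0; apply: contra lab => /eqP mE.
have le1 j : j \in S -> \big[Order.min/l i]_(j in S) l j <= l j.
  by move=> jS; exact: bigmin_le_cond.
have le2 j : j \in S -> l j <= \big[Order.min/l i]_(j in S) l j.
  by move=> jS; rewrite -mE; exact: (@le_bigmax_cond _ _ _ _ j).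
by rewrite eq_le (le_trans (le2 _ aS) (le1 _ bS)) (le_trans (le2 _ bS) (le1 _ aS)).
Qed.

Lemma graft_raw_distinct (T : finType) (J : T -> finType) (x : T -> R)
    (y : forall i, J i -> R) :
  injective x -> (forall i, injective (y i)) ->
  closure (distinct_configs (T := {i : T & J i}))
    (graft_raw (config_of x) (fun i => config_of (y i))).
Proof.
move=> xinj yinj.
pose z (e : R) (s : {i : T & J i}) : R := x (tag s) + e * y (tag s) (tagged s).
have zl s : z e s @[e --> (0:R)^'+] --> x (tag s).
  rewrite -[X in _ --> X]addr0 -[X in _ + X](mul0r (y (tag s) (tagged s))).
  apply: cvg_at_right_filter.
  apply: cvgD; first exact: cvg_cst.
  by apply: cvgM; [exact: cvg_id|exact: cvg_cst].
apply: (@closed_cvg _ _ (0:R)^'+ _ (fun e => config_of (z e)) _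
  (@closed_closure _ _)).
  suff : \forall e \near (0:R)^'+, forall p : {i & J i} * {i & J i},
      p.1 != p.2 -> z e p.1 != z e p.2.
    apply: filterS => e zne; apply: subset_closure; exists (z e) => // s s' /eqP.
    by have := zne (s, s'); case: eqVneq => //= _ /(_ isT)/negbTE ->.
  apply: filter_forall => -[s s'] /=.
  have [tE|tN] := eqVneq (tag s) (tag s').
    near=> e; case: s s' tE => i j [i' j'] /= ii'; case: _ / ii' j' => j' sN.
    have e0 : 0 < e by near: e; exact: nbhs_right_gt.
    rewrite /z /= (inj_eq (addrI _)) (inj_eq (mulfI (lt0r_neq0 e0))).
    by rewrite (inj_eq (yinj _)); apply: contra sN => /eqP ->.
  have xN : x (tag s) - x (tag s') != 0 by rewrite subr_eq0 (inj_eq xinj).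
  have /cvgr_neq0 : z e s - z e s' @[e --> (0:R)^'+] --> x (tag s) - x (tag s').
    by apply: cvgB.
  by move=> /(_ xN); apply: filterS => e; rewrite subr_eq0.
apply: (@cvg_conf _ (0:R)^'+ _ _ (fun e => config_of (z e))) => [s|S s] /=.
  exact: zl.
have [sS|sS] := boolP (s \in S); last first.
  by apply: cvg_near_cst; near=> e; rewrite /direction (negbTE sS) andbF.
case: ifP => [S1|S1] /=.
  rewrite -(direction_imset x S1 sS).
  have /card_gt1P [_ [_ [/imsetP[a aS ->] /imsetP[b bS ->] ab]]] := S1.
  by apply: (direction_cvg _ aS bS) => //=; rewrite (inj_eq xinj).
have tS s' : s' \in S -> tag s' = tag s.
  move=> s'S; apply/eqP; apply: contraFT S1 => ss'; apply/card_gt1P.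
  by exists (tag s'), (tag s); split=> //; exact: imset_f.
apply: cvg_near_cst; near=> e.
have e0 : 0 < e by near: e; exact: nbhs_right_gt.
set S' := [set j | Tagged J j \in S]%SET.
have TI : injective (Tagged J (i := tag s)).
  by move=> j j' /eqP; rewrite eq_Tagged /= => /eqP.
have SE : Tagged J (i := tag s) @: S' = S.
  apply/setP => -[i j]; apply/imsetP/idP => [[j']|ijS].
    by rewrite inE => ? ->.
  have /= ii' := tS _ ijS; case: _ / (esym ii') j ijS => j ijS.
  by exists j; rewrite ?inE.
have sS' : tagged s \in S' by rewrite inE; case: (s) sS.
have := direction_embed (z e) TI => /(congr1 (fun g => g S' (tagged s))).
rewrite sS' SE (_ : Tagged _ _ = s); last by case: (s).
move=> <-; apply: (@direction_affine _ _ _ (x (tag s)) e) => // j _.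
Unshelve. all: by end_near. Qed.

Lemma graft_raw_closure (T : finType) (J : T -> finType) (c : conf T)
    (d : forall i, conf (J i)) :
  closure (distinct_configs (T := T)) c ->
  (forall i, closure (distinct_configs (T := J i)) (d i)) ->
  closure (distinct_configs (T := {i : T & J i})) (graft_raw c d).
Proof.
move=> Dc Dd.
suff : forall (s : seq T) (d : forall i, conf (J i)),
    (forall i, closure (distinct_configs (T := J i)) (d i)) ->
    (forall i, i \notin s -> distinct_configs (d i)) ->
  closure (distinct_configs (T := {i : T & J i})) (graft_raw c d).
  by move/(_ (enum T)); apply => // i; rewrite mem_enum.
elim=> [|i0 s IH] {}d {}Dd Ds.
  apply: (image_closure (@graft_raw_continuous_l _ _ d)) Dc => _ [x xinj <-].
  have yP i : {y : J i -> R | injective y /\ config_of y = d i}.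
    by apply: cid; have [//|y yinj yE] := Ds i; exists y.
  rewrite (_ : d = fun i => config_of (sval (yP i))).
    by apply: graft_raw_distinct => // i; case: (yP i) => y [].
  by apply: functional_extensionality_dep => i; case: (yP i) => y [].
rewrite (_ : d = dfwith d i0 (d i0)); last first.
  by apply: functional_extensionality_dep => i; case: dfwithP.
apply: (@image_closure _ _ (fun e : conf (J i0) => graft_raw c (dfwith d i0 e))
  _ _ _ _ _ (Dd i0)).
  move=> e; apply: (@continuous_comp _ (prod_topology (fun i => conf (J i))) _
    (dfwith d i0) (fun d => graft_raw c d)).
    exact: (@dfwith_continuous _ (fun i => conf (J i))).
  exact: graft_raw_continuous_r.
move=> e De /=; apply: IH => i; case: dfwithP => //.
- exact: subset_closure.
- by move=> i' ii' i's; apply: Ds; rewrite inE eq_sym (negbTE ii').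
Qed.

Lemma FM_graft (L L' : set R) (T : finType) (J : T -> finType) (c : conf T)
    (d : forall i, conf (J i)) :
  FM L c -> (forall i, FM L' (d i)) -> FM L (graft_raw c d).
Proof.
move=> [Dc Lc] Dd; split; last by move=> s; exact: Lc.
by apply: graft_raw_closure => // i; case: (Dd i).
Qed.

(* The locations are read off from the class of the whole configuration, so the
   first point is at 0 and the last one at 1, and only the twigs in the image of
   f are kept. *)
Definition rescale_raw (T' T : finType) (f : T' -> T) (c : conf T) : conf T' :=
  (fun i => c.2 [set: T]%SET (f i), (pull_raw f c).2).

Lemma rescale_raw_continuous (T' T : finType) (f : T' -> T) :
  continuous (@rescale_raw T' T f).
Proof.
apply: continuous_conf => [i|S i]; first exact: continuous_screen.
rewrite /rescale_raw /pull_raw /=.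
case: (i \in S); last exact: (@cst_continuous _ R 0).
exact: (@continuous_screen T (f @: S) (f i)).
Qed.

Lemma bigmin_idx (T : finType) (x : T -> R) (S : {set T}) i i' :
  i \in S -> i' \in S ->
  \big[Order.min/x i]_(j in S) x j = \big[Order.min/x i']_(j in S) x j.
Proof.
move=> iS i'S; apply/eqP; rewrite eq_le.
by apply/andP; split; apply/bigmin_geP; split => [|j jS]; apply: bigmin_le_cond.
Qed.

Lemma bigmax_idx (T : finType) (x : T -> R) (S : {set T}) i i' :
  i \in S -> i' \in S ->
  \big[Order.max/x i]_(j in S) x j = \big[Order.max/x i']_(j in S) x j.
Proof.
move=> iS i'S; apply/eqP; rewrite eq_le.
apply/andP; split; apply/bigmax_leP; split => [|j jS];
  by [apply: (@le_bigmax_cond _ _ _ _ i)|apply: (@le_bigmax_cond _ _ _ _ i')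
     |apply: (@le_bigmax_cond _ _ _ _ j)].
Qed.

Lemma direction_itv (T : finType) (x : T -> R) (S : {set T}) i :
  0 <= direction x S i <= 1.
Proof.
rewrite /direction; case: ifP => [/andP[_ iS]|_]; last by rewrite lexx ler01.
set m := \big[Order.min/_]_(_ in _) _; set M := \big[Order.max/_]_(_ in _) _.
have mx : m <= x i by exact: bigmin_le_cond.
have xM : x i <= M by exact: (@le_bigmax_cond _ _ _ _ i).
have [mM|mM] := eqVneq m M; first by rewrite mM subrr invr0 mulr0 lexx ler01.
have Mm0 : 0 < M - m by rewrite subr_gt0 lt_neqAle mM (le_trans mx xM).
by rewrite divr_ge0 ?subr_ge0 ?(le_trans mx xM) //= ler_pdivrMr // mul1r lerB.
Qed.

Lemma screen_itv (T : finType) (c : conf T) (S : {set T}) i :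
  closure (distinct_configs (T := T)) c -> 0 <= c.2 S i <= 1.
Proof.
move=> Dc; have : closure [set r : R | 0 <= r <= 1] (c.2 S i).
  apply: (image_closure (@continuous_screen T S i)) Dc => _ [x _ <-].
  by apply: subset_closure; exact: direction_itv.
rewrite -(closure_id _).1 // (_ : mkset _ = [set` `[0:R, 1]]).
  exact: interval_closed.
by apply/seteqP; split => r /=; rewrite in_itv.
Qed.

Lemma rescale_raw_config_of (T' T : finType) (f : T' -> T) (x : T -> R) :
  injective f -> (1 < #|T|)%N -> injective x ->
  exists2 y : T' -> R, injective y & config_of y = rescale_raw f (config_of x).
Proof.
move=> finj T1 xinj; rewrite -cardsT in T1.
have /card_gt1P [a [b [aT bT ab]]] := T1.
pose m := \big[Order.min/x a]_(j in [set: T]%SET) x j.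
pose M := \big[Order.max/x a]_(j in [set: T]%SET) x j.
have dE i : direction x [set: T]%SET i = (x i - m) / (M - m).
  rewrite /direction T1 inE /=.
  by rewrite (bigmin_idx _ (finset.in_setT i) aT) (bigmax_idx _ (finset.in_setT i) aT).
have mx i : m <= x i by exact: bigmin_le_cond.
have xM i : x i <= M by exact: (@le_bigmax_cond _ _ _ _ i).
have Mm0 : 0 < M - m.
  rewrite subr_gt0 lt_neqAle (le_trans (mx a) (xM a)) andbT.
  apply: contra ab => /eqP mM; apply/eqP/xinj/eqP.
  by rewrite eq_le (le_trans (xM a)) -?mM ?mx //= (le_trans (xM b)) -?mM ?mx.
exists (fun i => direction x [set: T]%SET (f i)).
  move=> i j; rewrite !dE => /(mulIf (invr_neq0 (lt0r_neq0 Mm0))) /addIr.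
  by move=> /xinj /finj.
rewrite /config_of /rescale_raw /=; congr pair.
rewrite -direction_embed //; apply/funext => S; apply/funext => i.
apply: (@direction_affine _ _ _ (- m / (M - m)) (M - m)^-1).
  by rewrite invr_gt0.
by move=> j _ /=; rewrite dE mulrBl mulNr addrC [_^-1 * _]mulrC.
Qed.

Lemma FM_rescale (T' T : finType) (f : T' -> T) (L : set R) (c : conf T) :
  injective f -> (1 < #|T|)%N -> FM L c -> FM `[0, 1] (rescale_raw f c).
Proof.
move=> finj T1 [Dc _]; split; last first.
  by move=> i /=; rewrite in_itv /=; exact: screen_itv.
apply: (image_closure (@rescale_raw_continuous _ _ f)) Dc => _ [x xinj <-].
apply: subset_closure.
by have [y yinj yE] := rescale_raw_config_of finj T1 xinj; exists y.
Qed.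

Lemma FM_empty (L : set R) :
  FM L ((fun=> 0, fun _ : {set 'I_0} => fun=> 0) : conf 'I_0).
Proof.
split=> [|[]//]; apply: subset_closure; exists (fun=> 0) => [[]//|].
by congr pair; apply/funext => S; apply/funext => -[].
Qed.

Definition in_order k (c : conf 'I_k) : Prop :=
  forall i j : 'I_k, (i < j)%N ->
    c.2 [set i; j]%SET i < c.2 [set i; j]%SET j.

End Configurations.
Arguments conf R T : clear implicits.
Arguments FM {R} L T _.

Section Operad.
Variable R : realType.

Definition FM1 (k : nat) : set (conf R 'I_k) := FM [set 0] 'I_k.

Arguments FM1 k _ : clear implicits.

Definition fm_pull (L : set R) (T' T : finType) (f : T' -> T)
    (finj : injective f) (c : FM L T) : FM L T' :=
  exist _ (pull_raw f (val c)) (mem_set (FM_pull finj (set_valP c))).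

Definition fm_graft (L : set R) (T : finType) (J : T -> finType) (c : FM L T)
    (d : forall i, FM [set (0 : R)] (J i)) : FM L {i : T & J i} :=
  exist _ (graft_raw (val c) (fun i => val (d i)))
    (mem_set (FM_graft (set_valP c) (fun i => set_valP (d i)))).

(* Operadic composition; tagnat.sig numbers the twigs of the result
   lexicographically. *)
Definition fm_comp (L : set R) k (p : 'I_k -> nat) (c : FM L 'I_k)
    (d : forall i, FM1 (p i)) : FM L 'I_(\sum_i p i)%N :=
  fm_pull (@tagnat.sig_inj k p) (fm_graft (J := fun i => 'I_(p i)) c d).

Definition fm_empty (L : set R) : FM L 'I_0 :=
  exist (fun c => c \in FM L 'I_0) _ (mem_set (FM_empty L)).

(* F_1(k) = K_k x Sigma_k: the associahedron K_k is the part of F_1(k) where the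
   numbering of the twigs is their order on the line. *)
Definition assoc (k : nat) : set (conf R 'I_k) :=
  [set c | FM1 k c /\ in_order c].

Arguments assoc k _ : clear implicits.

Definition assoc_FM1 k (c : assoc k) : FM1 k :=
  exist _ (val c) (mem_set (set_valP c).1).

Lemma in_order_pull k k' (f : 'I_k' -> 'I_k) (c : conf R 'I_k) :
  {homo f : i j / (i < j)%N} -> in_order c -> in_order (pull_raw f c).
Proof.
move=> fmon co i j ij /=; rewrite !inE !eqxx orbT /=.
by rewrite imsetU1 imset_set1; apply: co; exact: fmon.
Qed.

Lemma assoc_pull k k' (f : 'I_k' -> 'I_k) (c : conf R 'I_k) :
  {homo f : i j / (i < j)%N} -> assoc k c -> assoc k' (pull_raw f c).
Proof.
move=> fmon [Fc co]; split; last exact: in_order_pull.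
apply: FM_pull Fc => i j fij; apply/val_inj => /=.
by case: (ltngtP i j) => // /fmon; rewrite fij ltnn.
Qed.

Lemma lift_homo k (i : 'I_k.+1) : {homo lift i : j j' / (j < j')%N}.
Proof.
have bumpS h a b : (a < b)%N -> (bump h a < bump h b)%N.
  by rewrite /bump; case: (leqP h a); case: (leqP h b) => /=; lia.
by move=> j j' jj'; exact: bumpS.
Qed.

(* sigma_(i+1), for the 0-based input i *)
Definition assoc_degen k (i : 'I_k.+1) (c : assoc k.+1) : assoc k :=
  exist (fun c => c \in assoc k) _
    (mem_set (assoc_pull (@lift_homo k i) (set_valP c))).

(* assoc_comp c d is the composition of c and d at the (0-based) input j.  It is
   obtained by grafting a copy of d on every twig of c and forgetting all twigs
   but one of the copies on the twigs other than j; face_index gives the twigs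
   that are kept. *)
Definition face_index r s (j : 'I_r.+2) (i : 'I_(r + s).+3) :
    {i : 'I_r.+2 & 'I_s.+2} :=
  if (i < j)%N then existT (fun=> 'I_s.+2) (inord i) ord0
  else if (i < j + s.+2)%N then existT (fun=> 'I_s.+2) j (inord (i - j))
  else existT (fun=> 'I_s.+2) (inord (i - s.+1)) ord0.

Lemma face_index_lt r s (j : 'I_r.+2) (i i' : 'I_(r + s).+3) : (i < i')%N ->
  (tag (face_index j i) < tag (face_index j i'))%N \/
  (tag (face_index j i) = tag (face_index j i') /\
   (tagged (face_index j i) < (tagged (face_index j i') : 'I_s.+2))%N).
Proof.
move=> ii'; have := ltn_ord i'; have := ltn_ord j; rewrite /face_index => jr i's.
case: ifP => i1; case: ifP => i2; try case: ifP => i3; try case: ifP => i4;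
  rewrite /= ?inordK; try lia; by [left; lia|right; split=> //; lia].
Qed.

Lemma face_index_inj r s (j : 'I_r.+2) : injective (@face_index r s j).
Proof.
move=> i i' ii'; apply/val_inj => /=.
by case: (ltngtP i i') => // /(face_index_lt j); rewrite ii' => -[|[_]]; rewrite ltnn.
Qed.

Lemma assoc_comp_subproof r s (j : 'I_r.+2) (c : assoc r.+2) (d : assoc s.+2) :
  assoc (r + s).+3 (pull_raw (@face_index r s j)
    (graft_raw (val c) (fun _ : 'I_r.+2 => val d))).
Proof.
have [[Fc co] [Fd d_o]] := (set_valP c, set_valP d).
split; first by apply: FM_pull (FM_graft Fc (fun=> Fd)); exact: face_index_inj.
move=> i i' ii' /=; rewrite !inE !eqxx orbT /= imsetU1 imset_set1.
rewrite !inE !eqxx orbT /= imsetU1 imset_set1.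
have [lt_tag|[eq_tag lt_tagged]] := face_index_lt j ii'.
  rewrite cards2 neq_ltn lt_tag /=; exact: co.
rewrite eq_tag finset.setUid cards1 /=.
move: eq_tag lt_tagged; case: (face_index j i) => t a; case: (face_index j i') => t' a' /=.
move=> -> aa'; rewrite (_ : finset _ = [set a; a']%SET); first exact: d_o.
by apply/setP => b; rewrite !inE -!/(Tagged _ _) !eq_Tagged.
Qed.

Definition assoc_comp r s (j : 'I_r.+2) (c : assoc r.+2) (d : assoc s.+2) :
    assoc (r + s).+3 :=
  exist (fun c => c \in assoc (r + s).+3) _
    (mem_set (assoc_comp_subproof j c d)).

End Operad.
Arguments FM1 R k _ : clear implicits.
Arguments assoc R k _ : clear implicits.

Definition k_open (X : topologicalType) (U : set X) : Prop :=
  forall (K : topologicalType) (f : K -> X), compact [set: K] ->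
    hausdorff_space K -> continuous f -> open (f @^-1` U).

Definition compactly_generated (X : topologicalType) : Prop :=
  forall U : set X, k_open U -> open U.

Definition weak_hausdorff (X : topologicalType) : Prop :=
  forall (K : topologicalType) (f : K -> X), compact [set: K] ->
    hausdorff_space K -> continuous f -> closed (range f).

Definition cgwh (X : topologicalType) : Prop :=
  compactly_generated X /\ weak_hausdorff X.

Definition kification (X : Type) : Type := X.

Section Kification.
Variable X : topologicalType.

Lemma k_openT : k_open [set: X].
Proof. by move=> K f _ _ _; rewrite preimage_setT; exact: openT. Qed.

Lemma k_openI : setI_closed (@k_open X).
Proof.
by move=> U V kU kV K f cK hK cf; apply: openI; [exact: kU|exact: kV].
Qed.

Lemma k_open_bigU (I : Type) (U : I -> set X) :
  (forall i, k_open (U i)) -> k_open (\bigcup_i U i).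
Proof.
move=> kU K f cK hK cf; rewrite preimage_bigcup.
by apply: bigcup_open => i _; exact: kU.
Qed.

HB.instance Definition _ := Choice.on (kification X).
HB.instance Definition _ := isOpenTopological.Build (kification X)
  k_openT k_openI k_open_bigU.

End Kification.

(* The quotient of X by r in the category of compactly generated weak Hausdorff
   spaces, for X compactly generated: the quotient by the smallest equivalence
   relation that contains r and has a weak Hausdorff quotient. *)
Section Quotient.
Variables (X : topologicalType) (r : X -> X -> Prop).
Local Open Scope quotient_scope.

Definition cgwh_eq : rel X := fun x y =>
  `[< forall e : equiv_rel X, (forall u v, r u v -> e u v) ->
        weak_hausdorff (quotient_topology {eq_quot e}) -> e x y >].

Lemma cgwh_eq_refl : reflexive cgwh_eq.
Proof. by move=> x; apply/asboolP => e _ _; exact: equiv_refl. Qed.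

Lemma cgwh_eq_sym : symmetric cgwh_eq.
Proof.
by move=> x y; apply/idP/idP => /asboolP xy; apply/asboolP => e re we;
  rewrite equiv_sym; exact: xy.
Qed.

Lemma cgwh_eq_trans : transitive cgwh_eq.
Proof.
move=> y x z /asboolP xy /asboolP yz; apply/asboolP => e re we.
by apply: (equiv_trans (xy e re we)); exact: yz.
Qed.

Definition cgwh_equiv : equiv_rel X :=
  EquivRel cgwh_eq cgwh_eq_refl cgwh_eq_sym cgwh_eq_trans.

Definition cgwh_quotient : topologicalType :=
  quotient_topology {eq_quot cgwh_equiv}.

Definition cls (x : X) : cgwh_quotient := \pi_(quotient_topology {eq_quot cgwh_equiv}) x.

Definition representative (q : cgwh_quotient) : X :=
  generic_quotient.repr (q : quotient_topology {eq_quot cgwh_equiv}).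

End Quotient.

Definition homeomorphism (X Y : topologicalType) (f : X -> Y) : Prop :=
  continuous f /\ exists g : Y -> X, [/\ continuous g, cancel f g & cancel g f].

Section Cofibrations.
Variable R : realType.

Definition disk n : set {ptws 'I_n -> R} := [set x | \sum_i x i ^+ 2 <= 1].

Definition sphere n : set {ptws 'I_n -> R} := [set x | \sum_i x i ^+ 2 = 1].

Arguments disk n _ : clear implicits.
Arguments sphere n _ : clear implicits.

Definition attaches_cells (X Y : topologicalType) (i : X -> Y) : Prop :=
  exists (I : Type) (n : I -> nat) (phi : forall a, sphere (n a) -> X)
      (Phi : forall a, disk (n a) -> Y),
    [/\ continuous i, forall a, continuous (phi a),
        forall a, continuous (Phi a),
        forall a u v, val u = val v -> i (phi a u) = Phi a v &
        forall (Z : topologicalType) (g : X -> Z) (h : forall a, disk (n a) -> Z),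
          cgwh Z -> continuous g -> (forall a, continuous (h a)) ->
          (forall a u v, val u = val v -> g (phi a u) = h a v) ->
          exists! q : Y -> Z,
            [/\ continuous q, q \o i = g & forall a, q \o Phi a = h a]].

Definition generalized_relative_CW (X Y : topologicalType) (i : X -> Y) : Prop :=
  exists (Y_ : nat -> topologicalType) (s : forall m, Y_ m -> Y_ m.+1)
      (c : forall m, Y_ m -> Y) (h : X -> Y_ 0%N),
    [/\ [/\ forall m, cgwh (Y_ m), forall m, attaches_cells (s m) &
            homeomorphism h],
        forall m, continuous (c m), forall m, c m.+1 \o s m = c m,
        c 0%N \o h = i &
        forall (Z : topologicalType) (g : forall m, Y_ m -> Z),
          cgwh Z -> (forall m, continuous (g m)) ->
          (forall m, g m.+1 \o s m = g m) ->
          exists! q : Y -> Z, continuous q /\ forall m, q \o c m = g m].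

Definition retract_of (X Y X' Y' : topologicalType) (f : X -> Y) (i : X' -> Y')
    : Prop :=
  exists (s : X -> X') (t : X' -> X) (s' : Y -> Y') (t' : Y' -> Y),
    [/\ [/\ continuous s, continuous t, continuous s' & continuous t'],
        t \o s = id, t' \o s' = id, s' \o f = i \o s & t' \o i = f \o t].

Definition cofibration (X Y : topologicalType) (f : X -> Y) : Prop :=
  exists (X' Y' : topologicalType) (i : X' -> Y'),
    [/\ cgwh X', cgwh Y', generalized_relative_CW i & retract_of f i].

Definition well_pointed (X : topologicalType) (x0 : X) : Prop :=
  cofibration (set_val : [set x0] -> X).

End Cofibrations.
Arguments well_pointed R {X} x0.

Section Labelled.
Variable R : realType.
Implicit Types (L N : set R) (X Y A : topologicalType).

Definition lconf_of_size L X (k : nat) : topologicalType :=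
  (FM L 'I_k * {ptws 'I_k -> X})%type.

Definition lconf L X : topologicalType :=
  kification {k : nat & lconf_of_size L X k}.

Definition lab L X k (c : FM L 'I_k) (x : 'I_k -> X) : lconf L X :=
  existT (lconf_of_size L X) k (c, x).

Definition lab_map L X Y (f : X -> Y) (w : lconf L X) : lconf L Y :=
  lab (projT2 w).1 (f \o (projT2 w).2).

(* Renumber gives the quotient by Sigma_k; together with Forget one obtains
   C(L; X) as CX below, and F_1^*(X) for L = {0}. *)
Variant forget_step L X (x0 : X) : lconf L X -> lconf L X -> Prop :=
| Renumber k (s : 'S_k) (c : FM L 'I_k) (x : 'I_k -> X) :
    forget_step x0 (lab c x) (lab (fm_pull (@perm_inj _ s) c) (x \o s))
| Forget k (i : 'I_k.+1) (c : FM L 'I_k.+1) (x : 'I_k.+1 -> X) :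
    x i = x0 ->
    forget_step x0 (lab c x)
      (lab (fm_pull (@lift_inj _ i) c) (x \o lift i)).

Definition CX L X (x0 : X) : topologicalType :=
  cgwh_quotient (forget_step (L := L) x0).

(* The trees of w located at points outside N. *)
Definition away N L X (w : lconf L X) : lconf L X :=
  let S := [set i | `[< ~ N ((val (projT2 w).1).1 i) >]]%SET in
  lab (fm_pull (@enum_val_inj _ (mem S)) (projT2 w).1)
    ((projT2 w).2 \o enum_val (A := mem S)).

Definition same_away N L X (x0 : X) (u v : CX L x0) : Prop :=
  exists w w' : lconf L X,
    [/\ u = cls _ w, v = cls _ w' &
        cls (forget_step x0) (away N w) = cls (forget_step x0) (away N w')].

Definition CMN L N X (x0 : X) : topologicalType :=
  cgwh_quotient (@same_away N L X x0).

Definition cmn_cls L N X (x0 : X) (w : lconf L X) : CMN L N x0 := cls _ (cls _ w).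

Definition cmn_rep L N X (x0 : X) (u : CMN L N x0) : lconf L X :=
  representative (representative u).

(* F_1^* *)
Definition Fstar X (x0 : X) : topologicalType := CX [set 0] x0.

Definition Fstar_base X (x0 : X) : Fstar x0 :=
  cls _ (lab (fm_empty [set 0]) (fun=> x0)).

(* Maps on quotients are given by their value on a representative; the value
   does not depend on the representative chosen. *)
Definition graft_labels L X (x0 : X) (w : lconf L (Fstar x0)) : lconf L X :=
  let y i := representative ((projT2 w).2 i) in
  lab (fm_comp (projT2 w).1 (fun i => (projT2 (y i)).1))
    (fun s => (projT2 (y (tagnat.sig1 s))).2 (tagnat.sig2 s)).

Definition lambda L N X (x0 : X) (u : CMN L N (Fstar_base x0)) : CMN L N x0 :=
  cmn_cls N x0 (graft_labels (cmn_rep u)).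

Definition cmn_map L N X Y (x0 : X) (y0 : Y) (f : X -> Y) (u : CMN L N x0) :
    CMN L N y0 :=
  cmn_cls N y0 (lab_map f (cmn_rep u)).

End Labelled.

Section Stasheff.
Variables (R : realType) (A : topologicalType).
Variables (rho : forall k, FM1 R k -> ('I_k -> A) -> A) (a0 : A).

Record one_monoid : Prop := OneMonoid {
  monoid_continuous : forall k,
    continuous (fun p : kification (FM1 R k * {ptws 'I_k -> A}) =>
                  rho p.1 p.2);
  monoid_equivariant : forall k (s : 'S_k) (c : FM1 R k) (a : 'I_k -> A),
    rho (fm_pull (@perm_inj _ s) c) (a \o s) = rho c a;
  monoid_unit : forall (c : FM1 R 1) (a : 'I_1 -> A), rho c a = a ord0;
  monoid_comp : forall k (p : 'I_k -> nat) (c : FM1 R k)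
      (d : forall i, FM1 R (p i)) (a : 'I_(\sum_i p i)%N -> A),
    rho (fm_comp c d) a = rho c (fun i => rho (d i) (a \o @tagnat.Rank k p i));
  monoid_base : forall (c : FM1 R 0) (a : 'I_0 -> A), rho c a = a0
}.

Definition rho_star (y : Fstar R a0) : A :=
  rho (projT2 (representative y)).1 (projT2 (representative y)).2.

(* CI N is C(I,N;A), the coequalizer of lambda_A and C(I,N)(rho). *)
Definition coequalized (N : set R) (p q : CMN `[0, 1] N a0) : Prop :=
  exists u : CMN `[0, 1] N (Fstar_base R a0),
    p = lambda u /\ q = cmn_map a0 rho_star u.

Definition CI (N : set R) : topologicalType := cgwh_quotient (@coequalized N).

Definition CI_cls (N : set R) (w : lconf `[0, 1] A) : CI N :=
  cls _ (cmn_cls N a0 w).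

Definition CI_quotient_map (N N' : set R) (u : CI N) : CI N' :=
  CI_cls N' (cmn_rep (representative u)).

Definition structure_map s (c : assoc R s) (a : 'I_s -> A) : A :=
  rho (assoc_FM1 c) a.

(* Replaces the s + 2 labels of the inputs j, .., j + s + 1 by v.  Inputs are
   numbered from 0, and input i > 0 carries the label a (i - 1). *)
Definition splice n n' (a : 'I_n.+1 -> A) (j s : nat) (v : A) (l : 'I_n') : A :=
  if (l.+1 < j)%N then a (inord l)
  else if l.+1 == j then v
  else a (inord (l + s.+1)).

Definition middle m (i : 'I_m) : 'I_m.+2 := lift ord0 (lift ord_max i).

(* In preB and preE, size m means k = m + 2: the labels are a_2, .., a_(k-1) in
   preB and a_2, .., a_k in preE.  In the relations, r and s stand for r - 2
   and s - 2. *)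
Definition preB_of_size (m : nat) : topologicalType :=
  (assoc R m.+2 * {ptws 'I_m -> A})%type.

Definition preB : topologicalType := kification {m : nat & preB_of_size m}.

Definition preB_elt m (c : assoc R m.+2) (a : 'I_m -> A) : preB :=
  existT preB_of_size m (c, a).

Variant B_step : preB -> preB -> Prop :=
| B_inner r s (j : 'I_r.+2) (c : assoc R r.+2) (d : assoc R s.+2)
    (a : 'I_(r + s).+1 -> A) : (0 < j < r.+1)%N ->
    B_step (preB_elt (assoc_comp j c d) a)
      (preB_elt c (splice a j s
        (structure_map d (fun t => a (inord (j.-1 + t))))))
| B_first r s (c : assoc R r.+2) (d : assoc R s.+2) (a : 'I_(r + s).+1 -> A) :
    B_step (preB_elt (assoc_comp ord0 c d) a)
      (preB_elt c (fun l => a (inord (l + s.+1))))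
| B_last r s (c : assoc R r.+2) (d : assoc R s.+2) (a : 'I_(r + s).+1 -> A) :
    B_step (preB_elt (assoc_comp ord_max c d) a)
      (preB_elt c (fun l => a (inord l)))
| B_degen m (i : 'I_m.+1) (c : assoc R m.+3) (a : 'I_m.+1 -> A) : a i = a0 ->
    B_step (preB_elt c a) (preB_elt (assoc_degen (middle i) c) (a \o lift i)).

Definition stasheff_B : topologicalType := cgwh_quotient B_step.

Definition preE_of_size (m : nat) : topologicalType :=
  (assoc R m.+2 * {ptws 'I_m.+1 -> A})%type.

Definition preE : topologicalType := kification {m : nat & preE_of_size m}.

Definition preE_elt m (c : assoc R m.+2) (a : 'I_m.+1 -> A) : preE :=
  existT preE_of_size m (c, a).

Variant E_step : preE -> preE -> Prop :=
| E_inner r s (j : 'I_r.+2) (c : assoc R r.+2) (d : assoc R s.+2)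
    (a : 'I_(r + s).+2 -> A) : (0 < j)%N ->
    E_step (preE_elt (assoc_comp j c d) a)
      (preE_elt c (splice a j s
        (structure_map d (fun t => a (inord (j.-1 + t))))))
| E_first r s (c : assoc R r.+2) (d : assoc R s.+2) (a : 'I_(r + s).+2 -> A) :
    E_step (preE_elt (assoc_comp ord0 c d) a)
      (preE_elt c (fun l => a (inord (l + s.+1))))
| E_degen m (i : 'I_m.+1) (c : assoc R m.+3) (a : 'I_m.+2 -> A) :
    a (lift ord_max i) = a0 ->
    E_step (preE_elt c a)
      (preE_elt (assoc_degen (middle i) c) (a \o lift (lift ord_max i))).

Definition stasheff_E : topologicalType := cgwh_quotient E_step.

Definition universal_arrow (e : stasheff_E) : stasheff_B :=
  let w := representative e in
  cls _ (preB_elt (projT2 w).1 ((projT2 w).2 \o lift ord_max)).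

Lemma middle_inj m : injective (@middle m).
Proof. by move=> i j /lift_inj /lift_inj. Qed.

Lemma card_ord_gt1 m : (1 < #|'I_m.+2|)%N.
Proof. by rewrite card_ord. Qed.

(* The configuration in I underlying the element (c; a) of B(A), resp. E(A): c
   is scaled so that its first and last inputs are at 0 and 1, and the
   unlabelled inputs are forgotten. *)
Definition B_config m (c : assoc R m.+2) : FM `[0 : R, 1] 'I_m :=
  exist (fun c => c \in FM `[0, 1] 'I_m) _
    (mem_set (FM_rescale (@middle_inj m) (card_ord_gt1 m) (set_valP c).1)).

Definition E_config m (c : assoc R m.+2) : FM `[0 : R, 1] 'I_m.+1 :=
  exist (fun c => c \in FM `[0, 1] 'I_m.+1) _
    (mem_set (FM_rescale (@lift_inj _ ord0) (card_ord_gt1 m) (set_valP c).1)).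

End Stasheff.

(* Main.v *)
Require Import Defs.
From mathcomp Require Import all_boot all_order all_algebra all_fingroup.
From mathcomp Require Import generic_quotient zify lra.
From mathcomp Require Import all_classical all_reals topology normedtype.

Set Implicit Arguments.
Unset Strict Implicit.
Unset Printing Implicit Defensive.

Import Order.TTheory GRing.Theory Num.Theory.
Import numFieldNormedType.Exports.

Local Open Scope classical_set_scope.
Local Open Scope ring_scope.

(* A configuration in [0, 1] labelled in A is turned into an element of B(A) by
   adding the end points 0 and 1 as first and last inputs, and forgetting the
   trees located there; for E(A) the product of the labels of the tree located
   at 1 is the label of the last input.  The relations (i), (ii) of Stasheff are
   exactly what makes the result invariant when the trees of a configuration are
   replaced by twigs labelled by the products of their labels, so the
   construction descends to the coequalizer C(I, N; A).  Conversely an element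
   of the associahedron, scaled so that its first and last inputs are at 0 and
   1, is a configuration in [0, 1], and a composition at an input becomes a
   grafting.

   Nothing in the first construction looks continuous when a point of the open
   interval runs into an end point.  But by compactness of the associahedra
   every configuration in [0, 1] is a renumbering of a scaled one, the map from
   these to all configurations is a quotient map, and on the scaled ones the
   construction is the tautological map to B(A) or E(A).  In the other
   direction, lambda is defined by representatives in powers of the quotient
   F_1^*(A), and is continuous because in compactly generated spaces a product
   with a power of a quotient map is a quotient map. *)

(** * Compactly generated spaces *)

(** Quotients are taken by the smallest relation with a weak Hausdorff quotient, so equality of two
    classes is not a chain of elementary steps. It can only be exploited through continuous maps to
    weak Hausdorff spaces ([cls_lift]). Hence even the independence of a grafting from the
    representatives of its labels needs a continuity argument, one label at a time. A second
    obstacle: a scaled configuration is not recovered by adding end points, because twigs located at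
    0 or 1 lie in one tree with the first or last input, and that tree is lost. End points are
    therefore added only to the twigs in the open interval; relation (ii), or (i) at the last input
    for E(A), absorbs the rest. B(A) and E(A) are treated at once through the record [collapsing],
    whose two instances differ in whether the last label counts. Trees are handled by the relation
    [grafted] rather than by operadic composition, since it allows arbitrary numberings and empty
    trees. *)

Lemma compact_set_type (X : topologicalType) (A : set X) :
  compact A -> compact [set: A].
Proof.
move=> cA F FF _.
have [|x [Ax clx]] := cA (set_val @ F) _.
  by apply: (@filterS _ F _ setT) => [a _|]; [exact: set_valP|exact: filterT].
exists (exist (fun x => x \in A) x (mem_set Ax)); split => // U V FU [W [[O oO <-] Ox WV]].
have [||_ [[a Ua <-] Oa]] := clx (set_val @` U) O.
- by apply: (@filterS _ F _ U) => [a Ua|//]; exists a.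
- exact: open_nbhs_nbhs.
by exists a; split => //; exact: WV.
Qed.

Lemma hausdorff_injective (X Y : topologicalType) (f : X -> Y) :
  continuous f -> injective f -> hausdorff_space Y -> hausdorff_space X.
Proof.
move=> cf finj hY x y xy; apply/finj/hY => U V /cf Ux /cf Vy.
by have [z [Uz Vz]] := xy _ _ Ux Vy; exists (f z).
Qed.

Lemma set_val_continuous (X : topologicalType) (A : set X) :
  continuous (set_val : A -> X).
Proof. exact: initial_continuous. Qed.

Lemma continuous_set_type (X Y : topologicalType) (A : set Y) (f : X -> A) :
  continuous (fun x => set_val (f x)) -> continuous f.
Proof.
move=> cf x U [W [[O oO <-] Ox WU]].
apply: (@filterS _ (nbhs x) _ (f @^-1` (set_val @^-1` O))) => [z|]; first exact: WU.
exact: (cf x O (open_nbhs_nbhs (conj oO Ox))).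
Qed.

Lemma hausdorff_set_type (X : topologicalType) (A : set X) :
  hausdorff_space X -> hausdorff_space A.
Proof.
apply: hausdorff_injective; first exact: set_val_continuous.
exact: val_inj.
Qed.

Lemma hausdorff_prod (X Y : topologicalType) :
  hausdorff_space X -> hausdorff_space Y -> hausdorff_space (X * Y)%type.
Proof.
move=> hX hY [x y] [x' y'] xy; congr pair.
  apply: hX => U V Ux Vx.
  have [||z [Uz Vz]] := xy (fst @^-1` U) (fst @^-1` V); last by exists z.1.
    exact: cvg_fst.
  exact: (@cvg_fst _ _ (nbhs x') (nbhs y')).
apply: hY => U V Ux Vx.
have [||z [Uz Vz]] := xy (snd @^-1` U) (snd @^-1` V); last by exists z.2.
  exact: cvg_snd.
exact: (@cvg_snd _ _ (nbhs x') (nbhs y')).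
Qed.

Lemma weak_hausdorff_injective (X Y : topologicalType) (f : X -> Y) :
  continuous f -> injective f -> weak_hausdorff Y -> weak_hausdorff X.
Proof.
move=> cf finj wY K g cK hK cg.
rewrite (_ : range g = f @^-1` range (f \o g)).
  apply: preimage_closed; first by move=> x _; exact: cf.
  by apply: wY => // x; apply: continuous_comp; [exact: cg|exact: cf].
apply/seteqP; split => [_ [k _ <-]|x [k _ /finj <-]]; first by exists k.
by exists k.
Qed.

Lemma weak_hausdorff_image (K Y : topologicalType) (f : K -> Y) (N : set K) :
  compact [set: K] -> hausdorff_space K -> continuous f -> weak_hausdorff Y ->
  closed N -> closed (f @` N).
Proof.
move=> cK hK cf wY cN.
rewrite (_ : f @` N = range (fun n : N => f (set_val n))).
  apply: wY; first exact/compact_set_type/(subclosed_compact cN cK).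
    exact: hausdorff_set_type.
  by move=> x; apply: continuous_comp; [exact: set_val_continuous|exact: cf].
apply/seteqP; split => [_ [k Nk <-]|_ [k _ <-]].
  by exists (exist (fun k => k \in N) k (mem_set Nk)).
by exists (set_val k) => //; exact: set_valP.
Qed.

Lemma weak_hausdorff_closed1 (Y : topologicalType) (y : Y) :
  weak_hausdorff Y -> closed [set y].
Proof.
(* [bool] serves as a nonempty compact Hausdorff test space. *)
move=> wY; rewrite (_ : [set y] = range (fun _ : bool => y)).
  apply: wY; [|exact: discrete_hausdorff|exact: cst_continuous].
  by apply: finite_compact; exact: finite_finset.
by apply/seteqP; split => [_ ->|_ [_ _ <-]//]; exists true.
Qed.

(** * Quotients of compactly generated weak Hausdorff spaces *)

Section CgwhQuotient.
Variables (X : topologicalType) (r : X -> X -> Prop).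
Local Open Scope quotient_scope.

Lemma cls_continuous : continuous (cls r).
Proof. exact: pi_continuous. Qed.

Lemma cls_representative q : cls r (representative q) = q.
Proof. exact: reprK. Qed.

Lemma cls_eqP x y : cls r x = cls r y <-> cgwh_eq r x y.
Proof.
split=> [/eqquotP//|xy].
by apply/eqquotP.
Qed.

Lemma cls_step x y : r x y -> cls r x = cls r y.
Proof. by move=> rxy; apply/cls_eqP/asboolP => e re _; exact: re. Qed.

Lemma cls_surj q : exists x, cls r x = q.
Proof. by exists (representative q); exact: cls_representative. Qed.

Lemma continuous_on_quotient (Z : topologicalType) (f : cgwh_quotient r -> Z) :
  continuous (f \o cls r) -> continuous f.
Proof. by move=> cf; apply/quotient_continuous. Qed.

(** The kernel of [f] is one of the equivalence relations in [cgwh_eq]: it contains [r], and its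
    quotient maps continuously and injectively to [Z]. *)
Lemma cls_lift (Z : topologicalType) (f : X -> Z) :
  continuous f -> weak_hausdorff Z -> (forall x y, r x y -> f x = f y) ->
  forall x y, cls r x = cls r y -> f x = f y.
Proof.
move=> cf wZ rf x y /cls_eqP /asboolP xy.
pose e0 : rel X := fun u v => `[< f u = f v >].
have e0_refl : reflexive e0 by move=> u; exact/asboolP.
have e0_sym : symmetric e0 by move=> u v; apply/asboolP/asboolP.
have e0_trans : transitive e0.
  by move=> v u w /asboolP uv /asboolP vw; apply/asboolP; rewrite uv.
pose e := EquivRel e0 e0_refl e0_sym e0_trans.
have reprE (u : X) : f (repr (\pi_(quotient_topology {eq_quot e}) u)) = f u.
  have : \pi_(quotient_topology {eq_quot e}) (repr (\pi_(quotient_topology {eq_quot e}) u))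
    = \pi_(quotient_topology {eq_quot e}) u by exact: reprK.
  by move=> /eqquotP /asboolP.
apply/asboolP/(xy e) => [u v uv|]; first exact/asboolP/rf.
pose g (q : quotient_topology {eq_quot e}) := f (repr q).
apply: (@weak_hausdorff_injective _ _ g) => //.
  apply/quotient_continuous.
  by rewrite (_ : g \o _ = f) //; apply/funext => u; exact: reprE.
move=> p q pq; rewrite -[p]reprK -[q]reprK.
by apply/eqquotP/asboolP.
Qed.

(** Maps out of quotients are given as [fun q => f (representative q)]; this is their computation
    rule. *)
Lemma cls_rec (Z : topologicalType) (f : X -> Z) :
  continuous f -> weak_hausdorff Z -> (forall x y, r x y -> f x = f y) ->
  forall x, f (representative (cls r x)) = f x.
Proof. by move=> cf wZ rf x; apply: cls_lift => //; exact: cls_representative. Qed.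

Lemma cls_rec_continuous (Z : topologicalType) (f : X -> Z) :
  continuous f -> weak_hausdorff Z -> (forall x y, r x y -> f x = f y) ->
  continuous (fun q : cgwh_quotient r => f (representative q)).
Proof.
move=> cf wZ rf; apply: continuous_on_quotient.
by rewrite (_ : _ \o _ = f) //; apply/funext => x; exact: cls_rec.
Qed.

(* If [q] is outside the image of [u : K -> X/r], every [u k] is separated from
   [q] in some admissible weak Hausdorff quotient; there the image of a closed
   neighbourhood of [k] is closed and misses [q], and finitely many of these
   neighbourhoods cover [K]. *)
Lemma cgwh_quotient_weak_hausdorff : weak_hausdorff (cgwh_quotient r).
Proof.
move=> K u cK hK cu; rewrite closedE => q qU.
apply: contrapT => nq; apply: qU.
have sep (k : K) : \forall k' \near k & p \near q, u k' <> p.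
  have ukq : u k <> q by move=> ukq; apply: nq; exists k.
  have [e [re we ne]] : exists e : equiv_rel X,
      [/\ forall a b, r a b -> e a b,
          weak_hausdorff (quotient_topology {eq_quot e}) &
          ~ e (representative (u k)) (representative q)].
    apply: contrapT => ne; apply: ukq.
    rewrite -[u k]cls_representative -[q]cls_representative.
    apply/cls_eqP/asboolP => e re we; apply: contrapT => nuk.
    by apply: ne; exists e.
  pose f x : quotient_topology {eq_quot e} := \pi_(quotient_topology {eq_quot e}) x.
  have cf : continuous f by exact: pi_continuous.
  have rf a b : r a b -> f a = f b by move=> /re ab; exact/eqquotP.
  pose g (p : cgwh_quotient r) := f (representative p).
  have cg : continuous g by exact: cls_rec_continuous.
  have cgu : continuous (g \o u).
    by move=> x; apply: continuous_comp; [exact: cu|exact: cg].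
  have gk : g (u k) <> g q by move=> /eqquotP.
  have [N kN Nq] : exists2 N, nbhs k N & forall x, closure N x -> g (u x) <> g q.
    have oq : open [set y | y <> g q].
      by rewrite -closedC setCK; exact: weak_hausdorff_closed1.
    have kT : nbhs k [set: K] by exact: filterT.
    have := cgu k _ (open_nbhs_nbhs (conj oq gk)).
    by move=> /(@compact_regular K k setT hK cK kT) [N kN Nq]; exists N.
  have cN : closed ((g \o u) @` closure N).
    by apply: weak_hausdorff_image => //; exact: closed_closure.
  exists (N, [set p | ~ ((g \o u) @` closure N) (g p)]); last first.
    move=> [x p] [/= Nx np] uxp; apply: np; exists x; last by rewrite /= uxp.
    exact: subset_closure.
  split => //=; have oN : open_nbhs (g q) (~` ((g \o u) @` closure N)).
    by split; [exact: closed_openC|move=> [x Nx]; exact: Nq].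
  exact: (cg q _ (open_nbhs_nbhs oN)).
have /compact_near_coveringP/(_ _ (nbhs q) (fun p k => u k <> p)) := cK.
move=> /(_ (nbhs_filter q) (fun k _ => sep k)).
apply: (@filterS _ (nbhs q) _ (fun p => [set: K] `<=` (fun k => u k <> p))).
by move=> p Kp [k _]; exact: Kp.
Qed.

End CgwhQuotient.
Lemma continuous_pair (X Y Z : topologicalType) (f : X -> Y) (g : X -> Z) :
  continuous f -> continuous g -> continuous (fun x => (f x, g x)).
Proof.
move=> cf cg x.
exact: (@cvg_pair _ _ _ (nbhs x) (nbhs (f x)) (nbhs (g x)) _ _ _ _ _ (cf x) (cg x)).
Qed.

(** * Continuity for compactly generated topologies *)

Section KificationMaps.

Lemma kification_continuousP (X Z : topologicalType) (f : X -> Z) :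
  continuous (f : kification X -> Z) <->
  forall (K : topologicalType) (g : K -> X), compact [set: K] ->
    hausdorff_space K -> continuous g -> continuous (f \o g).
Proof.
split=> [/continuousP cf K g cK hK cg|cf]; apply/continuousP => U oU.
  exact: (cf U oU K g cK hK cg).
by move=> K g cK hK cg; move: U oU; apply/continuousP; exact: cf.
Qed.

Lemma continuous_from_kification (X Z : topologicalType) (f : X -> Z) :
  continuous f -> continuous (f : kification X -> Z).
Proof.
move=> cf; apply/kification_continuousP => K g _ _ cg x.
by apply: continuous_comp; [exact: cg|exact: cf].
Qed.

Lemma continuous_to_kification (K X : topologicalType) (g : K -> X) :
  compact [set: K] -> hausdorff_space K -> continuous g ->
  continuous (g : K -> kification X).
Proof. by move=> cK hK cg; apply/continuousP => U kU; exact: kU. Qed.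

Lemma continuous_kification (X Z : topologicalType) (f : X -> Z) :
  continuous f -> continuous (f : kification X -> kification Z).
Proof.
move=> cf; apply/kification_continuousP => K g cK hK cg.
apply: continuous_to_kification => // x.
by apply: continuous_comp; [exact: cg|exact: cf].
Qed.

Lemma kification_compactly_generated (X : topologicalType) :
  compactly_generated (kification X).
Proof.
move=> U kU; suff : k_open (U : set X) by [].
move=> K g cK hK cg; apply: kU => //; exact: continuous_to_kification.
Qed.

(* Near each point of [K], [g] takes values in a single summand. *)
Lemma sigT_local_lift (I : choiceType) (Y : I -> topologicalType)
    (K : topologicalType) (g : K -> {i & Y i}) (i : I) (y : Y i) :
  continuous g -> exists g' : K -> Y i, continuous g' /\
    forall k, projT1 (g k) = i -> g k = existT Y i (g' k).
Proof.
(* Where [g] is in another summand, [g'] has the default value [y]. Summands are open, so the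
   default does not spoil continuity. *)
move=> cg.
pose g' k : Y i := match pselect (exists y', g k = existT Y i y') with
  | left ex => sval (cid ex) | right _ => y end.
have g'E k y' : g k = existT Y i y' -> g' k = y'.
  move=> gk; rewrite /g'; case: pselect => [ex|[]]; last by exists y'.
  by case: (cid ex) => z /= zE; apply: (@existT_inj2 I (fun i => Y i)); rewrite -zE -gk.
have g'N k : (forall y', g k <> existT Y i y') -> g' k = y.
  by move=> gk; rewrite /g'; case: pselect => // -[y' gy']; case: (gk y').
exists g'; split=> [k|k]; last first.
  case E : (g k) => [j z] /= ji; rewrite {}ji {j} in z E *.
  by rewrite (g'E _ _ E).
case E : (g k) => [j z]; have [ji|ji] := eqVneq j i.
  rewrite {}ji {j} in z E; rewrite /continuous_at (g'E _ _ E) => U Uz.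
  have : nbhs (g k) (existT Y i @` U) by rewrite E; exact: existT_nbhs.
  move=> /cg; apply: (@filterS _ (nbhs k)) => k' [u Uu gk'].
  by rewrite /= (g'E _ _ (esym gk')).
have nE y' : g k <> existT Y i y'.
  by rewrite E => /(congr1 (@projT1 _ _)) /= /eqP; rewrite (negbTE ji).
rewrite /continuous_at (g'N _ nE) => U Uy.
have : nbhs (g k) (existT Y j @` setT) by rewrite E; apply: existT_nbhs; exact: filterT.
move=> /cg; apply: (@filterS _ (nbhs k)) => k' [u _ gk'] /=.
rewrite g'N; first exact: nbhs_singleton.
by move=> y'; rewrite -gk' => /(congr1 (@projT1 _ _)) /= /eqP; rewrite (negbTE ji).
Qed.

Lemma sigT_near (I : choiceType) (Y : I -> topologicalType)
    (K : topologicalType) (g : K -> {i & Y i}) (k : K) :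
  continuous g -> \forall k' \near k, projT1 (g k') = projT1 (g k).
Proof.
move=> cg; case E : (g k) => [i y].
have : nbhs (g k) (existT Y i @` setT) by rewrite E; apply: existT_nbhs; exact: filterT.
by move=> /cg; apply: (@filterS _ (nbhs k)) => k' [u _ <-].
Qed.

Lemma near_eq_continuous (X Z : topologicalType) (f g : X -> Z) (x : X) :
  (\forall y \near x, f y = g y) -> {for x, continuous f} -> {for x, continuous g}.
Proof.
move=> fg cf U; rewrite -(nbhs_singleton fg) => /cf; apply: filterS2 fg => y fgy.
by rewrite /= fgy.
Qed.

(** Near each point a test map stays in one summand and lifts to it, so it suffices to test on the
    summands. *)
Lemma kification_sigT_continuous (I : choiceType) (Y : I -> topologicalType)
    (Z : topologicalType) (f : {i & Y i} -> Z) :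
  (forall i, continuous ((fun y => f (existT Y i y)) : kification (Y i) -> Z)) ->
  continuous (f : kification {i & Y i} -> Z).
Proof.
move=> cf; apply/kification_continuousP => K g cK hK cg k.
have [g' [cg' gE]] := sigT_local_lift (projT2 (g k)) cg.
have := @near_eq_continuous _ _ (fun k' => f (existT Y _ (g' k'))) (f \o g) k.
apply; first by apply: filterS (sigT_near k cg) => k' /gE /= ->.
by have /kification_continuousP/(_ K g' cK hK cg') := cf (projT1 (g k)); apply.
Qed.

Lemma kification_existT_continuous (I : choiceType) (Y : I -> topologicalType)
    (X : topologicalType) i (g : X -> Y i) : continuous g ->
  continuous ((fun x => existT Y i (g x)) : kification X -> kification {i & Y i}).
Proof.
move=> cg; apply: continuous_kification => x.
by apply: (@continuous_comp _ _ _ g); [exact: cg|exact: existT_continuous].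
Qed.

End KificationMaps.

(** * Products with powers of quotient maps and with compact covers *)

Lemma tube (L K : topologicalType) (N : set K) (O : set (L * K)) :
  compact N -> open O -> open [set l | forall k, N k -> O (l, k)].
Proof.
move=> /compact_near_coveringP cN oO; rewrite openE => l lO.
have := cN _ (nbhs l) (fun l k => O (l, k)) _; apply => k Nk.
have := open_nbhs_nbhs (conj oO (lO k Nk)).
by move=> [[V W] /= [lV kW] VW]; exists (W, V) => // -[a b] [/= Wa Vb]; exact: (VW (b, a)).
Qed.

Lemma compact_closed_nbhs (K : topologicalType) (k : K) (O : set K) :
  compact [set: K] -> hausdorff_space K -> open O -> O k ->
  exists N, [/\ nbhs k N, compact N & N `<=` O].
Proof.
move=> cK hK oO Ok; have kT : nbhs k [set: K] by exact: filterT.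
have := open_nbhs_nbhs (conj oO Ok).
move=> /(@compact_regular K k setT hK cK kT) [N kN NO]; exists (closure N); split => //.
  by apply: filterS kN; exact: subset_closure.
by apply: subclosed_compact cK _ => //; exact: closed_closure.
Qed.

(* A product of a space with a power of a quotient map is a quotient map for
   the compactly generated topologies: the coordinates of a test map are lifted
   through [q] one at a time, over compact neighbourhoods. *)
Lemma power_quotient_k_open (C X Y : topologicalType) (q : X -> Y) (T : finType)
    (W : set (C * {ptws T -> Y})) :
  (forall y, exists x, q x = y) -> (forall U, open (q @^-1` U) -> open U) ->
  compactly_generated X -> continuous q ->
  (forall (K : topologicalType) (c : K -> C) (x : T -> K -> X),
     compact [set: K] -> hausdorff_space K -> continuous c ->
     (forall i, continuous (x i)) ->
     open [set k | W (c k, fun i => q (x i k))]) ->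
  k_open W.
Proof.
move=> qsurj qopen cgX cq Wlift.
(* [s] contains the coordinates that have no lift through [q] yet; the others are lifted over the
   whole test space. *)
suff claim (s : seq T) (K : topologicalType) (c : K -> C) (y : T -> K -> Y) :
    compact [set: K] -> hausdorff_space K -> continuous c ->
    (forall i, continuous (y i)) ->
    (forall i, i \notin s -> exists x : K -> X,
      continuous x /\ forall k, q (x k) = y i k) ->
    open [set k | W (c k, fun i => y i k)].
  move=> K f cK hK cf.
  rewrite (_ : _ @^-1` _ = [set k | W ((f k).1, fun i => (f k).2 i)]); last first.
    by apply/seteqP; split => k; rewrite /preimage /=; case: (f k).
  apply: (claim (enum T)) => //.
  - by move=> k; apply: continuous_comp; [exact: cf|exact: cvg_fst].
  - move=> i k; apply: (@continuous_comp _ {ptws T -> Y} Y (fun k => (f k).2) (fun x => x i)).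
      by apply: continuous_comp; [exact: cf|exact: cvg_snd].
    exact: (@continuous_coord _ (fun=> Y)).
  - by move=> i; rewrite mem_enum.
elim: s => [|i0 s IH] in K c y *.
  move=> cK hK cc cy yx.
  have /choice [x xP] : forall i, exists x : K -> X,
      continuous x /\ forall k, q (x k) = y i k by move=> i; exact: yx.
  rewrite (_ : mkset _ = [set k | W (c k, fun i => q (x i k))]).
    by apply: Wlift => // i; have [] := xP i.
  apply/seteqP; split => k /=; rewrite (_ : (fun i => y i k) = fun i => q (x i k)) //;
    by apply/funext => i; have [_ ->] := xP i.
move=> cK hK cc cy yx.
pose upd (L : Type) (yL : T -> L -> Y) (b : L -> Y) i l :=
  if i == i0 then b l else yL i l.

rewrite openE => k0 Wk0.
have [x0 qx0] := qsurj (y i0 k0).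
(* Frozen at its value at [k0], coordinate [i0] lifts as a constant map, and the induction
   hypothesis applies. *)
have oO : open [set k | W (c k, fun i => upd K y (fun=> q x0) i k)].
  apply: IH => // [i|i is_].
    by rewrite /upd; case: eqP => _; [exact: cst_continuous|exact: cy].
  rewrite /upd; case: eqP => [_|/eqP ii0].
    by exists (fun=> x0); split => //; exact: cst_continuous.
  by apply: yx; rewrite inE negb_or ii0.
have Ok0 : W (c k0, fun i => upd K y (fun=> q x0) i k0).
  rewrite (_ : (fun i => _) = fun i => y i k0) //.
  by apply/funext => i; rewrite /upd; case: eqP => // ->.
have [N [k0N cN NO]] := compact_closed_nbhs cK hK oO Ok0.
(* The values of coordinate [i0] that are good over all of the compact neighbourhood [N]. This set
   is open: composed with a test map [g] into [X], the coordinate lifts over [L * K], and the tube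
   lemma applies. *)
pose U : set Y := [set b | forall k, N k -> W (c k, fun i => upd K y (fun=> b) i k)].
have oU : open U.
  apply/qopen/cgX => L g cL hL cg.
  apply: (@tube L K N [set p | W (c p.2, fun i => upd K y (fun=> q (g p.1)) i p.2)]) => //.
  pose y' i (p : L * K) := upd K y (fun=> q (g p.1)) i p.2.
  apply: (IH (L * K)%type (c \o snd) y').
  - by rewrite -setXTT; exact: compact_setX.
  - exact: hausdorff_prod.
  - by move=> p; apply: continuous_comp; [exact: cvg_snd|exact: cc].
  - move=> i; rewrite /y' /upd; case: eqP => _ p.
      apply: (@continuous_comp _ _ _ (fun p => g p.1)); last exact: cq.
      by apply: continuous_comp; [exact: cvg_fst|exact: cg].
    by apply: continuous_comp; [exact: cvg_snd|exact: cy].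
  - move=> i is_; rewrite /y' /upd; case: eqP => [_|/eqP ii0].
      exists (fun p => g p.1); split => // p.
      by apply: continuous_comp; [exact: cvg_fst|exact: cg].
    have [|x [cx xE]] := yx i; first by rewrite inE negb_or ii0.
    exists (fun p => x p.2); split => // p.
    by apply: continuous_comp; [exact: cvg_snd|exact: cx].
have Uk0 : U (y i0 k0) by move=> k /NO /=; rewrite -qx0.
have : nbhs k0 (y i0 @^-1` U) by apply: cy; exact: open_nbhs_nbhs.
rewrite /interior /=; apply: filterS2 k0N => k Nk Uk.
rewrite /= (_ : (fun i => y i k) = fun i => upd K y (fun=> y i0 k) i k); first exact: Uk.
by apply/funext => i; rewrite /upd; case: eqP => // ->.
Qed.

Lemma closed_equalizer (X Y : topologicalType) (f g : X -> Y) :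
  hausdorff_space Y -> continuous f -> continuous g -> closed [set x | f x = g x].
Proof.
move=> hY cf cg; rewrite closedE => x; apply: contra_notP => fgx.
move: hY; rewrite open_hausdorff => /(_ (f x) (g x)); case; first exact/eqP.
move=> [A B] /= [fA gB] [oA oB AB0].
have nA : nbhs x (f @^-1` A) by apply: cf; apply: open_nbhs_nbhs; split => //; exact/set_mem.
have nB : nbhs x (g @^-1` B) by apply: cg; apply: open_nbhs_nbhs; split => //; exact/set_mem.
apply: filterS2 nA nB => y Ay By fgy.
suff : (A `&` B) (f y) by rewrite (eqP AB0).
by split => //; rewrite fgy.
Qed.

(** The complement of the preimage of [W] in a test space [K] is a finite union of projections of
    closed subsets of [P i * K]. These projections are closed because [P i] and [K] are compact and
    [K] is Hausdorff. *)
Lemma compact_cover_k_open (F Y : topologicalType) (I : finType)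
    (P : I -> topologicalType) (p : forall i, P i -> F) (W : set (F * Y)) :
  hausdorff_space F -> (forall i, compact [set: P i]) ->
  (forall i, hausdorff_space (P i)) -> (forall i, continuous (p i)) ->
  (forall x, exists i a, p i a = x) ->
  (forall i, k_open [set ay : P i * Y | W (p i ay.1, ay.2)]) -> k_open W.
Proof.
move=> hF cP hP cp psurj kW K f cK hK cf; rewrite -closedC.
pose Z i := [set ak : P i * K | p i ak.1 = (f ak.2).1] `&`
  ~` [set ak | W (p i ak.1, (f ak.2).2)].
have cPK i : compact [set: (P i * K)%type] by rewrite -setXTT; exact: compact_setX.
have hPK i : hausdorff_space (P i * K)%type by exact: hausdorff_prod.
have c2 i : continuous (fun ak : P i * K => f ak.2).
  by move=> ak; apply: continuous_comp; [exact: cvg_snd|exact: cf].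
have cZ i : closed (Z i).
  apply: (@closedI (P i * K)%type).
    apply: closed_equalizer => // ak.
      by apply: continuous_comp; [exact: cvg_fst|exact: cp].
    by apply: (@continuous_comp _ _ _ _ fst); [exact: c2|exact: cvg_fst].
  apply: open_closedC.
  apply: (kW i (P i * K)%type (fun ak => (ak.1, (f ak.2).2))) => //; first exact: cPK.
  apply: (@continuous_pair _ _ _ fst (fun ak => (f ak.2).2)) => ak; first exact: cvg_fst.
  by apply: (@continuous_comp _ _ _ _ snd); [exact: c2|exact: cvg_snd].
rewrite (_ : ~` _ = \bigcup_(i in [set: I]) (snd @` Z i)).
  apply: closed_bigcup => [|i _]; first exact: finite_finset.
  apply: compact_closed => //; apply: continuous_compact.
    by apply: continuous_subspaceT => ak; exact: cvg_snd.
  by apply: subclosed_compact (cPK i) _.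
apply/seteqP; split => [k nWk|k [i _ [[a k'] [/= pa nW]] <-]]; last first.
  by rewrite /= => Wk; apply: nW; rewrite pa -surjective_pairing.
have [i [a pa]] := psurj (f k).1; exists i => //; exists (a, k) => //; split => //=.
by rewrite pa -surjective_pairing.
Qed.

(** * Limit configurations *)

Section Limits.
Variable R : realType.
Implicit Types (T U : finType).

Definition limit_config T (c : conf R T) := closure (distinct_configs (T := T)) c.

Lemma limit_closed T (P : set (conf R T)) c :
  closed P -> (forall x : T -> R, injective x -> P (config_of x)) ->
  limit_config c -> P c.
Proof.
move=> cP Px lc; apply: cP; move: lc.
by apply: closureS => _ [x xi <-]; exact: Px.
Qed.

Lemma limit_nbhs T (P : set (conf R T)) c :
  limit_config c -> nbhs c P -> exists x : T -> R, injective x /\ P (config_of x).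
Proof. by move=> lc /lc [_ [[x xi <-] Px]]; exists x. Qed.

Lemma FM_limit (L : set R) T (c : FM L T) : limit_config (val c).
Proof. by case: (set_valP c). Qed.

Lemma continuousDR (X : topologicalType) (f g : X -> R) :
  continuous f -> continuous g -> continuous (fun x => f x + g x).
Proof. by move=> cf cg x; apply: cvgD; [exact: cf|exact: cg]. Qed.

Lemma continuousBR (X : topologicalType) (f g : X -> R) :
  continuous f -> continuous g -> continuous (fun x => f x - g x).
Proof. by move=> cf cg x; apply: cvgB; [exact: cf|exact: cg]. Qed.

Lemma continuousMR (X : topologicalType) (f g : X -> R) :
  continuous f -> continuous g -> continuous (fun x => f x * g x).
Proof. by move=> cf cg x; apply: cvgM; [exact: cf|exact: cg]. Qed.

Lemma near_ltR (X : topologicalType) (f g : X -> R) x :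
  continuous f -> continuous g -> f x < g x -> \forall y \near x, f y < g y.
Proof.
move=> cf cg; rewrite -subr_gt0 => fg.
have /cvgr_gt /(_ _ fg) := @continuousBR X g f cg cf x.
by apply: filterS => y; rewrite subr_gt0.
Qed.

Lemma closed_eqR T (f g : conf R T -> R) :
  continuous f -> continuous g -> closed [set c | f c = g c].
Proof. by move=> cf cg; apply: closed_equalizer => //; exact: Rhausdorff. Qed.

Lemma screen_out T (c : conf R T) (S : {set T}) i :
  limit_config c -> ~~ ((1 < #|S|)%N && (i \in S)) -> c.2 S i = 0.
Proof.
move=> lc iS; apply: (limit_closed (P := [set c | c.2 S i = 0])) lc.
  by apply: closed_eqR; [exact: continuous_screen|exact: cst_continuous].
by move=> x _; rewrite /= /direction (negbTE iS).
Qed.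

Definition low T (y : T -> R) (S : {set T}) i := \big[Order.min/y i]_(j in S) y j.
Definition high T (y : T -> R) (S : {set T}) i := \big[Order.max/y i]_(j in S) y j.

Lemma low_le T (y : T -> R) (S : {set T}) i j : j \in S -> low y S i <= y j.
Proof. by move=> jS; exact: bigmin_le_cond. Qed.

Lemma le_high T (y : T -> R) (S : {set T}) i j : j \in S -> y j <= high y S i.
Proof. by move=> jS; exact: (@le_bigmax_cond _ _ _ _ j). Qed.

Lemma low_high_eq T (y : T -> R) (S : {set T}) i a b :
  high y S i = low y S i -> a \in S -> b \in S -> y a = y b.
Proof.
move=> hl aS bS; apply/eqP; rewrite eq_le.
by rewrite (le_trans (le_high y i aS)) ?hl ?low_le //= (le_trans (le_high y i bS)) ?hl ?low_le.
Qed.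

(** The equation defining [direction] without division. It also holds when [y] is constant on [S],
    so it passes to limits. *)
Lemma direction_mul T (y : T -> R) (S : {set T}) i : (1 < #|S|)%N -> i \in S ->
  direction y S i * (high y S i - low y S i) = y i - low y S i.
Proof.
move=> S1 iS; rewrite /direction S1 iS /= -/(low y S i) -/(high y S i).
have [hl|hl] := eqVneq (high y S i) (low y S i); last by rewrite divfK // subr_eq0.
rewrite hl subrr mulr0; apply/eqP; rewrite eq_sym subr_eq0 eq_le low_le //.
by rewrite -hl le_high.
Qed.

Lemma low_continuous T (X : topologicalType) (y : X -> T -> R) (S : {set T}) i :
  (forall j, continuous (fun x => y x j)) -> continuous (fun x => low (y x) S i).
Proof. by move=> cy x; apply: bigmin_cvg => j; exact: cy. Qed.

Lemma high_continuous T (X : topologicalType) (y : X -> T -> R) (S : {set T}) i :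
  (forall j, continuous (fun x => y x j)) -> continuous (fun x => high (y x) S i).
Proof. by move=> cy x; apply: bigmax_cvg => j; exact: cy. Qed.

(** [y] is a continuous choice of points which on distinct configurations represents the class of
    the points in [S]. The equation without division passes to the limit [c], and as [y c] is not
    constant on [S] it determines the screen of [S]. *)
Lemma limit_direction T (y : conf R T -> T -> R) (c : conf R T) (S : {set T}) i a b :
  (forall j, continuous (fun c => y c j)) ->
  (forall x : T -> R, injective x -> exists u t : R, 0 < t /\
     forall j, j \in S -> y (config_of x) j = u + t * x j) ->
  limit_config c -> i \in S -> a \in S -> b \in S -> y c a != y c b ->
  c.2 S i = direction (y c) S i.
Proof.
move=> cy yE lc iS aS bS yab.
have S1 : (1 < #|S|)%N.
  by apply/card_gt1P; exists a, b; split=> //; apply: contra yab => /eqP ->.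
have : c.2 S i * (high (y c) S i - low (y c) S i) = y c i - low (y c) S i.
  apply: (limit_closed (P := [set c | c.2 S i * (high (y c) S i - low (y c) S i) =
    y c i - low (y c) S i])) lc.
    apply: closed_eqR.
      apply: continuousMR; first exact: (@continuous_screen R T S i).
      by apply: continuousBR; [exact: high_continuous|exact: low_continuous].
    by apply: continuousBR; [exact: cy|exact: low_continuous].
  move=> x xinj /=; have [u [t [t0 yx]]] := yE x xinj.
  by rewrite -(direction_affine i t0 yx) direction_mul.
rewrite -direction_mul // => /mulIf; apply; rewrite subr_eq0.
by apply: contra yab => /eqP hl; rewrite (low_high_eq hl aS bS).
Qed.

Lemma direction_affineE T (x : T -> R) (S : {set T}) : (1 < #|S|)%N -> injective x ->
  exists u t : R, 0 < t /\ forall j, j \in S -> direction x S j = u + t * x j.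
Proof.
move=> S1 xinj; have /card_gt1P [a [b [aS bS ab]]] := S1.
have hl : low x S a < high x S a.
  rewrite lt_neqAle (le_trans (low_le x a aS) (le_high x a aS)) andbT.
  by apply: contra ab => /eqP /esym hl; rewrite (xinj _ _ (low_high_eq hl aS bS)).
exists (- low x S a / (high x S a - low x S a)), (high x S a - low x S a)^-1.
split; first by rewrite invr_gt0 subr_gt0.
move=> j jS; rewrite /direction S1 jS /= (bigmin_idx _ jS aS) (bigmax_idx _ jS aS).
by rewrite mulrBl mulNr addrC [_^-1 * _]mulrC.
Qed.

(** The compatibility condition between Fulton-MacPherson screens; the points [y] of
    [limit_direction] are here the screen of [S']. *)
Lemma limit_screen T (c : conf R T) (S' S : {set T}) i a b :
  limit_config c -> S \subset S' -> i \in S -> a \in S -> b \in S ->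
  c.2 S' a != c.2 S' b -> c.2 S i = direction (c.2 S') S i.
Proof.
move=> lc SS' iS aS bS ab.
apply: (limit_direction (y := fun c => c.2 S') _ _ lc iS aS bS ab).
  by move=> j; exact: continuous_screen.
move=> x xinj; have [|u [t [t0 xE]]] := @direction_affineE _ x S' _ xinj.
  apply/card_gt1P; exists a, b; split; try exact: (fintype.subsetP SS').
  by apply: contra ab => /eqP ->.
by exists u, t; split=> // j /(fintype.subsetP SS'); exact: xE.
Qed.

Lemma direction_le T (x : T -> R) (S : {set T}) i j : i \in S -> j \in S ->
  x i <= x j -> direction x S i <= direction x S j.
Proof.
move=> iS jS xij; rewrite /direction iS jS; case: ifP => // _.
rewrite (bigmin_idx _ iS jS) (bigmax_idx _ iS jS).
rewrite ler_wpM2r ?invr_ge0 ?subr_ge0 ?lerD2r //.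
exact: le_trans (low_le x j jS) (le_high x j jS).
Qed.

Lemma direction_min T (x : T -> R) (S : {set T}) i :
  (forall j, j \in S -> x i <= x j) -> direction x S i = 0.
Proof.
move=> xi; rewrite /direction; case: ifP => // /andP[_ iS].
rewrite (_ : \big[Order.min/x i]_(j in S) x j = x i) ?subrr ?mul0r //.
by apply/eqP; rewrite eq_le low_le //=; apply/bigmin_geP.
Qed.

Lemma direction_max T (x : T -> R) (S : {set T}) i a :
  (forall j, j \in S -> x j <= x i) -> i \in S -> a \in S -> x a != x i ->
  direction x S i = 1.
Proof.
move=> xi iS aS ai.
have S1 : (1 < #|S|)%N.
  by apply/card_gt1P; exists a, i; split=> //; apply: contra ai => /eqP ->.
rewrite /direction S1 iS /=.
rewrite (_ : \big[Order.max/x i]_(j in S) x j = x i); last first.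
  by apply/eqP; rewrite eq_le le_high // andbT; apply/bigmax_leP.
rewrite divff // subr_eq0 gt_eqF // (le_lt_trans (low_le x i aS)) //.
by rewrite lt_neqAle ai xi.
Qed.

Lemma direction_pair T (x : T -> R) i j : x i < x j ->
  direction x [set i; j]%SET i = 0 /\ direction x [set i; j]%SET j = 1.
Proof.
move=> ij; split.
  by apply: direction_min => k; rewrite !inE => /orP[] /eqP -> //; exact: ltW.
apply: (@direction_max _ _ _ _ i); rewrite ?inE ?eqxx ?orbT ?lt_eqF //.
by move=> k; rewrite !inE => /orP[] /eqP -> //; exact: ltW.
Qed.

(** The order of the twigs on the line. On limit configurations the screen of a pair takes only the
    values 0 and 1, so this strict inequality is locally constant there. *)
Definition before T (c : conf R T) : rel T :=
  fun i j => c.2 [set i; j]%SET i < c.2 [set i; j]%SET j.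
Arguments before : simpl never.

(** A sum equal to 1 and a product equal to 0 are closed conditions, and together they leave two
    cases. *)
Lemma limit_pair T (c : conf R T) i j : limit_config c -> i != j ->
  (c.2 [set i; j]%SET i = 0 /\ c.2 [set i; j]%SET j = 1) \/
  (c.2 [set i; j]%SET i = 1 /\ c.2 [set i; j]%SET j = 0).
Proof.
move=> lc ij; set S := [set i; j]%SET.
have : c.2 S i + c.2 S j = 1.
  apply: (limit_closed (P := [set c | c.2 S i + c.2 S j = 1])) lc.
    apply: closed_eqR; last exact: cst_continuous.
    by apply: continuousDR; exact: (@continuous_screen R T).
  move=> x xinj /=; case: (ltgtP (x i) (x j)) => [xij|xij|/xinj/eqP].
  - by have [-> ->] := direction_pair xij; rewrite add0r.
  - by rewrite /S finset.setUC; have [-> ->] := direction_pair xij; rewrite addr0.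
  - by rewrite (negbTE ij).
have : c.2 S i * c.2 S j = 0.
  apply: (limit_closed (P := [set c | c.2 S i * c.2 S j = 0])) lc.
    apply: closed_eqR; last exact: cst_continuous.
    by apply: continuousMR; exact: (@continuous_screen R T).
  move=> x xinj /=; case: (ltgtP (x i) (x j)) => [xij|xij|/xinj/eqP].
  - by have [-> ->] := direction_pair xij; rewrite mul0r.
  - by rewrite /S finset.setUC; have [-> ->] := direction_pair xij; rewrite mulr0.
  - by rewrite (negbTE ij).
move=> /eqP; rewrite mulf_eq0 => /orP[] /eqP ->; first by rewrite add0r; left.
by rewrite addr0; right.
Qed.

Lemma before_total T (c : conf R T) i j : limit_config c -> i != j ->
  before c i j || before c j i.
Proof.
move=> lc ij; rewrite /before [[set j; i]%SET]finset.setUC.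
by have [[-> ->]|[-> ->]] := limit_pair lc ij; rewrite ltr01 ?orbT.
Qed.

Lemma before_config_of T (x : T -> R) i j : injective x ->
  before (config_of x) i j = (x i < x j).
Proof.
move=> xinj; rewrite /before /=; case: (ltgtP (x i) (x j)) => [xij|xij|/xinj ->].
- by have [-> ->] := direction_pair xij; rewrite ltr01.
- by rewrite finset.setUC; have [-> ->] := direction_pair xij; rewrite ltr10.
- by rewrite ltxx.
Qed.

Lemma near_before T (c : conf R T) i j : before c i j ->
  \forall d \near c, before d i j.
Proof. by move=> cij; apply: near_ltR => //; exact: (@continuous_screen R T). Qed.

(* A limit configuration is a limit of distinct ones with the same order. *)
Lemma limit_order T (c : conf R T) (P : set (conf R T)) :
  limit_config c -> nbhs c P -> exists x : T -> R,
    [/\ injective x, P (config_of x) & forall i j, before c i j = (x i < x j)].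
Proof.
move=> lc nP.
have : \forall d \near c, forall p : T * T, before c p.1 p.2 ==> before d p.1 p.2.
  apply: (@filter_forall _ (T * T)%type
    (fun p d => before c p.1 p.2 ==> before d p.1 p.2) _ (nbhs_filter c)) => p.
  case: (boolP (before c p.1 p.2)) => [/near_before|_].
    by apply: filterS => d ->.
  by near=> d.
move=> /(filterI nP) /(limit_nbhs lc) [x [xinj [Px xc]]].
have imp i j : before c i j -> x i < x j.
  by move=> cij; rewrite -before_config_of //; have := xc (i, j); rewrite /= cij.
exists x; split => // i j; apply/idP/idP; first exact: imp.
move=> xij; have ij : i != j by apply: contraTneq xij => ->; rewrite ltxx.
have /orP[//|/imp] := before_total lc ij.
by rewrite ltNge (ltW xij).
Unshelve. all: by end_near. Qed.

Lemma before_irr T (c : conf R T) : irreflexive (before c).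
Proof. by move=> i; rewrite /before ltxx. Qed.

Lemma before_trans T (c : conf R T) : limit_config c -> transitive (before c).
Proof.
move=> lc; have [x [_ _ xE]] := limit_order lc filterT.
by move=> j i k; rewrite !xE; exact: lt_trans.
Qed.

(** A failure at [c] would persist nearby, in particular at some distinct configuration with the
    same order. *)
Lemma before_le T (c : conf R T) (y : conf R T -> T -> R) i j :
  (forall k, continuous (fun c => y c k)) ->
  (forall x : T -> R, injective x -> x i < x j -> y (config_of x) i <= y (config_of x) j) ->
  limit_config c -> before c i j -> y c i <= y c j.
Proof.
move=> cy yE lc cij; rewrite leNgt; apply/negP => yji.
have n1 : \forall d \near c, y d j < y d i by apply: near_ltR => //; exact: cy.
have [x [xinj xji xE]] := limit_order lc n1.
by move: xji; rewrite ltNge yE // -xE.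
Qed.

Lemma before_screen T (c : conf R T) (S : {set T}) i j :
  limit_config c -> i \in S -> j \in S -> before c i j -> c.2 S i <= c.2 S j.
Proof.
move=> lc iS jS; apply: (before_le (y := fun c => c.2 S)) => // [k|x _ /ltW].
  exact: continuous_screen.
exact: direction_le.
Qed.

Lemma in_orderE k (c : conf R 'I_k) : limit_config c -> in_order c ->
  forall i j, before c i j = (i < j)%N.
Proof.
move=> lc co i j; apply/idP/idP; last exact: co.
case: (ltngtP i j) => // [ji cij|/val_inj ->]; last by rewrite before_irr.
by have := before_trans lc cij (co _ _ ji); rewrite before_irr.
Qed.

Lemma limit_pull U T (f : U -> T) (c : conf R T) :
  injective f -> limit_config c -> limit_config (pull_raw f c).
Proof.
by move=> finj lc; have [] : FM setT U (pull_raw f c) by apply: FM_pull.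
Qed.

Lemma before_pull U T (f : U -> T) (c : conf R T) i j :
  before (pull_raw f c) i j = before c (f i) (f j).
Proof. by rewrite /before /= !inE !eqxx orbT imsetU1 imset_set1. Qed.

(** All trees are moved to 0 and become one tree of F_1, joined by the screens of the sets that meet
    several of them. *)
Definition centred T (c : conf R T) : conf R T := (fun=> 0, c.2).

Lemma limit_centred T (c : conf R T) : limit_config c -> limit_config (centred c).
Proof.
have cc : continuous (@centred T).
  apply: continuous_conf => [i|S i]; first exact: (@cst_continuous _ R 0).
  exact: continuous_screen.
apply: (image_closure cc) => _ [x xinj <-].
rewrite (_ : centred _ = (fun i => 0 * x i, direction x)); last first.
  by congr pair; apply/funext => i; rewrite mul0r.
(* Scaling by [e > 0] changes no screen; the centred configuration is the limit for [e] tending to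
   0. *)
pose z (e : R) : conf R T := (fun i => e * x i, direction x).
apply: (@closed_cvg _ _ (0:R)^'+ _ z _ (@closed_closure _ _)).
  near=> e; have e0 : 0 < e by near: e; exact: nbhs_right_gt.
  apply: subset_closure; exists (fun i => e * x i).
    by move=> i j /(mulfI (lt0r_neq0 e0)) /xinj.
  congr pair; apply/funext => S; apply/funext => i.
  by apply: (@direction_affine _ _ _ _ 0 e) => // j _; rewrite add0r.
apply: cvg_conf => [i|S i]; last exact: cvg_cst.
by apply: cvg_at_right_filter; apply: cvgM; [exact: cvg_id|exact: cvg_cst].
Unshelve. all: by end_near. Qed.

End Limits.
Arguments FM_limit {R L T} c.

(** * Grafting and end points *)

Section Grafting.
Variable R : realType.
Implicit Types (T U : finType).

Lemma pull_raw_comp T T' U (g : T' -> T) (f : T -> U) (c : conf R U) :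
  pull_raw g (pull_raw f c) = pull_raw (f \o g) c.
Proof.
congr pair; apply/funext => S; apply/funext => i /=; case: ifP => // iS.
by rewrite imset_f // -imset_comp.
Qed.

Lemma pull_raw_id T (c : conf R T) : limit_config c -> pull_raw id c = c.
Proof.
case: c => y w lc; congr pair; apply/funext => S; apply/funext => i /=.
rewrite imset_id; case: ifP => // iS.
by have /= -> := screen_out (S := S) (i := i) lc; rewrite ?iS ?andbF.
Qed.

Lemma limit_screen1 T (c : conf R T) (S : {set T}) i : limit_config c ->
  (#|S| <= 1)%N -> c.2 S i = 0.
Proof. by move=> lc S1; rewrite (screen_out lc) // ltnNge S1. Qed.

(* [C] is [c] with a tree grafted on each twig [t], whose twigs are the [u] such
   that [h u = t]; there may be none. *)
Definition grafted U T (h : U -> T) (C : conf R U) (c : conf R T) : Prop :=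
  (forall u, C.1 u = c.1 (h u)) /\
  forall (S : {set U}) u, u \in S -> (1 < #|h @: S|)%N ->
    C.2 S u = c.2 (h @: S) (h u).

Lemma grafted_pull U T (f : U -> T) (c : conf R T) : grafted f (pull_raw f c) c.
Proof. by split=> // S u uS _ /=; rewrite uS. Qed.

Lemma grafted_pull_comp U U' T (g : U' -> U) (h : U -> T) (C : conf R U)
    (c : conf R T) : grafted h C c -> grafted (h \o g) (pull_raw g C) c.
Proof.
move=> [h1 h2]; split=> [u|S u uS] /=; first exact: h1.
by rewrite imset_comp uS => /h2 ->; rewrite ?imset_f.
Qed.

Lemma grafted_graft T (J : T -> finType) (c : conf R T) (d : forall i, conf R (J i)) :
  grafted tag (graft_raw c d) c.
Proof. by split=> // S u uS S1 /=; rewrite uS S1. Qed.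

Lemma pull_graft_tagged (T : finType) (J : T -> finType) (c : conf R T)
    (d : forall i, conf R (J i)) i : limit_config (d i) ->
  pull_raw (Tagged J) (graft_raw c d) = (fun=> c.1 i, (d i).2).
Proof.
move=> ld; congr pair; apply/funext => S; apply/funext => t; case: ifP => tS; last first.
  by rewrite (screen_out ld) // tS andbF.
rewrite /= imset_f //= -imset_comp.
have S1 : (#|[set (tag \o Tagged J) u | u in S]%SET| <= 1)%N.
  rewrite -(cards1 i); apply: subset_leq_card; apply/fintype.subsetP => _ /imsetP[u _ ->].
  by rewrite inE.
rewrite ltnNge S1 /=; congr ((d i).2 _ t); apply/setP => u; rewrite inE.
apply/imsetP/idP => [[v vS /eqP]|uS]; last by exists u.
by rewrite eq_Tagged /= => /eqP ->.
Qed.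

Lemma FM_centred (L : set R) U k (f : 'I_k -> U) (C : FM L U) :
  injective f -> FM1 R k (centred (pull_raw f (val C))).
Proof. by move=> finj; split=> //; apply/limit_centred/limit_pull => //; exact: FM_limit. Qed.

(** If [f] lists the twigs of one tree of [C], this is that tree as an element of F_1. *)
Definition fm_local (L : set R) U k (f : 'I_k -> U) (finj : injective f)
    (C : FM L U) : FM1 R k :=
  exist (fun c => c \in FM1 R k) _ (mem_set (FM_centred C finj)).

Section Fibers.
Variables (L : set R) (n k : nat) (h : 'I_n -> 'I_k).
Variables (C : FM L 'I_n) (c : FM L 'I_k).
Hypothesis hCc : grafted h (val C) (val c).

Definition fiber (i : 'I_k) : {set 'I_n} := [set u | h u == i]%SET.

Definition fiber_config (i : 'I_k) : FM1 R #|fiber i| :=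
  fm_local (@enum_val_inj _ (mem (fiber i))) C.

Let p (i : 'I_k) := #|fiber i|.

Definition fiber_elt (s : {i : 'I_k & 'I_(p i)}) : 'I_n :=
  enum_val (A := mem (fiber (tag s))) (tagged s).

Lemma fiber_elt_tag s : h (fiber_elt s) = tag s.
Proof.
by have := enum_valP (A := mem (fiber (tag s))) (tagged s); rewrite inE => /eqP.
Qed.

Lemma fiber_elt_inj : injective fiber_elt.
Proof.
move=> [i a] [j b] E; have ij : i = j.
  by have := congr1 h E; rewrite !fiber_elt_tag.
move: b E; case: _ / ij => b; rewrite /fiber_elt /= => E.
by rewrite (@enum_val_inj _ (mem (fiber i)) a b E).
Qed.

Lemma fiber_elt_surj u : exists s, fiber_elt s = u.
Proof.
have uf : u \in mem (fiber (h u)) by rewrite inE.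
exists (Tagged (fun i => 'I_(p i)) (enum_rank_in uf u)).
by rewrite /fiber_elt /= enum_rankK_in.
Qed.

(** Converse to [grafted_graft]: [C], with its twigs indexed fibre by fibre, is the grafting of its
    own subtrees on [c]. *)
Lemma graft_fiber :
  graft_raw (val c) (fun i => val (fiber_config i)) = pull_raw fiber_elt (val C).
Proof.
have [h1 h2] := hCc; congr pair.
  by apply/funext => s /=; rewrite h1 fiber_elt_tag.
apply/funext => S; apply/funext => s /=; case: (boolP (s \in S)) => //= sS.
have tE : h @: (fiber_elt @: S) = tag @: S.
  by rewrite -imset_comp; apply: eq_imset => t; exact: fiber_elt_tag.
case: ifP => S1.
  by rewrite h2 ?imset_f ?tE // fiber_elt_tag.
rewrite inE; case: (s) (sS) => i a iaS; rewrite /Tagged /= iaS.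
congr ((val C).2 _ _); apply/setP => u; apply/imsetP/imsetP.
  by move=> [b]; rewrite inE => bS ->; exists (Tagged (fun i => 'I_(p i)) b).
move=> [[j b] jbS ->]; have ij : j = i.
  apply/eqP; apply: contraFT S1 => ij; apply/card_gt1P; exists j, i; split=> //.
    by apply/imsetP; exists (existT _ j b).
  by apply/imsetP; exists (existT _ i a).
by case: _ / (esym ij) b jbS => b jbS; exists b => //; rewrite inE.
Qed.

Lemma fiber_index_inj : injective (fiber_elt \o @tagnat.sig k p).
Proof. exact: inj_comp fiber_elt_inj (@tagnat.sig_inj k p). Qed.

(** Turns [grafted] into operadic composition, so that the axioms on [rho] and the coequalizer
    relation apply to it. *)
Lemma fm_comp_fiber :
  fm_comp c fiber_config = fm_pull fiber_index_inj C.
Proof.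
apply/val_inj; rewrite [RHS]/= -(pull_raw_comp (@tagnat.sig k p) fiber_elt).
by rewrite -graft_fiber.
Qed.

End Fibers.

(** * Adding end points to a configuration in the interval *)

Section Endpoints.
Variable T : finType.
Implicit Types (c : conf R T).

Definition ext_location c (w : (bool + T)%type) : R :=
  match w with inl b => b%:R | inr t => c.1 t end.

(* The configuration on a line obtained by adding endpoints [inl false] at 0 and
   [inl true] at 1; only meaningful on points located in the open interval. *)
Definition ext c : conf R (bool + T)%type :=
  (fun=> 0, fun (S : {set (bool + T)%type}) w => if w \notin S then 0
     else if (inl false \in S) || (inl true \in S) then direction (ext_location c) S w
     else match w with inl _ => 0 | inr t => c.2 [set t | inr t \in S]%SET t end).

Definition interior c t := 0 < c.1 t < 1.

Definition ext_interior c (w : (bool + T)%type) :=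
  if w is inr t then interior c t else true.

Lemma ext_location_end c b w : ext_interior c w -> inl b != w ->
  ext_location c (inl b) != ext_location c w.
Proof.
case: w => [b'|t] /=; first by case: b; case: b' => //= _ _;
  rewrite ?oner_eq0 // eq_sym oner_eq0.
by rewrite /interior => /andP[t0 t1] _; case: b => /=; [rewrite gt_eqF|rewrite lt_eqF].
Qed.

Lemma ext_screen c (S : {set (bool + T)%type}) w : w \in S ->
  (inl false \in S) || (inl true \in S) -> (ext c).2 S w = direction (ext_location c) S w.
Proof. by move=> wS eS; rewrite /ext /= wS eS. Qed.

Lemma ext_screen_inr c (S : {set (bool + T)%type}) t : inr t \in S ->
  ~~ ((inl false \in S) || (inl true \in S)) ->
  (ext c).2 S (inr t) = c.2 [set t | inr t \in S]%SET t.
Proof. by move=> wS eS; rewrite /ext /= wS (negbTE eS). Qed.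

Lemma ext_end_nonconstant c (S : {set (bool + T)%type}) :
  (inl false \in S) || (inl true \in S) -> (1 < #|S|)%N ->
  (forall w, w \in S -> ext_interior c w) ->
  exists a b, [/\ a \in S, b \in S & ext_location c a != ext_location c b].
Proof.
move=> eS S1 iS; have [b bS] : exists b, inl b \in S.
  by case/orP: eS; [exists false|exists true].
have : (0 < #|S :\ inl b|)%N by move: S1; rewrite (cardsD1 (inl b)) bS.
case/card_gt0P => w; rewrite !inE => /andP[wb wS].
by exists (inl b), w; split=> //; apply: ext_location_end; rewrite 1?eq_sym //; exact: iS.
Qed.

End Endpoints.

(** Twigs in the open interval are distinct from the end points, so [ext] is here the centred
    configuration of all these points together. *)
Lemma ext_config_of T U (p : U -> (bool + T)%type) (x : T -> R) : injective x ->
  injective p -> (forall u, ext_interior (config_of x) (p u)) ->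
  limit_config (pull_raw p (ext (config_of x))).
Proof.
move=> xinj pinj ip; set y := ext_location (config_of x) \o p.
have yinj : injective y.
  move=> u v; rewrite /y /= => yuv; apply: pinj.
  have := ip u; have := ip v; move: yuv.
  case: (p u) => [b|t]; case: (p v) => [b'|t'] yuv iv iu.
  - by apply/eqP; apply: contraT => /(ext_location_end iv); rewrite yuv eqxx.
  - by have := ext_location_end (b := b) iv isT; rewrite yuv eqxx.
  - by have := ext_location_end (b := b') iu isT; rewrite yuv eqxx.
  - by rewrite (xinj _ _ yuv).
rewrite (_ : pull_raw _ _ = centred (config_of y)).
  by apply: limit_centred; apply: subset_closure; exists y.
congr pair; rewrite /= (direction_embed (ext_location (config_of x)) pinj).
apply/funext => S; apply/funext => u; case: ifP => // uS; rewrite imset_f //=.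
case: ifP => // eS; case pu : (p u) => [b|t].
  by move: eS (imset_f p uS); rewrite pu; case: b {pu} => /[swap] ->; rewrite ?orbT.
set V := [set t | _]%SET.
have tV : t \in V by rewrite inE -pu imset_f.
have inrinj : injective (@inr bool T) by move=> a b [].
have VE : inr @: V = p @: S.
  apply/setP => -[b|t']; last by rewrite mem_imset // inE.
  rewrite (_ : inl b \in p @: S = false); last first.
    by case: b; move: eS => /negbT; rewrite negb_or => /andP[/negbTE ? /negbTE ?].
  by apply/imsetP => -[].
have := direction_embed (ext_location (config_of x)) inrinj.
by move=> /(congr1 (fun g => g V t)); rewrite tV VE => <-.
Qed.

(** The danger is a twig running into an end point. If all twigs are interior, a set with an end
    point and at least two elements has two distinct locations, and [direction] is continuous
    there. *)
Lemma pull_ext_cvg T U (p : U -> (bool + T)%type) (c : conf R T) : injective p ->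
  (forall u, ext_interior c (p u)) ->
  {for c, continuous (fun d => pull_raw p (ext d))}.
Proof.
move=> pinj ip.
have cl w : continuous (fun d : conf R T => ext_location d w).
  by case: w => [b|t]; [exact: cst_continuous|exact: continuous_location].
apply: (@cvg_conf _ _ (nbhs c) (nbhs_filter c)) => [u|S u]; first exact: cvg_cst.
rewrite /=; case: ifP => uS; last exact: cvg_cst.
rewrite imset_f //=; case: ifP => eS.
  have [S1|S1] := ltnP 1 #|p @: S|; last first.
    by rewrite /direction ltnNge S1 /=; exact: cvg_cst.
  have [|a [b [aS bS ab]]] := @ext_end_nonconstant T c (p @: S) eS S1.
    by move=> _ /imsetP[v _ ->].
  apply: (direction_cvg _ aS bS ab) => w; exact: cl.
case: (p u) => [b|t]; first exact: cvg_cst.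
exact: continuous_screen.
Qed.

Lemma limit_ext T U (p : U -> (bool + T)%type) (c : conf R T) :
  limit_config c -> injective p -> (forall u, ext_interior c (p u)) ->
  limit_config (pull_raw p (ext c)).
Proof.
move=> lc pinj ip; apply: (@closed_closure _ (distinct_configs (T := U))).
move=> V /(pull_ext_cvg pinj ip) nV'.
have nV : nbhs c ((fun d => pull_raw p (ext d)) @^-1` V) by exact: nV'.
have ni : \forall d \near c, forall u, ext_interior c (p u) ==> ext_interior d (p u).
  apply: (@filter_forall _ U (fun u d => ext_interior c (p u) ==> ext_interior d (p u))
    _ (nbhs_filter c)) => u.
  case: (p u) => [b|t] /=; first by near=> d.
  case: (boolP (interior c t)) => [/andP[c0 c1]|_]; last by near=> d.
  have n0 := near_ltR (@cst_continuous _ R 0) (@continuous_location R T t) c0.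
  have n1 := near_ltR (@continuous_location R T t) (@cst_continuous _ R 1) c1.
  by apply: filterS2 n0 n1 => d d0 d1; rewrite /interior d0 d1.
have [x [xinj [xV xi]]] := limit_nbhs lc (@filterI _ (nbhs c) _ _ _ nV ni).
exists (pull_raw p (ext (config_of x))); split => //.
by apply: ext_config_of => // u; have := xi u; rewrite ip.
Unshelve. all: by end_near. Qed.

Lemma before_ext_inr T (c : conf R T) t t' :
  before (ext c) (inr t) (inr t') = before c t t'.
Proof.
rewrite /before !ext_screen_inr ?inE ?eqxx ?orbT //.
rewrite (_ : [set _ | _]%SET = [set t; t']%SET) //.
by apply/setP => s; rewrite !inE.
Qed.

End Grafting.

(** * Order and grafting in the presence of end points; compactness *)

Section Associahedra.
Variable R : realType.
Implicit Types (T U : finType).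

Lemma before_ext_location T (c : conf R T) w w' :
  (if w is inl _ then true else false) || (if w' is inl _ then true else false) ->
  ext_location c w < ext_location c w' -> before (ext c) w w'.
Proof.
move=> ww' lt_ww'; have eS : (inl false \in [set w; w']%SET) || (inl true \in [set w; w']%SET).
  by case: w ww' {lt_ww'} => [[]|t]; case: w' => [[]|t'] // _; rewrite !inE ?eqxx ?orbT.
rewrite /before !ext_screen // ?inE ?eqxx ?orbT //.
by have [-> ->] := direction_pair lt_ww'; rewrite ltr01.
Qed.

Lemma assoc_ext T k (p : 'I_k -> (bool + T)%type) (c : conf R T) :
  limit_config c -> (forall i j : 'I_k, (i < j)%N -> before (ext c) (p i) (p j)) ->
  (forall i, ext_interior c (p i)) -> assoc R k (pull_raw p (ext c)).
Proof.
move=> lc pmon ip; have pinj : injective p.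
  move=> i j pij; apply/val_inj => /=.
  by case: (ltngtP i j) => // /pmon; rewrite pij before_irr.
split; first by split=> [|i] //; exact: limit_ext.
by move=> i j ij; have := pmon _ _ ij; rewrite -before_pull.
Qed.

Definition ext_map U T (h : U -> T) (w : bool + U) : bool + T :=
  match w with inl b => inl b | inr u => inr (h u) end.

(** By injectivity [p] picks at most one twig from each tree grafted on [c], so the trees themselves
    are invisible. *)
Lemma pull_ext_grafted U T (V : finType) (h : U -> T) (C : conf R U) (c : conf R T)
    (p : V -> (bool + U)%type) :
  limit_config C -> limit_config c -> grafted h C c ->
  injective (ext_map h \o p) ->
  pull_raw p (ext C) = pull_raw (ext_map h \o p) (ext c).
Proof.
move=> lC lc [h1 h2] hinj; congr pair.
apply/funext => S; apply/funext => u; case: ifP => // uS.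
have pS : (ext_map h \o p) @: S = ext_map h @: (p @: S) by rewrite -imset_comp.
have inlE b : (inl b \in (ext_map h \o p) @: S) = (inl b \in p @: S).
  apply/imsetP/imsetP => [[v vS /=]|[v vS pv]]; last by exists v => //=; rewrite -pv.
  by case pv : (p v) => [b'|u'] //= [->]; exists v => //; rewrite pv.
have pinj : injective p by move=> a b pab; apply: hinj; rewrite /= pab.
have hu : ext_map h (p u) \in (ext_map h \o p) @: S by apply/imsetP; exists u.
rewrite /= imset_f // hu /= !inlE; case: ifP => eS.
  have [S1|S1] := ltnP 1 #|S|; last first.
    by rewrite /direction (card_imset _ pinj) (card_imset _ hinj) ltnNge S1.
  have := @direction_imset _ _ _ (ext_map h) (ext_location c) (p @: S) (p u).
  rewrite -pS (card_imset _ hinj) imset_f // => /(_ S1 isT) <-.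
  by congr direction; apply/funext => -[b|v] //=; exact: h1.
case pu : (p u) => [b|v] //=.
set A := [set t | inr t \in p @: S]%SET.
set B := [set t | inr t \in (ext_map h \o p) @: S]%SET.
have BA : B = h @: A.
  apply/setP => t; rewrite inE pS; apply/imsetP/imsetP => [[[b|w] wS //= [->]]|[w wA ->]].
    by exists w => //; rewrite inE.
  by exists (inr w) => //; rewrite inE in wA.
have vA : v \in A by rewrite inE -pu imset_f.
have [hA|hA] := ltnP 1 #|h @: A|; first by rewrite BA h2.
rewrite BA (limit_screen1 _ lc) // limit_screen1 //.
apply: leq_trans hA; rewrite card_in_imset // => a b; rewrite !inE.
move=> /imsetP[i iS ai] /imsetP[j jS bj] hab.
by have [] : inr a = inr b :> bool + U by rewrite ai bj; congr p; apply: hinj;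
  rewrite /= -ai -bj /= hab.
Qed.

Lemma conf_hausdorff T : hausdorff_space (conf R T).
Proof.
apply: hausdorff_prod.
  by apply: (@hausdorff_product T (fun=> R)) => i; exact: Rhausdorff.
apply: (@hausdorff_product {set T} (fun=> {ptws T -> R})) => S.
by apply: (@hausdorff_product T (fun=> R)) => i; exact: Rhausdorff.
Qed.

Lemma closed_FM (L : set R) T : closed L -> closed (FM L T).
Proof.
move=> cL; rewrite (_ : FM L T = closure (distinct_configs (T := T)) `&`
    \bigcap_(i in [set: T]) ((fun c : conf R T => c.1 i) @^-1` L)).
  apply: (@closedI (conf R T)); first exact: closed_closure.
  apply: closed_bigI => i _.
  exact: (preimage_closed (in1W (@continuous_location R T i)) cL).
apply/seteqP; split => c [lc Lc]; split=> // i; last exact: Lc.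
by move=> _; exact: Lc.
Qed.

(** All screens lie in [0, 1], and the strict inequalities of the order are closed conditions, since
    the screen of an ordered pair is exactly (0, 1). *)
Lemma compact_assoc k : compact (assoc R k).
Proof.
have c01 : compact (`[0 : R, 1]%classic) by exact: segment_compact.
have ccube : compact ([set x : {ptws 'I_k -> R} | forall i, `[0 : R, 1]%classic (x i)] `*`
    [set w : prod_topology (fun _ : {set 'I_k} => {ptws 'I_k -> R}) |
      forall S, [set x : {ptws 'I_k -> R} | forall i, `[0 : R, 1]%classic (x i)] (w S)]).
  have cI : compact [set x : {ptws 'I_k -> R} | forall i, `[0 : R, 1]%classic (x i)].
    exact: (@tychonoff 'I_k (fun=> R) (fun=> `[0 : R, 1]%classic) (fun=> c01)).
  apply: compact_setX => //.
  exact: (@tychonoff {set 'I_k} (fun=> {ptws 'I_k -> R}) _ (fun=> cI)).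
apply: subclosed_compact ccube _; last first.
  move=> c [[lc c0] _]; split => /= [i|S i].
    by rewrite c0 in_itv /= lexx ler01.
  by rewrite in_itv /=; apply: screen_itv.
rewrite (_ : assoc R k = FM [set 0] 'I_k `&` \bigcap_(p in [set p : 'I_k * 'I_k | (p.1 <
  p.2)%N])
   [set c : conf R 'I_k | c.2 [set p.1; p.2]%SET p.1 = 0 /\ c.2 [set p.1; p.2]%SET p.2 = 1]).
  apply: (@closedI (conf R 'I_k)); first by apply: closed_FM; exact: closed_eq.
  apply: closed_bigI => p _; apply: (@closedI (conf R 'I_k)).
    apply: closed_eqR; last exact: cst_continuous.
    exact: (@continuous_screen R 'I_k).
  apply: closed_eqR; last exact: cst_continuous.
  exact: (@continuous_screen R 'I_k).
apply/seteqP; split => c [Fc co]; split=> //; last first.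
  by move=> i j ij; have [-> ->] := co (i, j) ij; rewrite ltr01.
move=> [i j] /= ij.
have [//|//|[ci cj]] := @limit_pair R _ c i j Fc.1; first by rewrite neq_ltn ij.
by have := co _ _ ij; rewrite ci cj ltr10.
Qed.

End Associahedra.

(** * Faces of the associahedra *)

Section Faces.
Variables (R : realType) (r s : nat) (j : 'I_r.+2).

(** Left inverse of [face_index]: where input [a] of the outer factor, or input [t] of the inner one
    if [a = j], ends up in the composition. *)
Definition face_pos (a : 'I_r.+2) (t : 'I_s.+2) : nat :=
  (if a < j then a : nat else if a == j then j + t else a + s.+1)%N.

Lemma face_index_pos (i : 'I_(r + s).+3) :
  face_pos (tag (face_index j i)) (tagged (face_index j i)) = i.
Proof.
have := ltn_ord i; have := ltn_ord j; rewrite /face_index.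
case: ifP => i1 jr i_s; first by rewrite /face_pos /= inordK ?i1 //; lia.
case: ifP => i2; first by rewrite /face_pos /= ltnn eqxx inordK; lia.
by rewrite /face_pos /= -val_eqE /= inordK; [case: ifP; [lia|case: ifP; lia]|lia].
Qed.

(* The input [o] of the face represents the whole face. *)
Definition skip_face (o : 'I_s.+2) (a : 'I_r.+2) : 'I_(r + s).+3 :=
  inord (face_pos a o).

Definition in_face (t : 'I_s.+2) : 'I_(r + s).+3 := inord (j + t).

Lemma skip_faceE o a : skip_face o a = face_pos a o :> nat.
Proof.
rewrite inordK //; have := ltn_ord a; have := ltn_ord j; have := ltn_ord o.
by rewrite /face_pos; case: (ltnP a j) => _; [|case: (a == j)]; lia.
Qed.

Lemma in_faceE t : in_face t = (j + t)%N :> nat.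
Proof. by rewrite inordK //; have := ltn_ord t; have := ltn_ord j; lia. Qed.

Lemma skip_face_homo o : {homo skip_face o : a b / (a < b)%N}.
Proof.
move=> a b; rewrite !skip_faceE /face_pos -!val_eqE /=; have := ltn_ord o.
case: (ltngtP a j) => ?; case: (ltngtP b j) => ?; lia.
Qed.

Lemma in_face_homo : {homo in_face : a b / (a < b)%N}.
Proof. by move=> a b; rewrite !in_faceE ltn_add2l. Qed.

Definition face_tag (i : 'I_(r + s).+3) : 'I_r.+2 := tag (face_index j i).

(** [e] lies in the face at [j]: sets that meet several blocks see the face as its single input [o].
    The representative [o] is a parameter because the last face is represented by its last input and
    the others by their first. *)
Definition collapsible (o : 'I_s.+2) (e : conf R 'I_(r + s).+3) : Prop :=
  forall (S : {set 'I_(r + s).+3}) i, i \in S -> (1 < #|face_tag @: S|)%N ->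
    e.2 S i = e.2 ((skip_face o \o face_tag) @: S) (skip_face o (face_tag i)).

(** A set either meets several blocks, or lies in one block outside the face and is a singleton, or
    lies in the face, where [d] has its screen. *)
Lemma assoc_comp_faces o (e : conf R 'I_(r + s).+3) (c : assoc R r.+2)
    (d : assoc R s.+2) : assoc R _ e -> collapsible o e ->
  val c = pull_raw (skip_face o) e -> val d = pull_raw in_face e ->
  val (assoc_comp j c d) = e.
Proof.
move=> ae eE cE dE; have [[le e0] _] := ae.
rewrite /= cE dE; case: (e) e0 eE le => y w /= y0 wE le.
congr pair; first by apply/funext => i; rewrite /= y0 y0.
apply/funext => S; apply/funext => i; case: ifP => iS; last first.
  by have /= -> := screen_out (S := S) (i := i) le; rewrite ?iS ?andbF.
have tagE : tag @: (face_index j @: S) = face_tag @: S by rewrite -imset_comp.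
rewrite /= imset_f //= tagE; case: ifP => S1.
  have hu : tag (face_index j i) \in face_tag @: S by apply/imsetP; exists i.
  by rewrite hu [RHS]wE // (imset_comp (skip_face o) face_tag).
set V := [set t | _]%SET.
have iV : tagged (face_index j i) \in V.
  by rewrite inE; apply/imsetP; exists i => //; case: (face_index j i).
rewrite iV; have [tj|tj] := eqVneq (face_tag i) j; last first.
  have tS u : u \in S -> face_tag u = face_tag i.
    move=> uS; apply/eqP; apply: contraFT S1 => ui; apply/card_gt1P.
    by exists (face_tag u), (face_tag i); split=> //; exact: imset_f.
  have Si : S = [set i]%SET.
    apply/setP => u; rewrite inE; apply/idP/eqP => [uS|->//].
    apply/val_inj; rewrite /= -(face_index_pos u) -(face_index_pos i).
    have := tS _ uS; rewrite /face_tag => ->.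
    by rewrite /face_pos; case: ifP => //; rewrite -/(face_tag i) (negbTE tj).
  have V1 : (#|in_face @: V| <= 1)%N.
    apply: leq_trans (leq_imset_card _ _) _.
    apply: leq_trans (subset_leq_card (B := [set tagged (face_index j i)]%SET) _) _.
      apply/fintype.subsetP => t; rewrite /V Si imset_set1 !inE => /eqP E.
      by rewrite -E.
    by rewrite cards1.
  have /= -> := limit_screen1 (in_face (tagged (face_index j i))) le V1.
  by have /= -> := limit_screen1 (S := S) i le; rewrite // Si cards1.
have fE u : face_tag u = j -> in_face (tagged (face_index j u)) = u.
  move=> uj; apply/val_inj; rewrite /= in_faceE -[RHS]face_index_pos /face_pos.
  by rewrite -/(face_tag u) uj ltnn eqxx.
have {}tS u : u \in S -> face_tag u = j.
  move=> uS; apply/eqP; rewrite -tj; apply: contraFT S1 => ui; apply/card_gt1P.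
  by exists (face_tag u), (face_tag i); split=> //; exact: imset_f.
rewrite fE //; congr (w _ i); apply/setP => v; apply/imsetP/idP => [[t tV ->]|vS].
  move: tV; rewrite inE => /imsetP[u uS E]; rewrite (_ : in_face t = u) //.
  by rewrite -(fE u (tS u uS)) -E.
have vj := tS v vS; exists (tagged (face_index j v)); last by rewrite fE.
rewrite inE; apply/imsetP; exists v => //.
move: tj vj; rewrite /face_tag; case: (face_index j i) => a b /= ->.
by case: (face_index j v) => a' b' /= ->.
Qed.

Lemma skip_face_tag o (i : 'I_(r + s).+3) :
  skip_face o (face_tag i) = (if j <= i < j + s.+2 then j + o else i)%N :> nat.
Proof.
rewrite skip_faceE /face_tag -[in RHS](face_index_pos i) /face_pos.
case: (face_index j i) => a t /=; have := ltn_ord o; have := ltn_ord t.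
by rewrite -!val_eqE /=; case: (ltngtP a j) => ? ? ?; case: ifP; lia.
Qed.

End Faces.

(** * Scaled configurations *)

Section Rescaling.
Variable R : realType.
Implicit Types (T U : finType).

(** Otherwise the screen would be nonzero at a nearby distinct configuration with the same order,
    where the minimum is attained at [i]. *)
Lemma screen_first T (c : conf R T) (S : {set T}) i : limit_config c ->
  (forall j, j \in S -> j != i -> before c i j) -> c.2 S i = 0.
Proof.
move=> lc iS; apply/eqP; apply: contraT => ci.
have nP : \forall d \near c, d.2 S i != 0.
  by have := @continuous_screen R T S i c; move=> /cvgr_neq0; apply.
have [x [xinj xi xE]] := limit_order lc nP; case/eqP: xi.
apply: direction_min => j jS; have [->//|ji] := eqVneq j i.
by rewrite ltW // -xE iS.
Qed.

Lemma screen_last T (c : conf R T) (S : {set T}) i : limit_config c ->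
  (1 < #|S|)%N -> i \in S ->
  (forall j, j \in S -> j != i -> before c j i) -> c.2 S i = 1.
Proof.
move=> lc S1 iS Si; apply/eqP; apply: contraT; rewrite -subr_eq0 => ci.
have nP : \forall d \near c, d.2 S i - 1 != 0.
  have := @continuousBR R _ _ _ (@continuous_screen R T S i) (@cst_continuous _ R 1) c.
  by move=> /cvgr_neq0; apply.
have [x [xinj xi xE]] := limit_order lc nP; case/eqP: xi.
have : (0 < #|S :\ i|)%N by move: S1; rewrite (cardsD1 i) iS.
case/card_gt0P => a; rewrite !inE => /andP[ai aS].
apply/eqP; rewrite subr_eq0; apply/eqP.
apply: (@direction_max _ _ _ _ _ a) => //.
  move=> j jS; have [->//|ji] := eqVneq j i.
  by rewrite ltW // -xE Si.
by apply: contra ai => /eqP /xinj ->.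
Qed.

Lemma direction_id T (y : T -> R) (S : {set T}) i a b : i \in S ->
  a \in S -> b \in S -> y a = 0 -> y b = 1 ->
  (forall j, j \in S -> 0 <= y j <= 1) -> direction y S i = y i.
Proof.
move=> iS aS bS ya yb y01; have S1 : (1 < #|S|)%N.
  apply/card_gt1P; exists a, b; split=> //; apply/eqP => ab.
  by move: (oner_eq0 R); rewrite -yb -ya ab eqxx.
have := direction_mul y S1 iS.
have -> : low y S i = 0.
  apply/eqP; rewrite eq_le -{1}ya low_le //=; apply/bigmin_geP.
  by split=> [|j jS]; [have /andP[] := y01 _ iS|have /andP[] := y01 _ jS].
have -> : high y S i = 1.
  apply/eqP; rewrite eq_le -{2}yb le_high // andbT; apply/bigmax_leP.
  by split=> [|j jS]; [have /andP[] := y01 _ iS|have /andP[] := y01 _ jS].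
by rewrite !subr0 mulr1.
Qed.

Section Ends.
Variables (k : nat) (c : conf R 'I_k.+2).
Hypothesis ac : assoc R k.+2 c.

Let z (i : 'I_k.+2) : R := c.2 [set: 'I_k.+2]%SET i.

Lemma assoc_limit : limit_config c. Proof. by case: ac => -[]. Qed.

Lemma assoc_before i j : before c i j = (i < j)%N.
Proof. by apply: in_orderE; [exact: assoc_limit|case: ac]. Qed.

Lemma screen_ord0 : z ord0 = 0.
Proof.
apply: (screen_first assoc_limit) => j _ j0.
by rewrite assoc_before lt0n.
Qed.

Lemma screen_ord_max : z ord_max = 1.
Proof.
apply: (screen_last assoc_limit); rewrite ?cardsT ?card_ord ?inE // => j _ jm.
by rewrite assoc_before; have := ltn_ord j; move: jm; rewrite -val_eqE /=; lia.
Qed.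

Lemma screen_homo (i j : 'I_k.+2) : (i <= j)%N -> z i <= z j.
Proof.
rewrite leq_eqVlt => /orP[/eqP /val_inj -> //|ij].
by apply: (before_screen assoc_limit); rewrite ?inE // assoc_before.
Qed.

Lemma screenT_itv i : 0 <= z i <= 1.
Proof. exact: (screen_itv _ _ assoc_limit). Qed.

(* The place in [c] of a point of [ext (rescale_raw f c)]. *)
Definition unext U (f : U -> 'I_k.+2) (w : bool + U) : 'I_k.+2 :=
  match w with inl b => if b then ord_max else ord0 | inr u => f u end.

(** The root screen of [c] is 0 at the first input and 1 at the last, so these inputs play the role
    of the added end points. Twigs located at 0 or 1 are excluded, as they lie in one tree of [c]
    with the first or last input. *)
Lemma pull_ext_rescale U (V : finType) (f : U -> 'I_k.+2) (p : V -> (bool + U)%type) :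
  injective f -> injective p -> (forall v, ext_interior (rescale_raw f c) (p v)) ->
  pull_raw p (ext (rescale_raw f c)) = pull_raw (unext f \o p) c.
Proof.
move=> finj pinj ip.
have zE w : ext_location (rescale_raw f c) w = z (unext f w).
  by case: w => [[]|u] //=; rewrite ?screen_ord0 ?screen_ord_max.
have uinj : injective (unext f \o p).
  move=> v v' /= vv'; apply: pinj; move: (ip v) (ip v') vv'.
  case: (p v) => [b|u]; case: (p v') => [b'|u'] iv iv' E.
  - apply/eqP; apply: contraT => /(ext_location_end iv').
    by rewrite !zE E eqxx.
  - by have := ext_location_end (b := b) iv' isT; rewrite !zE E eqxx.
  - by have := ext_location_end (b := b') iv isT; rewrite !zE -E eqxx.
  - by congr inr; exact: finj.
have lr : limit_config (rescale_raw f c).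
  have [] : FM `[0, 1] U (rescale_raw f c) by apply: (@FM_rescale _ _ _ f _ c finj _
    ac.1); rewrite card_ord.
  by [].
have le := limit_ext lr pinj ip.
have lp := limit_pull uinj assoc_limit.
congr pair; first by apply/funext => v; rewrite /= (ac.1).2.
apply/funext => S; apply/funext => v; have [S1|S1] := ltnP 1 #|S|; last first.
  by rewrite -[LHS]/((pull_raw p (ext (rescale_raw f c))).2 S v)
    -[RHS]/((pull_raw (unext f \o p) c).2 S v) !limit_screen1.
case: ifP => // vS; rewrite (imset_comp (unext f) p).
have pS : (1 < #|p @: S|)%N by rewrite card_imset.
have vpS : p v \in p @: S by exact: imset_f.
case: (boolP ((inl false \in p @: S) || (inl true \in p @: S))) => eS; last first.
  case pv : (p v) eS vpS => [b|u] eS vpS; first by case: b {pv} vpS eS => ->; rewrite ?orbT.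
  rewrite ext_screen_inr //= inE vpS pv /=; congr (c.2 _ _); apply/setP => i.
  apply/imsetP/imsetP => [[u']|[[b|u'] wS ->]].
  - by rewrite inE => u'S ->; exists (inr u').
  - by move: eS wS => /norP[/negbTE n0 /negbTE n1]; case: b; rewrite ?n0 ?n1.
  - by exists u' => //; rewrite inE.
have iS w : w \in p @: S -> ext_interior (rescale_raw f c) w by move=> /imsetP[v' _ ->].
have [a [b [aS bS ab]]] := ext_end_nonconstant eS pS iS; rewrite ext_screen //.
rewrite -[RHS]/(c.2 (unext f @: (p @: S)) (unext f (p v))).
(* The root screen is not constant on a set with an end point, hence determines its screen. *)
rewrite [RHS](@limit_screen _ _ c [set: 'I_k.+2]%SET _ _ (unext f a) (unext f b)).
- rewrite -[RHS](direction_imset _ _ vpS); last by rewrite -imset_comp card_imset.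
  by congr direction; apply/funext => w; exact: zE.
- exact: assoc_limit.
- exact: finset.subsetT.
- exact: imset_f.
- exact: imset_f.
- exact: imset_f.
- by move: ab; rewrite !zE.
Qed.

End Ends.

Lemma limit_affine T (c : conf R T) (u v : R) : 0 < v -> limit_config c ->
  limit_config ((fun i => u + v * c.1 i, c.2) : conf R T).
Proof.
move=> v0; set f : conf R T -> conf R T := fun c => (fun i => u + v * c.1 i, c.2).
have cf : continuous f.
  apply: continuous_conf => [i|S i]; last exact: (@continuous_screen R T S i).
  apply: continuousDR; first exact: cst_continuous.
  by apply: continuousMR; [exact: cst_continuous|exact: continuous_location].
apply: (image_closure cf) => _ [x xinj <-]; apply: subset_closure.
exists (fun i => u + v * x i).
  by move=> i j /addrI /(mulfI (lt0r_neq0 v0)) /xinj.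
by congr pair; apply/funext => S; apply/funext => i; exact: (@direction_affine _ _ _ _ u v).
Qed.

Lemma fm_eqP (L : set R) T (c d : FM L T) : val c = val d -> c = d.
Proof. exact: val_inj. Qed.

Lemma B_config_continuous m : continuous (@B_config R m).
Proof.
apply: continuous_set_type => c.
apply: (@continuous_comp _ _ _ (fun c : assoc R m.+2 => val c) (rescale_raw (@middle m))).
  exact: set_val_continuous.
exact: rescale_raw_continuous.
Qed.

Lemma E_config_continuous m : continuous (@E_config R m).
Proof.
apply: continuous_set_type => c.
apply: (@continuous_comp _ _ _ (fun c : assoc R m.+2 => val c) (rescale_raw (lift ord0))).
  exact: set_val_continuous.
exact: rescale_raw_continuous.
Qed.

Lemma fm_pull_continuous (L : set R) T U (f : U -> T) (finj : injective f) :
  continuous (@fm_pull R L U T f finj).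
Proof.
apply: continuous_set_type => c.
apply: (@continuous_comp _ _ _ (fun c : FM L T => val c) (pull_raw f)).
  exact: set_val_continuous.
exact: pull_raw_continuous.
Qed.

(* Renumbering lists the points in increasing order. *)
Lemma limit_sort k (c : conf R 'I_k) : limit_config c ->
  exists s : 'S_k, forall i j, before c i j = (s i < s j)%N.
Proof.
move=> lc; have [x [xinj _ xE]] := limit_order lc filterT.
pose rank i := #|[set j | x j < x i]%SET|.
have rankP i : (rank i < k)%N.
  rewrite -[X in (_ < X)%N]card_ord -cardsT; apply: proper_card.
  by apply/properP; split; [exact: finset.subsetT|exists i; rewrite ?inE ?ltxx].
have rank_lt i j : x i < x j -> (rank i < rank j)%N.
  move=> xij; apply: proper_card; apply/properP; split.
    by apply/fintype.subsetP => l; rewrite !inE => /lt_trans; apply.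
  by exists i; rewrite inE ?ltxx.
have rinj : injective (fun i => Ordinal (rankP i)).
  move=> i j [] ij; apply/xinj/eqP; rewrite eq_le !leNgt.
  by apply/andP; split; apply/negP => /rank_lt; rewrite ij ltnn.
exists (perm rinj) => i j; rewrite !permE xE /=; apply/idP/idP; first exact: rank_lt.
by case: (ltgtP (x i) (x j)) => // [/rank_lt ji /(ltn_trans ji)|/xinj ->]; rewrite ltnn.
Qed.

Lemma pull_inr_ext T (c : conf R T) : limit_config c ->
  pull_raw inr (ext c) = centred c.
Proof.
move=> lc; congr pair; apply/funext => S; apply/funext => i.
case: ifP => iS; last by rewrite (screen_out lc) // iS andbF.
rewrite ext_screen_inr ?imset_f //; last by apply/norP; split; apply/imsetP => -[].
congr (c.2 _ _); apply/setP => j; rewrite inE mem_imset // => a b []; exact.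
Qed.

(** The preimage is obtained by adding the end points with [ext] and numbering all points in
    increasing order. *)
Lemma rescale_surj_interior k (c : FM `[0 : R, 1] 'I_k) :
  (forall i, interior (val c) i) ->
  exists (s : 'S_k) (e : assoc R k.+2), fm_pull (@perm_inj _ s) (B_config e) = c.
Proof.
move=> ic; have lc := FM_limit c; have [s sE] := limit_sort lc.
pose p (i : 'I_k.+2) : bool + 'I_k :=
  match unlift ord0 i with
  | None => inl false
  | Some j => match unlift ord_max j with None => inl true | Some l => inr ((s^-1)%g l) end
  end.
have p0 : p ord0 = inl false by rewrite /p unlift_none.
have pm l : p (middle l) = inr ((s^-1)%g l) by rewrite /p /middle !liftK.
have pE (i : 'I_k.+2) : [\/ i = ord0, i = ord_max | exists l, i = middle l].
  case: (unliftP ord0 i) => [j ->|]; last by constructor 1.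
  case: (unliftP ord_max j) => [l ->|->]; first by constructor 3; exists l.
  by constructor 2; apply/val_inj.
have pM : p ord_max = inl true.
  by rewrite /p (_ : ord_max = lift ord0 ord_max) ?liftK ?unlift_none //; apply/val_inj.
have ip i : ext_interior (val c) (p i).
  case: (pE i) => [iE|iE|[l iE]]; rewrite iE ?p0 ?pM ?pm //=; exact: ic.
have ae : assoc R k.+2 (pull_raw p (ext (val c))).
  apply: assoc_ext => // i j ij.
  have mE (l : 'I_k) : middle l = l.+1 :> nat.
    by rewrite /middle /= /bump /= leqNgt ltn_ord /=.
  have := ic; rewrite /interior => ic'.
  case: (pE i) => [iE|iE|[l iE]]; case: (pE j) => [jE|jE|[l' jE]];
    rewrite iE jE ?p0 ?pM ?pm; move: ij; rewrite iE jE ?mE //= ?ltnn //.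
  - by move=> _; apply: before_ext_location => //=; rewrite ltr01.
  - by move=> _; apply: before_ext_location => //=; case/andP: (ic' ((s^-1)%g l')).
  - by rewrite ltnNge ltnW // ltnS ltn_ord.
  - by move=> _; apply: before_ext_location => //=; case/andP: (ic' ((s^-1)%g l)).
  - by rewrite ltnS before_ext_inr sE !permKV.
exists s, (exist (fun c => c \in assoc R k.+2) _ (mem_set ae)); apply: fm_eqP => /=.
have n0 : inl false \in p @: [set: 'I_k.+2]%SET by apply/imsetP; exists ord0; rewrite ?inE ?p0.
have n1 : inl true \in p @: [set: 'I_k.+2]%SET by apply/imsetP; exists ord_max;
  rewrite ?inE ?pM.
have ni i : inr i \in p @: [set: 'I_k.+2]%SET.
  by apply/imsetP; exists (middle (s i)); rewrite ?inE // pm permK.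
have psE : (p \o @middle k) \o s = inr by apply/funext => i; rewrite /= pm permK.
have -> : pull_raw s (rescale_raw (@middle k) (pull_raw p (ext (val c)))) =
   ((fun i => (pull_raw p (ext (val c))).2 [set: 'I_k.+2]%SET (middle (s i))),
    (pull_raw s (pull_raw (@middle k) (pull_raw p (ext (val c))))).2) by [].
rewrite !pull_raw_comp psE pull_inr_ext //.
rewrite [RHS]surjective_pairing; congr pair; apply/funext => i.
rewrite /= inE pm permK ni /= n0 /=.
(* With end points at 0 and 1 the locations are already normalised, so the root screen gives them
   back. *)
apply: (@direction_id _ _ _ _ (inl false) (inl true)) => // -[[]|j] _ /=.
- by rewrite lexx ler01.
- by rewrite lexx ler01.
- by have /andP[/ltW -> /ltW ->] := ic j.
Qed.

(* Every configuration in [0, 1] is a limit of configurations in the interior,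
   obtained by contraction towards 1/2, and the associahedra are compact. *)
Lemma rescale_surj k (c : FM `[0 : R, 1] 'I_k) :
  exists (s : 'S_k) (e : assoc R k.+2), fm_pull (@perm_inj _ s) (B_config e) = c.
Proof.
pose q (s : 'S_k) (e : assoc R k.+2) := fm_pull (@perm_inj _ s) (B_config e).
have cq s : continuous (fun e => val (q s e)).
  move=> e; apply: (@continuous_comp _ (FM `[0 : R, 1] 'I_k) _ (q s) val).
    apply: (@continuous_comp _ _ _ (@B_config R k)).
      exact: B_config_continuous.
    exact: fm_pull_continuous.
  exact: set_val_continuous.
pose Q := \bigcup_(s in [set: 'S_k]) range (fun e => val (q s e)).
have cQ : closed Q.
  apply: closed_bigcup => [|s _]; first exact: finite_finset.
  apply: compact_closed; first exact: conf_hausdorff.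
  apply: continuous_compact; last exact/compact_set_type/compact_assoc.
  by apply: continuous_subspaceT => e; exact: cq.
suff [s _ [e _ eE]] : Q (val c) by exists s, e; exact: fm_eqP.
have lc := FM_limit c; have [_ c01] := set_valP c.
pose d (t : R) : conf R 'I_k := (fun i => t / 2 + (1 - t) * (val c).1 i, (val c).2).
apply: (@closed_cvg _ _ (0:R)^'+ _ d _ cQ).
  near=> t; have t0 : 0 < t by near: t; exact: nbhs_right_gt.
  have t1 : t < 1 by near: t; exact: nbhs_right_lt.
  have id i : 0 < (d t).1 i < 1.
    have := c01 i; rewrite /= in_itv /= => /andP[ci0 ci1].
    by apply/andP; split; nra.
  have Fd : FM `[0 : R, 1] 'I_k (d t).
    split; first by apply: limit_affine => //; rewrite subr_gt0.
    by move=> i; rewrite /= in_itv /=; have /andP[/ltW -> /ltW ->] := id i.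
  have [s [e eE]] := @rescale_surj_interior k
    (exist (fun c => c \in FM `[0 : R, 1] 'I_k) _ (mem_set Fd)) id.
  by exists s => //; exists e => //; rewrite /q eE.
have -> : val c = (fun i => 0 / 2 + (1 - 0) * (val c).1 i, (val c).2).
  case: (val c) => y w; congr pair; apply/funext => i.
  by rewrite /= mul0r add0r subr0 mul1r.
apply: cvg_conf => [i|S i]; last exact: cvg_cst.
apply: cvg_at_right_filter; apply: cvgD.
  by apply: cvgM; [exact: cvg_id|exact: cvg_cst].
by apply: cvgM; [apply: cvgB; [exact: cvg_cst|exact: cvg_id]|exact: cvg_cst].
Unshelve. all: by end_near. Qed.

End Rescaling.

(** * Products of labels *)

Section Monoid.
Variables (R : realType) (A : topologicalType).
Variables (rho : forall k, FM1 R k -> ('I_k -> A) -> A) (a0 : A).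
Hypothesis A_monoid : one_monoid rho a0.
Implicit Types (T U W : finType).

Lemma fm_pullE (L : set R) U T (f g : U -> T) (finj : injective f)
    (ginj : injective g) (c : FM L T) : f =1 g -> fm_pull finj c = fm_pull ginj c.
Proof.
move=> fg; apply: fm_eqP; rewrite /=; congr pull_raw; exact/funext.
Qed.

(** Equivariance; the two sizes are kept apart because the sizes of sums and lists that occur are
    only propositionally equal. *)
Lemma rho_pull_bij n n' (f : 'I_n -> 'I_n') (finj : injective f) (c : FM1 R n')
    (a : 'I_n' -> A) : n = n' -> rho (fm_pull finj c) (a \o f) = rho c a.
Proof.
move=> nn'; case: _ / nn' => [] in f finj c a *.
rewrite -[RHS](monoid_equivariant A_monoid (perm finj)).
congr (rho _); last by apply/funext => i; rewrite /= permE.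
by apply: fm_pullE => i; rewrite permE.
Qed.

(** The associativity axiom via [fm_comp_fiber]; an empty fibre contributes the unit. *)
Lemma rho_grafted n k (h : 'I_n -> 'I_k) (C : FM1 R n) (c : FM1 R k) (a : 'I_n -> A) :
  grafted h (val C) (val c) ->
  rho C a = rho c (fun i => rho (fiber_config h C i) (a \o enum_val (A := mem (fiber h i)))).
Proof.
move=> hCc; have bn : (\sum_i #|fiber h i|)%N = n.
  transitivity #|{: {i : 'I_k & 'I_#|fiber h i|}}|; first by rewrite tagnat.card.
  rewrite -[RHS]card_ord; apply: (@bij_eq_card _ _ (@fiber_elt n k h)).
  apply: inj_card_bij; first exact: fiber_elt_inj.
  have /subset_leq_card : [set: 'I_n]%SET \subset (@fiber_elt n k h) @: [set: {i : 'I_k &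
    'I_#|fiber h i|}]%SET.
    by apply/fintype.subsetP => u _; have [s <-] := fiber_elt_surj h u; apply: imset_f.
  by rewrite cardsT => /leq_trans; apply; rewrite -[X in (_ <= X)%N]cardsT leq_imset_card.
rewrite -(rho_pull_bij (@fiber_index_inj n k h) C a bn) -(fm_comp_fiber hCc).
rewrite (monoid_comp A_monoid); congr (rho _); apply/funext => i; congr (rho _).
apply/funext => t; rewrite /= (_ : tagnat.sig _ = Tagged (fun i => 'I_#|fiber h i|) t) //.
by rewrite -[RHS](@tagnat.rankK k (fun i => #|fiber h i|)) tagnat.rankE.
Qed.

Lemma tnth_fst_inj W (l : seq (W * A)) : uniq (unzip1 l) ->
  injective (fun i => (tnth (in_tuple l) i).1).
Proof.
move=> ul i j /=; have w := tnth (in_tuple l) i.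
rewrite !(tnth_nth w) -!(nth_map _ w.1) // => /eqP.
by rewrite nth_uniq ?size_map // => /eqP /val_inj.
Qed.

(** Product of the labels along the tree that the twigs in [l] span in [Z], wherever they are
    located. If there is no such tree the default is [a0]. *)
Definition mul W (Z : conf R W) (l : seq (W * A)) : A :=
  match pselect (FM1 R (size l)
      (pull_raw (fun i => (tnth (in_tuple l) i).1) (centred Z))) with
  | left pf => rho (exist (fun c => c \in FM1 R (size l)) _ (mem_set pf))
      (fun i => (tnth (in_tuple l) i).2)
  | right _ => a0
  end.

(** By equivariance only the pairing of twigs with labels matters, not the order of the list. *)
Lemma mulE W (Z : conf R W) (l : seq (W * A)) n (g : 'I_n -> W) (a : 'I_n -> A)
    (d : FM1 R n) : val d = pull_raw g (centred Z) ->
  perm_eq l [seq (g i, a i) | i <- enum 'I_n] -> mul Z l = rho d a.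
Proof.
move=> dE lE; pose t := map_tuple (fun i => (g i, a i)) (ord_tuple n).
have tE i : tnth t i = (g i, a i) by rewrite tnth_map tnth_ord_tuple.
have /tuple_permP [p lp] : perm_eq l t by move: lE; rewrite -val_ord_tuple.
have sl : size l = n by rewrite lp size_tuple.
pose f (i : 'I_(size l)) := p (cast_ord sl i).
have finj : injective f by move=> i j /perm_inj /cast_ord_inj.
have lf i : tnth (in_tuple l) i = (g (f i), a (f i)).
  rewrite -tE (tnth_nth (g (f i), a (f i))) /=.
  have -> : nth (g (f i), a (f i)) l i =
      nth (g (f i), a (f i)) [tuple tnth t (p i) | i < n] i by rewrite -lp.
  by rewrite -(tnth_nth _ _ (cast_ord sl i)) tnth_map tnth_ord_tuple.
have pullE : pull_raw (fun i => (tnth (in_tuple l) i).1) (centred Z) = pull_raw f (val d).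
  by rewrite dE pull_raw_comp; congr pull_raw; apply/funext => i; rewrite lf.
rewrite /mul -(rho_pull_bij finj d a sl); case: pselect => [pf|[]]; last first.
  by rewrite pullE; exact: (set_valP (fm_pull finj d)).
congr (rho _); last by apply/funext => i; rewrite lf.
exact: fm_eqP.
Qed.

Lemma mul_nil W (Z : conf R W) : mul Z [::] = a0.
Proof. by rewrite /mul; case: pselect => // pf; exact: monoid_base. Qed.

Lemma mul_seq1 W (Z : conf R W) w : limit_config Z -> mul Z [:: w] = w.2.
Proof.
move=> lZ; rewrite /mul; case: pselect => [pf|[]]; first by rewrite (monoid_unit A_monoid).
split=> //; apply: limit_pull; last exact: limit_centred.
by move=> i j _; apply/val_inj; rewrite !ord1.
Qed.

Lemma limit_FM T (c : conf R T) : limit_config c -> FM setT T c.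
Proof. by []. Qed.

Definition to_FM T (c : conf R T) (lc : limit_config c) : FM (setT : set R) T :=
  exist (fun c => c \in FM setT T) c (mem_set (limit_FM lc)).

(** Associativity for lists, reduced to [rho_grafted] by numbering the twigs that occur. A tree
    without twigs enters the outer product with label [a0]. *)
Lemma mul_grafted U T (h : U -> T) (C : conf R U) (c : conf R T) (s : seq T)
    (F : T -> seq (U * A)) :
  limit_config C -> limit_config c -> grafted h C c -> uniq s ->
  (forall t, uniq (unzip1 (F t))) -> (forall t u, u \in unzip1 (F t) -> h u = t) ->
  mul C (flatten [seq F t | t <- s]) = mul c [seq (t, mul C (F t)) | t <- s].
Proof.
move=> lC lc hCc us uF hF; set l := flatten _.
have ul : uniq (unzip1 l).
  rewrite /l; elim: s us {l} => //= t s IH /andP[ts us].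
  rewrite /unzip1 map_cat cat_uniq uF IH // andbT -all_predC.
  apply/allP => u /mapP [w /flatten_mapP [t' t's wF] ->] /=.
  apply: contra ts => wFt.
  rewrite -(hF t w.1) // (hF t' w.1) //; exact: map_f.
have memF w t : t \in s -> w \in F t -> w \in l.
  by move=> ts wF; apply/flatten_mapP; exists t.
have lF w : w \in l -> h w.1 \in s /\ w \in F (h w.1).
  move=> /flatten_mapP [t ts wF].
  by rewrite (hF t w.1) // map_f.
pose g i := (tnth (in_tuple l) i).1.
have ginj : injective g by exact: tnth_fst_inj.
pose st := in_tuple s.
have stinj : injective (tnth st) by exact/tuple_uniqP.
have hg i : h (g i) \in s by have [] := lF _ (mem_tnth i (in_tuple l)).
(* The tree of a twig, numbered by its position in [s]. *)
pose h' (i : 'I_(size l)) : 'I_(size s) := Ordinal (etrans (index_mem _ _) (hg i)).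
have h'E i : tnth st (h' i) = h (g i).
  by rewrite (tnth_nth (h (g i))) /= nth_index.
pose C' := fm_local ginj (to_FM lC).
pose c' := fm_local stinj (to_FM lc).
have hC'c' : grafted h' (val C') (val c').
  split=> // S i iS S1; case: hCc => _ hC.
  have hS : h @: (g @: S) = tnth st @: (h' @: S).
    by rewrite -!imset_comp; apply: eq_imset => j; rewrite /= h'E.
  rewrite /= iS imset_f // hC ?imset_f //; last by rewrite hS (card_imset _ stinj).
  by rewrite hS -h'E.
rewrite (@mulE _ C l _ g (fun i => (tnth (in_tuple l) i).2) C') //; last first.
  rewrite (_ : map _ _ = l) //; rewrite -[RHS](map_tnth_enum (in_tuple l)).
  by apply: eq_map => i; rewrite /g -surjective_pairing.
rewrite (rho_grafted _ hC'c') (@mulE _ c _ _ (tnth st) (fun i => mul C (F (tnth st i))) c') //.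
  congr (rho _); apply/funext => i.
  rewrite (@mulE _ C (F (tnth st i)) _ (g \o enum_val (A := mem (fiber h' i)))
    ((fun i => (tnth (in_tuple l) i).2) \o enum_val (A := mem (fiber h' i)))
      (fiber_config h' C' i)) //.
    by rewrite -pull_raw_comp.
  apply: uniq_perm.
  - exact: map_uniq (uF _).
  - rewrite map_inj_uniq ?enum_uniq // => a b [/ginj /enum_val_inj -> //].
  move=> w; apply/idP/mapP => [wF|[a _ ->]]; last first => /=.
    have := enum_valP (A := mem (fiber h' i)) a; rewrite inE => /eqP hi.
    move: (enum_val a) hi => j <-; rewrite h'E /g -surjective_pairing.
    by have [] := lF _ (mem_tnth j (in_tuple l)).
  have wl : w \in l by apply: memF wF; exact: mem_tnth.
  have /tnthP [j wj] : w \in in_tuple l by [].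
  have jf : j \in mem (fiber h' i).
    rewrite inE; apply/eqP/stinj; rewrite h'E /g -wj.
    by apply: hF; exact: map_f.
  exists (enum_rank_in jf j); rewrite ?mem_enum //=.
  by rewrite enum_rankK_in // /g -wj -surjective_pairing.
by rewrite -[s in map _ s](map_tnth_enum st) -map_comp.
Qed.

End Monoid.

(** * Relations common to B(A) and E(A) *)

Section PositionLists.
Variables (R : realType) (W : finType) (Z : conf R W).
Implicit Types (s F : seq W).

Definition collapse F w u : W := if u \in F then w else u.

(** [collapsible] for a list [s] of twigs of [Z]: seen from outside, the twigs in [F] are the single
    twig [w]. *)
Definition clustered s F w : Prop :=
  forall (S : {set W}) u, {subset S <= s} -> u \in S ->
    (1 < #|collapse F w @: S|)%N -> Z.2 S u = Z.2 (collapse F w @: S) (collapse F w u).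

Definition place n d s : 'I_n -> W := fun i => nth d s i.

Lemma place_inj n d s : size s = n -> uniq s -> injective (@place n d s).
Proof.
move=> sn us i j /eqP; rewrite /place nth_uniq ?sn // => /eqP.
exact: val_inj.
Qed.

Lemma assoc_uniq n d s : size s = n -> assoc R n (pull_raw (place d s) Z) -> uniq s.
Proof.
move=> sn [_ co]; apply/(uniqP d) => i j; rewrite !inE sn => ik jk ij.
have lt (a b : 'I_n) : place d s a = place d s b -> (a < b)%N -> False.
  by move=> ab /co; rewrite -/(before _ a b) before_pull ab before_irr.
by case: (ltngtP i j) => // [/(lt (Ordinal ik) (Ordinal jk))|/(lt (Ordinal jk) (Ordinal
  ik))] [].
Qed.

Section Face.
Variables (d : W) (s1 F s2 : seq W) (r s : nat) (j : 'I_r.+2) (o : 'I_s.+2).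
Hypotheses (s1j : size s1 = j) (Fs : size F = s.+2) (s2r : (size s1 + size s2 = r.+1)%N).

Let w := nth d F o.

Lemma place_skip_face :
  place d (s1 ++ F ++ s2) \o skip_face j o =1 @place r.+2 d (s1 ++ w :: s2).
Proof.
move=> a; rewrite /place /= skip_faceE /face_pos !nth_cat s1j Fs -!val_eqE /=.
have := ltn_ord o; case: (ltngtP a j) => aj os.
- by rewrite aj.
- rewrite ifF; last by lia.
  rewrite ifF; last by lia.
  rewrite (_ : (a - j)%N = (a - j).-1.+1) /=; last by lia.
  by congr nth; lia.
- by rewrite ifF ?addKn ?os ?aj ?subnn //; lia.
Qed.

Lemma place_in_face : place d (s1 ++ F ++ s2) \o in_face j =1 @place s.+2 d F.
Proof.
move=> t; rewrite /place /= in_faceE !nth_cat s1j Fs.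
by rewrite ifF ?addKn ?ltn_ord //; lia.
Qed.

Hypothesis us : uniq (s1 ++ F ++ s2).

Lemma size_face : size (s1 ++ F ++ s2) = (r + s).+3.
Proof. by rewrite !size_cat Fs; move: s2r; lia. Qed.

Lemma collapse_place (i : 'I_(r + s).+3) :
  collapse F w (place d (s1 ++ F ++ s2) i) =
  place d (s1 ++ F ++ s2) (skip_face j o (face_tag j i)).
Proof.
rewrite /place skip_face_tag /collapse.
have -> : (nth d (s1 ++ F ++ s2) i \in F) = (j <= i < j + s.+2)%N.
  move: us; rewrite !cat_uniq => /and3P[_ s1F /and3P[_ Fs2 _]].
  rewrite !nth_cat s1j Fs; case: ltnP => ij /=.
    apply: contraNF s1F => iF; apply/hasP; exists (nth d s1 i).
      by rewrite mem_cat iF.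
    by rewrite mem_nth ?s1j.
  case: ifP => is_; first by rewrite mem_nth ?Fs //; lia.
  rewrite (_ : (i < _)%N = false); last by lia.
  apply: contraNF Fs2 => iF; apply/hasP; exists (nth d s2 (i - j - s.+2)) => //.
  have s2E : size s2 = (r.+1 - j)%N by move: s2r; rewrite s1j; lia.
  rewrite mem_nth // s2E; move: (ltn_ord i) ij is_; clear; lia.
case: ifP => // ij; rewrite !nth_cat s1j Fs.
by rewrite ifF ?addKn ?ltn_ord //; lia.
Qed.

Lemma collapsible_place : clustered (s1 ++ F ++ s2) F w ->
  collapsible j o (pull_raw (@place (r + s).+3 d (s1 ++ F ++ s2)) Z).
Proof.
move=> cl S i iS S1.
set p := place d _; set g := skip_face j o \o face_tag j.
have pg : collapse F w @: (p @: S) = p @: (g @: S).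
  by rewrite -!imset_comp; apply: eq_imset => l; rewrite /= collapse_place.
have gS : g i \in g @: S by exact: imset_f.
rewrite /= iS gS cl ?imset_f //.
- by rewrite pg collapse_place.
- by move=> _ /imsetP[l _ ->]; rewrite mem_nth ?size_face.
rewrite pg card_imset; last exact: place_inj size_face us.
rewrite /g imset_comp card_imset // => a b /(congr1 val) /=.
case: (ltngtP a b) => [/(skip_face_homo j o)|/(skip_face_homo j o)|/val_inj //];
  by move=> ab ba; move: ab; rewrite ba ltnn.
Qed.

End Face.
End PositionLists.

(** * Stasheff's relations for lists of labelled positions *)

Section Collapsing.
Variables (R : realType) (A : topologicalType).
Variables (rho : forall k, FM1 R k -> ('I_k -> A) -> A) (a0 : A).
Hypothesis A_monoid : one_monoid rho a0.
Implicit Types (T U W : finType).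

(** [splice] for labels indexed by [nat], which avoids conversions between ordinals of different
    sizes. *)
Definition splice_labels (a : nat -> A) (j s : nat) (v : A) (l : nat) : A :=
  if (l.+1 < j)%N then a l else if l.+1 == j then v else a (l + s.+1)%N.

(* The relations common to B(A) and E(A); the labels of the inputs 1, .. are
   [a 0], .., and those that the target does not use are ignored. *)
Record collapsing (Q : Type) (X : forall m, conf R 'I_m.+2 -> (nat -> A) -> Q) : Prop :=
  Collapsing {
  collapsing_ext : forall m e a a', (forall i, (i <= m)%N -> a i = a' i) ->
    X m e a = X m e a';
  collapsing_degen : forall m e (i : 'I_m.+1) (a : nat -> A), assoc R m.+3 e -> a i = a0 ->
    X m.+1 e a = X m (pull_raw (lift (middle i)) e) (a \o bump i);
  collapsing_inner : forall r s (j : 'I_r.+2) (o : 'I_s.+2) e (d : assoc R s.+2) a,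
    assoc R (r + s).+3 e -> collapsible j o e -> val d = pull_raw (in_face j) e ->
    (0 < j)%N ->
    X (r + s).+1 e a = X r (pull_raw (skip_face j o) e)
      (splice_labels a j s (structure_map rho d (fun t => a (j.-1 + t)%N)));
  collapsing_first : forall r s (o : 'I_s.+2) e a,
    assoc R (r + s).+3 e -> collapsible (ord0 : 'I_r.+2) o e ->
    X (r + s).+1 e a = X r (pull_raw (skip_face (ord0 : 'I_r.+2) o) e)
      (fun l => a (l + s.+1)%N) }.

Section Lists.
Variables (Q : Type) (X : forall m, conf R 'I_m.+2 -> (nat -> A) -> Q).
Hypothesis X_collapsing : collapsing X.
Variables (W : finType) (Z : conf R W).
Implicit Types (x y w : W) (l F : seq (W * A)) (b : A).

Definition full x l y : seq W := x :: unzip1 l ++ [:: y].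

Definition Lassoc x l y := assoc R (size l).+2 (pull_raw (place y (full x l y)) Z).

(* The element with inputs at the points [x], those of [l], and [y] of [Z],
   labelled by [l] and [b]. *)
Definition Lx x l y b : Q :=
  X (pull_raw (@place _ (size l).+2 y (full x l y)) Z) (nth b (unzip2 l)).

Lemma size_full x l y : size (full x l y) = (size l).+2.
Proof. by rewrite /= size_cat size_map addn1. Qed.

(** Frees [Lx] from [size l]: the sizes of concatenated lists match those in the relations only
    propositionally. *)
Lemma LxE x l y b m (p : 'I_m.+2 -> W) a : size l = m -> p =1 place y (full x l y) ->
  (forall i, (i <= m)%N -> a i = nth b (unzip2 l) i) ->
  Lx x l y b = X (pull_raw p Z) a.
Proof.
move=> lm; case: _ / lm p => p pE aE.
by rewrite (funext pE); apply: (collapsing_ext X_collapsing) => i /aE.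
Qed.

Lemma LassocE x l y m (p : 'I_m.+2 -> W) : size l = m -> p =1 place y (full x l y) ->
  Lassoc x l y -> assoc R m.+2 (pull_raw p Z).
Proof. by move=> lm; case: _ / lm p => p /funext ->. Qed.

Lemma Lx_degen x l1 w l2 y b : Lassoc x (l1 ++ (w, a0) :: l2) y ->
  Lx x (l1 ++ (w, a0) :: l2) y b = Lx x (l1 ++ l2) y b.
Proof.
move=> al; set m := size (l1 ++ l2).
have lm : size (l1 ++ (w, a0) :: l2) = m.+1 by rewrite /m !size_cat addnS.
have im : (size l1 < m.+1)%N by rewrite /m size_cat ltnS leq_addr.
rewrite (LxE lm (p := place y (full x (l1 ++ (w, a0) :: l2) y))
  (a := nth b (unzip2 (l1 ++ (w, a0) :: l2)))) //.
rewrite (collapsing_degen X_collapsing (i := Ordinal im)); first last.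
- by rewrite /unzip2 map_cat nth_cat size_map ltnn subnn.
- exact: LassocE al.
rewrite pull_raw_comp; apply/esym/LxE => // [i|i _].
  have bE : lift (middle (Ordinal im)) i = bump (size l1).+1 i :> nat.
    rewrite /middle /= /bump /= (_ : (m < _)%N = false) //.
    by apply/negbTE; rewrite -leqNgt; exact: im.
  rewrite /place /comp bE /full /unzip1 !map_cat -!catA -!cat_cons !nth_cat /= size_map /bump.
  case: (ltnP i (size l1).+1) => il; first by rewrite add0n il.
  rewrite ifF; last by lia.
  by rewrite (_ : (true + i - (size l1).+1)%N = (i - (size l1).+1).+1) //; lia.
rewrite /= /unzip2 !map_cat !nth_cat /= size_map /bump.
case: (ltnP i (size l1)) => il; first by rewrite add0n il.
rewrite ifF; last by lia.
by rewrite (_ : (true + i - size l1)%N = (i - size l1).+1) //; lia.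
Qed.

(** Relation (i) for the block [F], represented by its first twig [w]. The product [v] is specified
    for every [d] of a size equal to [size F], as that size is not literally of the form [s.+2]. *)
Lemma Lx_inner x l1 F l2 y b w v : Lassoc x (l1 ++ F ++ l2) y -> (1 < size F)%N ->
  w = head y (unzip1 F) ->
  clustered Z (full x (l1 ++ F ++ l2) y) (unzip1 F) w ->
  (forall n (d : assoc R n), n = size F ->
     val d = pull_raw (place y (unzip1 F)) Z ->
     v = structure_map rho d (fun i => nth b (unzip2 F) i)) ->
  Lx x (l1 ++ F ++ l2) y b = Lx x (l1 ++ (w, v) :: l2) y b.
Proof.
(* [r] and [s] are the sizes of the two factors minus 2. Input 0 is [x], so the block starts at
   input [(size l1).+1]. *)
move=> al F1 wE cl vE; set s := (size F).-2; set r := (size l1 + size l2).+1.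
have sF : size F = s.+2 by rewrite /s; case: (size F) F1 => [|[]].
have lr : size (l1 ++ F ++ l2) = (r + s).+1 by rewrite !size_cat sF /r; lia.
have jr : ((size l1).+1 < r.+2)%N by rewrite /r; lia.
set j := Ordinal jr.
have fE : full x (l1 ++ F ++ l2) y = (x :: unzip1 l1) ++ unzip1 F ++ (unzip1 l2 ++ [:: y]).
  by rewrite /full /unzip1 !map_cat -!catA.
have h1 : size (x :: unzip1 l1) = j by rewrite /= size_map.
have h2 : size (unzip1 F) = s.+2 by rewrite size_map.
have h3 : (size (x :: unzip1 l1) + size (unzip1 l2 ++ [:: y]) = r.+1)%N.
  by rewrite /= size_cat /= !size_map /r; lia.
have w0 : nth y (unzip1 F) (ord0 : 'I_s.+2) = w by rewrite nth0.
set e := pull_raw (@place _ (r + s).+3 y (full x (l1 ++ F ++ l2) y)) Z.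
have ae : assoc R (r + s).+3 e by exact: LassocE al.
have ue : uniq (full x (l1 ++ F ++ l2) y).
  by apply: assoc_uniq ae; rewrite size_full lr.
have ad : assoc R s.+2 (pull_raw (in_face j) e).
  by apply: assoc_pull ae; exact: in_face_homo.
pose d : assoc R s.+2 := exist (fun c => c \in assoc R s.+2) _ (mem_set ad).
rewrite (LxE lr (p := place y (full x (l1 ++ F ++ l2) y))
  (a := nth b (unzip2 (l1 ++ F ++ l2)))) //.
rewrite (collapsing_inner X_collapsing (j := j) (o := ord0) (d := d)) //; last first.
  by rewrite /e fE; rewrite fE in ue cl; apply: collapsible_place => //; rewrite w0.
rewrite pull_raw_comp; apply/esym/LxE => [|i|i ir].
- by rewrite size_cat /= /r; lia.
- rewrite fE (place_skip_face y ord0 h1 h2 h3) w0 /full /unzip1 map_cat /=.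
  by rewrite -catA.
rewrite (vE _ d) //; last first.
  by rewrite /= /e pull_raw_comp fE (funext (place_in_face y h1 h2 h3)).
rewrite /splice_labels /= /unzip2 !map_cat !nth_cat /= !size_map.
case: (ltngtP i (size l1)) => il.
- by rewrite ifT ?il //; lia.
- rewrite ifF; last by lia.
  rewrite ifF; last by lia.
  rewrite ifF; last by lia.
  rewrite ifF; last by rewrite sF; lia.
  rewrite (_ : (i - size l1)%N = (i - size l1).-1.+1) /=; last by lia.
  by congr nth; rewrite sF; lia.
- rewrite ifF ?il; last by lia.
  rewrite eqxx subnn /=; congr (structure_map _ _ _).
  apply/funext => t; rewrite !nth_cat !size_map ifF ?addKn; last by lia.
  by rewrite sF ltn_ord.
Qed.

(** The block consists of [F] and the last input, and is represented by the latter. Its label [b]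
    enters the product as the default of [nth] behind the labels of [F]. For B(A) this amounts to
    the second relation in (ii). *)
Lemma Lx_last x l F y b v : Lassoc x (l ++ F) y -> (0 < size F)%N ->
  clustered Z (full x (l ++ F) y) (unzip1 F ++ [:: y]) y ->
  (forall n (d : assoc R n), n = (size F).+1 ->
     val d = pull_raw (place y (unzip1 F ++ [:: y])) Z ->
     v = structure_map rho d (fun i => nth b (unzip2 F) i)) ->
  Lx x (l ++ F) y b = Lx x l y v.
Proof.
move=> al F1 cl vE; set s := (size F).-1; set r := size l.
have sF : size F = s.+1 by rewrite /s; case: (size F) F1.
have lr : size (l ++ F) = (r + s).+1 by rewrite !size_cat sF /r addnS.
set j : 'I_r.+2 := ord_max.
have fE : full x (l ++ F) y = (x :: unzip1 l) ++ (unzip1 F ++ [:: y]) ++ [::].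
  by rewrite /full /unzip1 !map_cat cats0 -!catA.
have h1 : size (x :: unzip1 l) = j by rewrite /= size_map.
have h2 : size (unzip1 F ++ [:: y]) = s.+2 by rewrite size_cat size_map sF addn1.
have h3 : (size (x :: unzip1 l) + size ([::] : seq W) = r.+1)%N.
  by rewrite /= size_map addn0.
have wy : nth y (unzip1 F ++ [:: y]) (ord_max : 'I_s.+2) = y.
  by rewrite nth_cat size_map sF ltnn subnn.
set e := pull_raw (@place _ (r + s).+3 y (full x (l ++ F) y)) Z.
have ae : assoc R (r + s).+3 e by exact: LassocE al.
have ue : uniq (full x (l ++ F) y).
  by apply: assoc_uniq ae; rewrite size_full lr.
have ad : assoc R s.+2 (pull_raw (in_face j) e).
  by apply: assoc_pull ae; exact: in_face_homo.
pose d : assoc R s.+2 := exist (fun c => c \in assoc R s.+2) _ (mem_set ad).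
rewrite (LxE lr (p := place y (full x (l ++ F) y)) (a := nth b (unzip2 (l ++ F)))) //.
rewrite (collapsing_inner X_collapsing (j := j) (o := ord_max) (d := d)) //; last first.
  by rewrite /e fE; rewrite fE in ue cl; apply: collapsible_place => //; rewrite wy.
rewrite pull_raw_comp; apply/esym/LxE => [//|i|i ir].
  by rewrite fE (place_skip_face y ord_max h1 h2 h3) wy.
rewrite (vE _ d) ?sF //; last first.
  by rewrite /= /e pull_raw_comp fE (funext (place_in_face y h1 h2 h3)).
rewrite /splice_labels /= /unzip2 map_cat !nth_cat !size_map eqSS.
have [il|il] := ltnP i (size l); first by rewrite ltnS il; apply: set_nth_default;
  rewrite size_map.
have -> : i = size l by apply/eqP; rewrite eqn_leq il andbT.
rewrite ltnS ltnn eqxx nth_default ?size_map //; congr (structure_map _ _ _).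
by apply/funext => t; rewrite nth_cat size_map ifF ?addKn //; lia.
Qed.

(** The first relation in (ii); for empty [F] there is nothing to do. *)
Lemma Lx_first x F l y b : Lassoc x (F ++ l) y ->
  clustered Z (full x (F ++ l) y) (x :: unzip1 F) x ->
  Lx x (F ++ l) y b = Lx x l y b.
Proof.
case: F => [//|f F] al cl; set s := size F; set r := size l.
have lr : size ((f :: F) ++ l) = (r + s).+1 by rewrite size_cat /= /r /s; lia.
have fE : full x ((f :: F) ++ l) y = [::] ++ (x :: unzip1 (f :: F)) ++ (unzip1 l ++ [:: y]).
  by rewrite /full /unzip1 !map_cat /= -!catA.
have h1 : size ([::] : seq W) = (ord0 : 'I_r.+2) by [].
have h2 : size (x :: unzip1 (f :: F)) = s.+2 by rewrite /= size_map.
have h3 : (size ([::] : seq W) + size (unzip1 l ++ [:: y]) = r.+1)%N.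
  by rewrite /= size_cat /= !size_map /r; lia.
set e := pull_raw (@place _ (r + s).+3 y (full x ((f :: F) ++ l) y)) Z.
have ae : assoc R (r + s).+3 e by exact: LassocE al.
have ue : uniq (full x ((f :: F) ++ l) y).
  by apply: assoc_uniq ae; rewrite size_full lr.
rewrite (LxE lr (p := place y (full x ((f :: F) ++ l) y))
  (a := nth b (unzip2 ((f :: F) ++ l)))) //.
rewrite (collapsing_first X_collapsing (o := ord0)) //; last first.
  by rewrite /e fE; rewrite fE in ue cl; apply: collapsible_place.
rewrite pull_raw_comp; apply/esym/LxE => // [i|i ir].
  by rewrite fE (place_skip_face y ord0 h1 h2 h3).
rewrite /= /unzip2 map_cat -cat_cons nth_cat /= size_map ifF; last by rewrite -/s; lia.
by congr nth; rewrite -/s; lia.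
Qed.

End Lists.
End Collapsing.

(** * Classes in B(A) and E(A) *)

Section Stasheff.
Variables (R : realType) (A : topologicalType).
Variables (rho : forall k, FM1 R k -> ('I_k -> A) -> A) (a0 : A).

(** The empty configuration in [0, 1] is a scaled one, and its preimage has only the two end
    inputs. *)
Lemma assoc2_inhabited : exists e : assoc R 2, True.
Proof. by have [_ [e _]] := rescale_surj (fm_empty `[0 : R, 1]); exists e. Qed.

Definition corolla : assoc R 2 := sval (cid assoc2_inhabited).

(* Total versions of the classes of elements, with junk value the class of the
   corolla outside the associahedra. *)
Definition B_class m (e : conf R 'I_m.+2) (a : nat -> A) : stasheff_B rho a0 :=
  match pselect (assoc R m.+2 e) with
  | left pf => cls _ (preB_elt (exist (fun c => c \in assoc R m.+2) e (mem_set pf))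
      (fun i : 'I_m => a i))
  | right _ => cls _ (preB_elt corolla (fun=> a0))
  end.

Definition E_class m (e : conf R 'I_m.+2) (a : nat -> A) : stasheff_E rho a0 :=
  match pselect (assoc R m.+2 e) with
  | left pf => cls _ (preE_elt (exist (fun c => c \in assoc R m.+2) e (mem_set pf))
      (fun i : 'I_m.+1 => a i))
  | right _ => cls _ (preE_elt corolla (fun=> a0))
  end.

Lemma B_classE m (c : assoc R m.+2) e (a : nat -> A) (a' : 'I_m -> A) :
  e = val c -> (forall i : 'I_m, a i = a' i) ->
  B_class e a = cls (B_step rho a0) (preB_elt c a').
Proof.
move=> ec aa'; rewrite /B_class; case: pselect => [pf|[]]; last first.
  by rewrite ec; exact: set_valP.
by congr (cls _ (preB_elt _ _)); [exact: val_inj|exact/funext].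
Qed.

Lemma E_classE m (c : assoc R m.+2) e (a : nat -> A) (a' : 'I_m.+1 -> A) :
  e = val c -> (forall i : 'I_m.+1, a i = a' i) ->
  E_class e a = cls (E_step rho a0) (preE_elt c a').
Proof.
move=> ec aa'; rewrite /E_class; case: pselect => [pf|[]]; last first.
  by rewrite ec; exact: set_valP.
by congr (cls _ (preE_elt _ _)); [exact: val_inj|exact/funext].
Qed.

Lemma B_class_ext m (e : conf R 'I_m.+2) (a a' : nat -> A) :
  (forall i, (i < m)%N -> a i = a' i) -> B_class e a = B_class e a'.
Proof.
move=> aa'; rewrite /B_class; case: pselect => // pf.
by congr (cls _ (preB_elt _ _)); apply/funext => i; exact: aa'.
Qed.

Definition to_assoc m (e : conf R 'I_m) (pf : assoc R m e) : assoc R m :=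
  exist (fun c => c \in assoc R m) e (mem_set pf).

Section Face.
Variables (r s : nat) (j : 'I_r.+2) (o : 'I_s.+2) (e : conf R 'I_(r + s).+3).
Hypotheses (ae : assoc R _ e) (ce : collapsible j o e).

Lemma assoc_skip_face : assoc R r.+2 (pull_raw (skip_face j o) e).
Proof. by apply: assoc_pull ae; exact: skip_face_homo. Qed.

Lemma assoc_in_face : assoc R s.+2 (pull_raw (in_face j) e).
Proof. by apply: assoc_pull ae; exact: in_face_homo. Qed.

Lemma assoc_compE (d : assoc R s.+2) : val d = pull_raw (in_face j) e ->
  val (assoc_comp j (to_assoc assoc_skip_face) d) = e.
Proof. by move=> dE; apply: (assoc_comp_faces ae ce). Qed.

End Face.

Lemma splice_labelsE r s n (j : nat) (a : nat -> A) v (l : 'I_n) :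
  (n <= r.+1)%N -> (j <= r.+1)%N ->
  splice (fun i : 'I_(r + s).+1.+1 => a i) j s v l = splice_labels a j s v l.
Proof.
move=> nr jr; have ln := ltn_ord l; rewrite /splice /splice_labels.
by case: ifP => lj; [|case: ifP => // lj']; rewrite inordK //; lia.
Qed.

Lemma E_collapsing : collapsing rho a0 E_class.
Proof.
split.
- move=> m e a a' aa'; rewrite /E_class; case: pselect => // pf.
  congr (cls _ (preE_elt _ _)); apply/funext => i; apply: aa'.
  by rewrite -ltnS.
- move=> m e i a ae ai.
  rewrite (@E_classE _ (to_assoc ae) _ _ (fun i => a i)) //.
  rewrite (@E_classE _ (assoc_degen (middle i) (to_assoc ae)) _ _
    ((fun i : 'I_m.+2 => a i) \o lift (lift ord_max i))) //.
    apply: cls_step; apply: E_degen; rewrite -ai /=; congr a.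
    by rewrite /bump leqNgt ltn_ord.
  move=> l /=; congr a.
  by rewrite [in RHS]/bump /= [in (m.+1 <= _)%N]leqNgt ltn_ord.
- move=> r s j o e d a ae ce dE j0.
  rewrite (@E_classE _ (assoc_comp j (to_assoc (assoc_skip_face j o ae)) d) _ _ (fun i =>
    a i)) //; last first.
    by rewrite assoc_compE.
  rewrite (@E_classE _ (to_assoc (assoc_skip_face j o ae)) _ _
    (splice (fun i : 'I_(r + s).+2 => a i) j s (structure_map rho d
       (fun t => (fun i : 'I_(r + s).+2 => a i) (inord (j.-1 + t)))))) //.
    by apply: cls_step; exact: E_inner.
  move=> l; rewrite splice_labelsE //; last by have := ltn_ord j.
  congr splice_labels; congr (structure_map _ _ _); apply/funext => t.
  by rewrite inordK //; have := ltn_ord t; have := ltn_ord j; lia.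
- move=> r s o e a ae ce.
  have dE : val (to_assoc (assoc_in_face (ord0 : 'I_r.+2) ae)) = pull_raw (in_face (ord0
    : 'I_r.+2)) e by [].
  rewrite (@E_classE _ (assoc_comp ord0 (to_assoc (assoc_skip_face ord0 o ae)) (to_assoc
    (assoc_in_face ord0 ae))) _ _ (fun i => a i)) //; last first.
    by rewrite assoc_compE.
  rewrite (@E_classE _ (to_assoc (assoc_skip_face ord0 o ae)) _ _
    (fun l => (fun i : 'I_(r + s).+2 => a i) (inord (l + s.+1)))) //.
    by apply: cls_step; exact: E_first.
  by move=> l; rewrite inordK //; have := ltn_ord l; lia.
Qed.

Lemma B_collapsing : collapsing rho a0 B_class.
Proof.
split.
- by move=> m e a a' aa'; apply: B_class_ext => i im; apply: aa'; exact: ltnW.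
- move=> m e i a ae ai.
  rewrite (@B_classE _ (to_assoc ae) _ _ (fun i => a i)) //.
  rewrite (@B_classE _ (assoc_degen (middle i) (to_assoc ae)) _ _
    ((fun i : 'I_m.+1 => a i) \o lift i)) //.
  by apply: cls_step; exact: B_degen.
- move=> r s j o e d a ae ce dE j0.
  rewrite (@B_classE _ (assoc_comp j (to_assoc (assoc_skip_face j o ae)) d) _ _ (fun i =>
    a i)) //; last first.
    by rewrite assoc_compE.
  (* For B(A) the face at the last input falls under (ii) and not under (i). *)
  have [jr|jr] := ltnP j r.+1; last first.
    have jM : j = ord_max by apply/val_inj/eqP; rewrite eqn_leq jr -ltnS ltn_ord.
    rewrite (@B_classE _ (to_assoc (assoc_skip_face j o ae)) _ _
      (fun l => (fun i : 'I_(r + s).+1 => a i) (inord l))) //.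
      by rewrite jM; apply: cls_step; exact: B_last.
    move=> l; have lr := ltn_ord l; rewrite /splice_labels ifT; last by lia.
    by rewrite inordK //; lia.
  rewrite (@B_classE _ (to_assoc (assoc_skip_face j o ae)) _ _
    (splice (fun i : 'I_(r + s).+1 => a i) j s (structure_map rho d
       (fun t => (fun i : 'I_(r + s).+1 => a i) (inord (j.-1 + t)))))) //.
    by apply: cls_step; apply: B_inner; rewrite j0.
  move=> l; have lr := ltn_ord l; rewrite /splice /splice_labels.
  case: ifP => lj; first by rewrite inordK //; lia.
  case: ifP => lj'; last by rewrite inordK //; lia.
  congr (structure_map _ _ _); apply/funext => t.
  by rewrite inordK //; have := ltn_ord t; lia.
- move=> r s o e a ae ce.
  have dE : val (to_assoc (assoc_in_face (ord0 : 'I_r.+2) ae)) = pull_raw (in_face (ord0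
    : 'I_r.+2)) e by [].
  rewrite (@B_classE _ (assoc_comp ord0 (to_assoc (assoc_skip_face ord0 o ae)) (to_assoc
    (assoc_in_face ord0 ae))) _ _ (fun i => a i)) //; last first.
    by rewrite assoc_compE.
  rewrite (@B_classE _ (to_assoc (assoc_skip_face ord0 o ae)) _ _
    (fun l => (fun i : 'I_(r + s).+1 => a i) (inord (l + s.+1)))) //.
    by apply: cls_step; exact: B_first.
  by move=> l; rewrite inordK //; have := ltn_ord l; lia.
Qed.

End Stasheff.

(** * The element of a labelled configuration *)

Section Configurations.
Variables (R : realType) (A : topologicalType).
Variables (rho : forall k, FM1 R k -> ('I_k -> A) -> A) (a0 : A).
Hypothesis A_monoid : one_monoid rho a0.
Implicit Types (T U W : finType).

Definition points T (c : conf R T) (P : pred T) : seq T :=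
  sort (fun i j => (i == j) || before c i j) (enum P).

Lemma before_total_le T (c : conf R T) : limit_config c ->
  total (fun i j => (i == j) || before c i j).
Proof.
move=> lc i j; rewrite (eq_sym j i); have [//|ij] := eqVneq i j.
exact: before_total.
Qed.

Lemma points_sorted T (c : conf R T) P : limit_config c -> sorted (before c) (points c P).
Proof.
move=> lc; set leT := fun i j => (i == j) || before c i j.
have le_trans : transitive leT.
  move=> j i k /orP[/eqP -> //|ij] /orP[/eqP <-|jk]; first by rewrite /leT ij orbT.
  by rewrite /leT (before_trans lc ij jk) orbT.
have := sort_sorted (before_total_le lc) (enum P).
rewrite -/(points c P) sorted_pairwise // sorted_pairwise; last exact: before_trans.
have : uniq (points c P) by rewrite sort_uniq enum_uniq.
rewrite uniq_pairwise => u1 u2; have := conj u2 u1 => /andP.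
rewrite -pairwise_relI; apply: sub_pairwise => i j /=.
by rewrite /leT => /andP[/orP[/eqP ->|//]]; rewrite eqxx.
Qed.

Lemma mem_points T (c : conf R T) P t : (t \in points c P) = P t.
Proof. by rewrite mem_sort mem_enum. Qed.

Lemma points_uniq T (c : conf R T) P : uniq (points c P).
Proof. by rewrite sort_uniq enum_uniq. Qed.

Lemma points_eq T (c : conf R T) P (s : seq T) : limit_config c ->
  sorted (before c) s -> s =i P -> points c P = s.
Proof.
move=> lc so sP; apply: (irr_sorted_eq (leT := before c)) => //.
- exact: before_trans.
- exact: before_irr.
- exact: points_sorted.
- by move=> t; rewrite mem_points sP.
Qed.

Definition labelled T (a : T -> A) (s : seq T) : seq (T * A) := [seq (t, a t) | t <- s].

Lemma unzip1_labelled T (a : T -> A) s : unzip1 (labelled a s) = s.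
Proof. by rewrite /unzip1 -map_comp map_id_in. Qed.

Definition map_pos U W (f : U -> W) (l : seq (U * A)) : seq (W * A) :=
  [seq (f w.1, w.2) | w <- l].

Lemma unzip1_map_pos U W (f : U -> W) l : unzip1 (map_pos f l) = map f (unzip1 l).
Proof. by rewrite /unzip1 /map_pos -!map_comp. Qed.

Lemma unzip2_map_pos U W (f : U -> W) l : unzip2 (map_pos f l) = unzip2 l.
Proof. by rewrite /unzip2 /map_pos -!map_comp. Qed.

Lemma map_place W (l : seq (W * A)) y b n : n = size l ->
  [seq (place y (unzip1 l) i, nth b (unzip2 l) i) | i <- enum 'I_n] = l.
Proof.
move=> nl; apply: (@eq_from_nth _ (y, b)) => [|i]; first by rewrite size_map size_enum_ord.
rewrite size_map size_enum_ord => ik.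
rewrite (nth_map (Ordinal ik)) ?size_enum_ord // /place nth_enum_ord //.
by rewrite (nth_map (y, b)) -?nl // (nth_map (y, b)) -?nl // -surjective_pairing.
Qed.

Lemma mul_structure_map W (Z : conf R W) (y : W) l b n (d : assoc R n) : n = size l ->
  val d = pull_raw (place y (unzip1 l)) Z ->
  mul rho a0 Z l = structure_map rho d (fun i => nth b (unzip2 l) i).
Proof.
move=> nl dE.
rewrite (@mulE _ _ _ _ A_monoid _ _ _ n (place y (unzip1 l)) (fun i => nth b (unzip2 l) i)
  (assoc_FM1 d)) //.
  have [[_ d0] _] := set_valP d.
  rewrite /= dE; congr pair; apply/funext => i.
  by have := d0 i; rewrite -/(val d) dE.
by rewrite map_place.
Qed.

Lemma mul_ext T (c : conf R T) (l : seq (T * A)) y b n (d : assoc R n) :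
  limit_config c -> n = size l ->
  val d = pull_raw (place y (unzip1 (map_pos inr l))) (ext c) ->
  mul rho a0 c l = structure_map rho d (fun i => nth b (unzip2 l) i).
Proof.
move=> lc nl dE; case: l => [|w l] in nl dE *.
  subst n; rewrite mul_nil // /structure_map; apply/esym.
  rewrite -(monoid_base A_monoid (assoc_FM1 d) (fun=> a0)); congr (rho _).
  by apply/funext => -[].
rewrite (@mulE _ _ _ _ A_monoid _ _ _ n (place w.1 (unzip1 (w :: l)))
  (fun i => nth b (unzip2 (w :: l)) i) (assoc_FM1 d)) //.
  rewrite [LHS]/= dE -pull_inr_ext // pull_raw_comp; congr pull_raw; apply/funext => i.
  by rewrite /place unzip1_map_pos [RHS]/= (nth_map w.1) // size_map -nl ltn_ord.
rewrite (_ : [seq _ | i <- _] = w :: l) //.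
exact: map_place.
Qed.

Lemma pairwise_points T (c : conf R T) P : limit_config c ->
  pairwise (before c) (points c P).
Proof. by move=> lc; rewrite -sorted_pairwise ?points_sorted //; exact: before_trans. Qed.

Lemma Lassoc_ext T (c : conf R T) (l : seq (T * A)) : limit_config c ->
  pairwise (before c) (unzip1 l) -> all (interior c) (unzip1 l) ->
  Lassoc (ext c) (inl false) (map_pos inr l) (inl true).
Proof.
move=> lc pl il; rewrite /Lassoc.
set f := full _ _ _; have sf : size f = (size (map_pos (@inr bool T) l)).+2 by exact:
  size_full.
have pf : pairwise (before (ext c)) f.
  rewrite /f /full unzip1_map_pos /= all_cat pairwise_cat /= !andbT.
  apply/andP; split; [apply/andP; split|apply/andP; split].
  - rewrite all_map; apply: sub_all il => t /andP[t0 _].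
    exact: before_ext_location.
  - by apply: before_ext_location; rewrite //= ltr01.
  - apply/allrelP => w w' /mapP[t tl ->]; rewrite inE => /eqP ->.
    by apply: before_ext_location => //=; have /andP[] := allP il t tl.
  - rewrite pairwise_map; apply: sub_pairwise pl => t t' tt'.
    by rewrite /= before_ext_inr.
apply: assoc_ext => // [i j ij|i].
  by move/(pairwiseP (inl true)): pf; apply; rewrite ?inE ?sf.
have : place (inl true) f i \in f by rewrite /place mem_nth // sf.
rewrite /f inE mem_cat inE unzip1_map_pos => /orP[/eqP ->//|/orP[/mapP[t tl ->]|/eqP ->//]].
exact: (allP il).
Qed.

Lemma collapse_inr T (F : seq T) u0 u :
  collapse (map inr F) (inr u0) (inr u : bool + T) = inr (collapse F u0 u).
Proof.
rewrite /collapse mem_map; last by move=> a b [].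
by case: ifP.
Qed.

Lemma collapse_inl T (F : seq T) u0 b :
  collapse (map inr F) (inr u0) (inl b : bool + T) = inl b.
Proof. by rewrite /collapse; case: ifP => // /mapP[]. Qed.

(** Moving a twig of [F] to [u0] does not change its tree. Screens of sets with an end point depend
    on the locations only, and screens of sets that meet several trees are read off from [c], so
    both stay the same; a set disjoint from [F] does not move. *)
Lemma ext_clustered U T (h : U -> T) (C : conf R U) (c : conf R T) (t : T)
    (F : seq U) u0 (s : seq U) :
  grafted h C c -> u0 \in F -> (forall u, u \in F -> h u = t) ->
  (forall u, u \in s -> u \notin F -> h u != t) ->
  clustered (ext C) (inl false :: map inr s ++ [:: inl true]) (map inr F) (inr u0).
Proof.
move=> [h1 h2] u0F Ft sF S w Ss wS S1.
set k := collapse _ _.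
have [/existsP[u1 /andP[u1F u1S]]|/existsPn nS] := boolP [exists u, (u \in F) && (inr u
  \in S)]; last first.
  have kid v : v \in S -> k v = v.
    rewrite /k; case: v => [b|u] vS; first exact: collapse_inl.
    rewrite collapse_inr /collapse; case: ifP => // uF.
    by have := nS u; rewrite uF vS.
  have kS : k @: S = S.
    by rewrite -[RHS]imset_id; apply: eq_in_imset => v vS; rewrite kid.
  by rewrite kS kid.
have kl b : (inl b \in k @: S) = (inl b \in S).
  apply/imsetP/idP => [[[b'|u] vS]|bS]; rewrite /k ?collapse_inl ?collapse_inr //.
    by move=> [->].
  by exists (inl b) => //; rewrite collapse_inl.
have kh u : h (collapse F u0 u) = h u.
  by rewrite /collapse; case: ifP => // uF; rewrite !Ft.
have kwS : k w \in k @: S by exact: imset_f.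
have [eS|eS] := boolP ((inl false \in S) || (inl true \in S)).
  rewrite !ext_screen ?kl // -direction_imset //.
  congr direction; apply/funext => -[b|u] /=; rewrite /k ?collapse_inl ?collapse_inr //=.
  by rewrite !h1 kh.
case: w wS kwS => [b|u] uS; first by case: b uS eS => ->; rewrite ?orbT.
rewrite /k collapse_inr -/k => kuS; rewrite !ext_screen_inr ?kl //.
set S' := [set u | inr u \in S]%SET; set S'' := [set u | inr u \in k @: S]%SET.
have hS : h @: S'' = h @: S'.
  apply/setP => v; apply/imsetP/imsetP => -[a]; rewrite inE.
    move=> /imsetP[[b|a'] a'S]; rewrite /k ?collapse_inl ?collapse_inr // => -[->] ->.
    by exists a'; rewrite ?inE ?kh.
  move=> aS ->; exists (collapse F u0 a); rewrite ?inE ?kh //.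
  by apply/imsetP; exists (inr a); rewrite /k ?collapse_inr.
have hS1 : (1 < #|h @: S'|)%N.
  (* Inside [F], the set [S] would collapse to the single point [u0]. *)
  have [u2 u2S u2F] : exists2 u2, inr u2 \in S & u2 \notin F.
    apply: contrapT => nu2; move: S1; rewrite ltnNge => /negP; apply.
    rewrite -(cards1 (inr u0 : bool + U)); apply: subset_leq_card.
    apply/fintype.subsetP => _ /imsetP[[b|v] vS ->].
      by case: b vS eS => ->; rewrite ?orbT.
    rewrite collapse_inr inE /collapse; case: ifP => // vF.
    by case: nu2; exists v; rewrite ?vF.
  apply/card_gt1P; exists (h u1), (h u2); split.
  - by apply: imset_f; rewrite inE.
  - by apply: imset_f; rewrite inE.
  rewrite (Ft _ u1F) eq_sym; apply: sF => //.
  have := Ss _ u2S; rewrite inE mem_cat inE /= => /orP[/mapP[v vs [->]] //|//].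
by rewrite !h2 ?hS ?kh // inE.
Qed.

Section Value.
Variables (Q : Type) (X : forall m, conf R 'I_m.+2 -> (nat -> A) -> Q).
Hypothesis X_collapsing : collapsing rho a0 X.

Definition Lext T (c : conf R T) (l : seq (T * A)) b : Q :=
  Lx X (ext c) (inl false) (map_pos inr l) (inl true) b.

Definition chain T (c : conf R T) (l : seq (T * A)) : Prop :=
  pairwise (before c) (unzip1 l) /\ all (interior c) (unzip1 l).

Lemma map_pos_cat U W (f : U -> W) (l l' : seq (U * A)) :
  map_pos f (l ++ l') = map_pos f l ++ map_pos f l'.
Proof. exact: map_cat. Qed.

Lemma Lext_degen T (c : conf R T) l1 t l2 b : limit_config c ->
  chain c (l1 ++ (t, a0) :: l2) -> Lext c (l1 ++ (t, a0) :: l2) b = Lext c (l1 ++ l2) b.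
Proof.
move=> lc [pl il]; have := Lassoc_ext lc pl il.
rewrite /Lext !map_pos_cat => al; exact: (Lx_degen X_collapsing).
Qed.

(** A run of twigs of one tree is a cluster because no other twig of the list lies in that tree. *)
Lemma Lext_cluster U T (h : U -> T) (C : conf R U) (c : conf R T) (t : T)
    (l1 F l2 : seq (U * A)) w b :
  limit_config C -> grafted h C c -> chain C (l1 ++ (w :: F) ++ l2) ->
  (forall u, u \in unzip1 (w :: F) -> h u = t) ->
  (forall u, u \in unzip1 (l1 ++ l2) -> h u != t) ->
  Lext C (l1 ++ (w :: F) ++ l2) b =
  Lext C (l1 ++ (w.1, mul rho a0 C (w :: F)) :: l2) b.
Proof.
move=> lC hCc [pl il] Ft lt; case: F => [|w' F] in pl il Ft *.
  by rewrite mul_seq1 // -surjective_pairing.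
have := Lassoc_ext lC pl il; rewrite /Lext !map_pos_cat => al.
apply: (Lx_inner X_collapsing (w := inr w.1)) al _ _ _ _ => //.
  rewrite /full -!map_pos_cat !unzip1_map_pos.
  apply: (ext_clustered (t := t) hCc) => // [|u ul].
    by rewrite inE eqxx.
  move=> uF; apply: lt; move: ul uF; rewrite /unzip1 !map_cat !mem_cat.
  by case/orP => [->//|/orP[->//|->]]; rewrite orbT.
move=> n d nF dE; have nF' : n = size (w :: w' :: F) by rewrite nF size_map.
by rewrite (mul_ext b lC nF' dE) unzip2_map_pos.
Qed.

Lemma chain_subseq T (c : conf R T) (l l' : seq (T * A)) :
  subseq (unzip1 l) (unzip1 l') -> chain c l' -> chain c l.
Proof.
move=> ll' [pl il]; split; first exact: subseq_pairwise ll' pl.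
by apply/allP => t tl; apply: (allP il); exact: (mem_subseq ll').
Qed.

(** A tree is represented by its first twig. An empty tree contributes nothing, as no twig in [U]
    could carry its unit. *)
Definition merged U (C : conf R U) (F : seq (U * A)) : seq (U * A) :=
  if F is w :: _ then [:: (w.1, mul rho a0 C F)] else [::].

(** The trees are merged one after the other; [pre] holds those already done. *)
Lemma Lext_flatten U T (h : U -> T) (C : conf R U) (c : conf R T) (s : seq T)
    (F : T -> seq (U * A)) (pre : seq (U * A)) b :
  limit_config C -> grafted h C c -> uniq s ->
  (forall t u, u \in unzip1 (F t) -> h u = t) ->
  (forall u, u \in unzip1 pre -> h u \notin s) ->
  chain C (pre ++ flatten [seq F t | t <- s]) ->
  Lext C (pre ++ flatten [seq F t | t <- s]) b =
  Lext C (pre ++ flatten [seq merged C (F t) | t <- s]) b.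
Proof.
move=> lC hCc us Ft; elim: s us pre => [//|t s IH] /= /andP[ts us] pre pres ch.
case FE : (F t) => [|w G]; rewrite FE /= in ch *.
  by apply: IH => // u /pres; rewrite inE negb_or => /andP[].
have FEt u : u \in unzip1 (w :: G) -> h u = t by rewrite -FE; exact: Ft.
have flat u : u \in unzip1 (flatten [seq F t | t <- s]) -> h u \in s.
  by move=> /mapP[v /flatten_mapP[t' t's vF] ->]; rewrite (Ft t') // map_f.
rewrite (Lext_cluster b lC hCc ch FEt); last first.
  move=> u; rewrite /unzip1 map_cat mem_cat => /orP[/pres|/flat us'].
    by rewrite inE negb_or => /andP[].
  by apply: contraNneq ts => <-.
rewrite -cat1s catA IH //.
- by rewrite -catA.
- move=> u; rewrite /unzip1 map_cat mem_cat inE => /orP[/pres|/eqP ->].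
    by rewrite inE negb_or => /andP[].
  by rewrite FEt // inE eqxx.
apply: chain_subseq ch; rewrite -catA /unzip1 !map_cat /=.
apply: cat_subseq => //=; rewrite eqxx map_cat; exact: suffix_subseq.
Qed.

(** The list has at most one twig from each tree, so [pull_ext_grafted] applies. *)
Lemma Lext_grafted U T (h : U -> T) (C : conf R U) (c : conf R T) (l : seq (U * A)) b :
  limit_config C -> limit_config c -> grafted h C c -> chain c (map_pos h l) ->
  Lext C l b = Lext c (map_pos h l) b.
Proof.
move=> lC lc hCc [pl _].
have ul : uniq (map h (unzip1 l)).
  by rewrite -unzip1_map_pos; apply: pairwise_uniq pl; exact: before_irr.
have fE : full (inl false) (map_pos inr (map_pos h l)) (inl true) =
    map (ext_map h) (full (inl false) (map_pos inr l) (inl true)).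
  by rewrite /full !unzip1_map_pos /= map_cat -!map_comp.
have sl : size (map_pos (@inr bool T) (map_pos h l)) = size (map_pos (@inr bool U) l).
  by rewrite /map_pos !size_map.
rewrite /Lext [RHS](LxE X_collapsing (ext c) sl (p := ext_map h \o place (inl true)
  (full (inl false) (map_pos inr l) (inl true)))
  (a := nth b (unzip2 (map_pos (@inr bool U) l)))).
- rewrite -(pull_ext_grafted lC lc hCc) //.
  have uf : uniq (map (ext_map h) (full (inl false) (map_pos inr l) (inl true))).
    rewrite -fE /full !unzip1_map_pos /= mem_cat inE orbF cat_uniq /= !andbT.
    rewrite map_inj_uniq ?ul; last by move=> a b' [].
    by rewrite orbF; apply/andP; split; apply/negP => /mapP[].
  move=> i j; rewrite /comp /place -!(nth_map _ (inl true)) ?size_full // => /eqP.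
  have sf : size (map (ext_map h) (full (inl false) (map_pos inr l) (inl true))) =
      (size (map_pos (@inr bool U) l)).+2 by rewrite size_map size_full.
  by rewrite nth_uniq ?sf // => /eqP /val_inj.
- by move=> i; rewrite /place fE (nth_map (inl true)) ?size_full.
- by move=> i _; rewrite !unzip2_map_pos.
Qed.

Lemma Lext_drop T (c : conf R T) (s : seq T) (keep : pred T) (v : T -> A) pre b :
  limit_config c -> (forall t, ~~ keep t -> v t = a0) ->
  chain c (pre ++ labelled v s) ->
  Lext c (pre ++ labelled v s) b = Lext c (pre ++ labelled v [seq t <- s | keep t]) b.
Proof.
move=> lc va; elim: s pre => [//|t s IH] /= pre ch.
case: ifP => kt; first by rewrite /= -cat1s catA IH -?catA.
rewrite -IH; first by rewrite va ?kt // Lext_degen // -(va t) ?kt.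
apply: chain_subseq ch; rewrite /unzip1 !map_cat.
by apply: cat_subseq => //=; exact: subseq_cons.
Qed.

Definition at_end T (c : conf R T) t := c.1 t == 1.

Definition value T (c : conf R T) (a : T -> A) : Q :=
  Lext c (labelled a (points c (interior c))) (mul rho a0 c (labelled a (points c (at_end
    c)))).

(** The labels induced on [c] when [C] is grafted on it; a twig of [c] that carries no tree gets the
    unit. *)
Definition merge_labels U T (h : U -> T) (C : conf R U) (a : U -> A) (t : T) : A :=
  mul rho a0 C (labelled a (points C (fun u => h u == t))).

Lemma grafted_before U T (h : U -> T) (C : conf R U) (c : conf R T) u v :
  grafted h C c -> h u != h v -> before C u v = before c (h u) (h v).
Proof.
move=> [_ h2] uv; rewrite /before.
have E : h @: [set u; v]%SET = [set h u; h v]%SET by rewrite imsetU1 imset_set1.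
by rewrite !h2 ?E ?inE ?eqxx ?orbT // cards2 uv.
Qed.

Lemma points_flatten U T (h : U -> T) (C : conf R U) (c : conf R T) (P : pred T) :
  limit_config C -> limit_config c -> grafted h C c ->
  points C (fun u => P (h u)) = flatten [seq points C (fun u => h u == t) | t <- points c P].
Proof.
move=> lC lc hCc; apply: points_eq => //; last first.
  move=> u; apply/flatten_mapP/idP => [[t]|Pu].
    by rewrite !mem_points => /[swap] /eqP <-.
  by exists (h u); rewrite mem_points ?eqxx.
rewrite sorted_pairwise; last exact: before_trans.
elim: (points c P) (pairwise_points P lc) => //= t s IH /andP[ts /IH ps].
rewrite pairwise_cat pairwise_points // ps !andbT.
apply/allrelP => u v; rewrite mem_points => /eqP ut /flatten_mapP[t' t's].
rewrite mem_points => /eqP vt'; have tt' := allP ts _ t's.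
rewrite (grafted_before hCc) ut vt' //.
by apply: contraTneq tt' => ->; rewrite before_irr.
Qed.

Lemma labelled_flatten U T (a : U -> A) (F : T -> seq U) (s : seq T) :
  labelled a (flatten [seq F t | t <- s]) = flatten [seq labelled a (F t) | t <- s].
Proof. by elim: s => //= t s IH; rewrite /labelled map_cat -IH. Qed.

(** The trees over 1 are multiplied by associativity; those over the interior are merged, and their
    representatives are transported to [c]. Twigs of [c] with an empty tree have label [a0] and are
    dropped by (iii). *)
Lemma value_grafted U T (h : U -> T) (C : conf R U) (c : conf R T) (a : U -> A) :
  limit_config C -> limit_config c -> grafted h C c ->
  value C a = value c (merge_labels h C a).
Proof.
move=> lC lc hCc; have [h1 _] := hCc.
have uF t : uniq (unzip1 (labelled a (points C (fun u => h u == t)))).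
  by rewrite unzip1_labelled points_uniq.
have hF t u : u \in unzip1 (labelled a (points C (fun u => h u == t))) -> h u = t.
  by rewrite unzip1_labelled mem_points => /eqP.
rewrite /value.
have iE : points C (interior C) = flatten [seq points C (fun u =>
  h u == t) | t <- points c (interior c)].
  rewrite -points_flatten //; congr points; apply/funext => u.
  by rewrite /interior h1.
have eE : points C (at_end C) = flatten [seq points C (fun u =>
  h u == t) | t <- points c (at_end c)].
  rewrite -points_flatten //; congr points; apply/funext => u.
  by rewrite /at_end h1.
have chC : chain C (labelled a (points C (interior C))).
  split; rewrite unzip1_labelled; first exact: pairwise_points.
  by apply/allP => u; rewrite mem_points.
have chc v : chain c (labelled v (points c (interior c))).
  split; rewrite unzip1_labelled; first exact: pairwise_points.
  by apply/allP => u; rewrite mem_points.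
rewrite {1}eE [labelled a (flatten _)]labelled_flatten.
rewrite (@mul_grafted _ _ _ _ A_monoid _ _ h C c) ?points_uniq //.
set b := mul _ _ _ _.
move: chC; rewrite iE labelled_flatten => chC.
rewrite -[flatten _]cat0s (Lext_flatten (pre := [::]) b lC hCc) ?points_uniq //.
pose keep t := points C (fun u => h u == t) != [::].
have mE : map_pos h (flatten [seq merged C (labelled a (points C (fun u => h u == t)))
    | t <- points c (interior c)]) =
    labelled (merge_labels h C a) [seq t <- points c (interior c) | keep t].
  elim: (points c (interior c)) => //= t s IH; rewrite map_pos_cat IH /keep.
  have := hF t; rewrite /merge_labels; case E : (points C (fun u => h u == t)) => [|u l] //=.
  by move=> /(_ u (mem_head _ _)) ->; rewrite E.
rewrite cat0s (Lext_grafted b lC lc hCc) mE.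
  rewrite -[RHS]/(Lext c ([::] ++ _) _) (@Lext_drop _ _ _ keep) //.
    by move=> t; rewrite /keep /merge_labels negbK => /eqP ->; exact: mul_nil.
  exact: chc.
apply: chain_subseq (chc (merge_labels h C a)).
by rewrite !unzip1_labelled; exact: filter_subseq.
Qed.

End Value.
End Configurations.

(** * The value of a scaled configuration *)

Section Scaled.
Variables (R : realType) (A : topologicalType).
Variables (rho : forall k, FM1 R k -> ('I_k -> A) -> A) (a0 : A).
Hypothesis A_monoid : one_monoid rho a0.
Implicit Types (T U W : finType).

Lemma filter_thirds (S : Type) (z : S -> R) (l : seq S) :
  all (fun u => 0 <= z u <= 1) l -> pairwise (fun u v => z u <= z v) l ->
  l = [seq u <- l | z u == 0] ++ [seq u <- l | 0 < z u < 1] ++ [seq u <- l | z u == 1].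
Proof.
have nil (p : pred S) s : all (fun u => ~~ p u) s -> [seq u <- s | p u] = [::].
  by elim: s => //= u s IH /andP[/negbTE -> /IH].
elim: l => //= u l IH /andP[/andP[u0 u1] l01] /andP[ul pl].
have [z0|z0] := eqVneq (z u) 0.
  by rewrite z0 ltxx /= eq_sym oner_eq0 /= {1}(IH l01 pl).
have z0' : 0 < z u by rewrite lt_neqAle eq_sym z0.
have n0 : [seq v <- l | z v == 0] = [::].
  by apply: nil; apply: sub_all ul => v uv; rewrite gt_eqF // (lt_le_trans z0').
rewrite n0 /= z0' /=; have [z1|z1] := eqVneq (z u) 1.
  have n1 : [seq v <- l | 0 < z v < 1] = [::].
    by apply: nil; apply: sub_all ul => v; rewrite z1 leNgt => /negbTE ->; rewrite andbF.
  by rewrite z1 ltxx n1 /= {1}(IH l01 pl) n0 n1.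
by rewrite lt_neqAle z1 u1 /= {1}(IH l01 pl) n0.
Qed.

Lemma map_pos_labelled U W (f : U -> W) (a : U -> A) s :
  map_pos f (labelled a s) = [seq (f u, a u) | u <- s].
Proof. by rewrite /map_pos /labelled -map_comp. Qed.

Section Ends.
Variables (m : nat) (c : conf R 'I_m.+2).
Hypothesis ac : assoc R m.+2 c.
Let lc := assoc_limit ac.
Let z (i : 'I_m.+2) : R := c.2 [set: 'I_m.+2]%SET i.

(** A set on which the root screen [z] is not constant has its screen determined by [z], and
    collapsing [F] to [w] preserves [z]. So inputs with a common value of [z] form a cluster. *)
Lemma screen_clustered (s F : seq 'I_m.+2) w : w \in F ->
  (forall u, u \in F -> z u = z w) -> (forall u, u \in s -> u \notin F -> z u != z w) ->
  clustered c s F w.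
Proof.
move=> wF zF zs S u Ss uS S1; set k := collapse F w.
have zk v : z (k v) = z v by rewrite /k /collapse; case: ifP => // /zF.
have [/existsP[u1 /andP[u1F u1S]]|/existsPn nS] := boolP [exists v, (v \in F) && (v \in
  S)]; last first.
  have kid v : v \in S -> k v = v.
    by rewrite /k /collapse; have := nS v; case: (v \in F) => //= /negbTE ->.
  have kS : k @: S = S.
    by rewrite -[RHS]imset_id; apply: eq_in_imset => v vS; rewrite kid.
  by rewrite kS kid.
have [u2 u2S u2F] : exists2 u2, u2 \in S & u2 \notin F.
  apply: contrapT => nu2; move: S1; rewrite ltnNge => /negP; apply.
  rewrite -(cards1 w); apply: subset_leq_card.
  apply/fintype.subsetP => _ /imsetP[v vS ->].
  rewrite inE /k /collapse; case: ifP => // vF.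
  by case: nu2; exists v; rewrite ?vF.
have z12 : z u1 != z u2 by rewrite eq_sym (zF _ u1F) zs // Ss.
rewrite (limit_screen lc (finset.subsetT _) uS u1S u2S z12).
rewrite (limit_screen lc (finset.subsetT _) (imset_f k uS) (imset_f k u1S) (imset_f k
  u2S)); last first.
  by rewrite -!/(z _) !zk.
by rewrite -direction_imset //; congr direction; apply/funext => v /=; rewrite -!/(z _) zk.
Qed.

Lemma assoc_sorted n (s : seq 'I_m.+2) d : size s = n ->
  pairwise (fun i j : 'I_m.+2 => (i < j)%N) s -> assoc R n (pull_raw (place d s) c).
Proof.
move=> sn ps; apply: assoc_pull ac => i j ij.
by move/(pairwiseP d): ps; apply; rewrite ?inE ?sn.
Qed.

Variables (Q : Type) (X : forall m, conf R 'I_m.+2 -> (nat -> A) -> Q).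
Hypothesis X_collapsing : collapsing rho a0 X.

(** The inputs with [z = 0] form a block with the first input and are absorbed by it; those with
    [z = 1] form a block with the last input, whose new label is the product. *)
Lemma Lx_ends (l0 : seq ('I_m.+2 * A)) b :
  pairwise (fun i j : 'I_m.+2 => (i < j)%N) (full ord0 l0 ord_max) ->
  Lx X c ord0 l0 ord_max b =
  Lx X c ord0 [seq w <- l0 | 0 < z w.1 < 1] ord_max
    (mul rho a0 c ([seq w <- l0 | z w.1 == 1] ++ [:: (ord_max, b)])).
Proof.
move=> pl0.
have lE : l0 = [seq w <- l0 | z w.1 == 0] ++
    [seq w <- l0 | 0 < z w.1 < 1] ++ [seq w <- l0 | z w.1 == 1].
  apply: filter_thirds; first by apply/allP => w _; exact: screenT_itv.
  move: pl0; rewrite /full /= pairwise_cat pairwise_map => /and3P[_ _ /andP[+ _]].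
  by apply: sub_pairwise => w w' /= /ltnW; exact: screen_homo.
set F0 := [seq _ <- _ | _] in lE; set l := [seq _ <- _ | 0 < _ < 1] in lE *.
set F1 := [seq _ <- _ | z _ == 1] in lE *.
have F0z u : u \in unzip1 F0 -> z u = 0.
  by move=> /mapP[w]; rewrite mem_filter => /andP[/eqP wz _] ->.
have lz u : u \in unzip1 l -> 0 < z u < 1.
  by move=> /mapP[w]; rewrite mem_filter => /andP[wz _] ->.
have F1z u : u \in unzip1 F1 -> z u = 1.
  by move=> /mapP[w]; rewrite mem_filter => /andP[/eqP wz _] ->.
have z0 : z ord0 = 0 := screen_ord0 ac.
have z1 : z ord_max = 1 := screen_ord_max ac.
rewrite {1}lE; move: pl0; rewrite {1}lE => pl0.
rewrite (Lx_first X_collapsing); first last.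
- apply: screen_clustered => [|u|u].
  + by rewrite inE eqxx.
  + by rewrite z0 inE => /orP[/eqP ->|/F0z].
  rewrite z0 /full /unzip1 !map_cat -!/(unzip1 _) !(in_cons, mem_cat, in_nil) orbF negb_or.
  move=> uin /andP[/negbTE u0 /negbTE uF0].
  move: uin; rewrite u0 uF0 /= => /orP[/orP[/lz /andP[/gt_eqF -> //]|/F1z ->]|/eqP ->].
    by rewrite oner_eq0.
  by rewrite z1 oner_eq0.
- by apply: assoc_sorted pl0; rewrite size_full.
have {}pl0 : pairwise (fun i j : 'I_m.+2 => (i < j)%N) (full ord0 (l ++ F1) ord_max).
  apply: subseq_pairwise pl0; rewrite /full /unzip1 /= ?eqxx !map_cat -!catA.
  exact: suffix_subseq.
(* The last input alone is not a face; its product is just [b]. *)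
have [F1E|F1E] := posnP (size F1).
  by rewrite (size0nil F1E) cats0 /= mul_seq1.
apply: (Lx_last X_collapsing) => //.
- by apply: assoc_sorted pl0; rewrite size_full.
- apply: screen_clustered => [|u|u].
  + by rewrite mem_cat inE eqxx orbT.
  + by rewrite z1 mem_cat inE => /orP[/F1z|/eqP ->].
  rewrite z1 /full /unzip1 !map_cat -!/(unzip1 _) !(in_cons, mem_cat, in_nil) !orbF negb_or.
  move=> uin /andP[/negbTE uF1 /negbTE u1].
  move: uin; rewrite u1 uF1 !orbF => /orP[/eqP ->|/lz /andP[_ /lt_eqF ->] //].
  by rewrite z0 eq_sym oner_eq0.
move=> n d nF dE.
rewrite (@mul_structure_map _ _ _ _ A_monoid _ _ ord_max _ b _ d).
- congr (structure_map _ _ _); apply/funext => i.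
  rewrite /unzip2 map_cat nth_cat size_map /=; case: ltnP => // iF.
  rewrite [RHS]nth_default ?size_map //; case: (i - size F1)%N => //= j; by rewrite nth_nil.
- by rewrite size_cat addn1.
- by rewrite dE /unzip1 map_cat.
Qed.

(** [mul] reads only the screens, and scaling keeps them. *)
Lemma mul_rescale U (f : U -> 'I_m.+2) (l : seq (U * A)) : injective f ->
  uniq (unzip1 l) -> mul rho a0 (rescale_raw f c) l = mul rho a0 c (map_pos f l).
Proof.
move=> finj ul; pose g (i : 'I_(size l)) := (tnth (in_tuple l) i).1.
have ginj : injective g by exact: tnth_fst_inj.
pose d : FM1 R _ := fm_local (inj_comp finj ginj) (to_FM lc).
have E : [seq (g i, (tnth (in_tuple l) i).2) | i <- enum 'I_(size l)] = l.
  rewrite -[RHS](map_tnth_enum (in_tuple l)).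
  by apply: eq_map => i; rewrite /g -surjective_pairing.
rewrite (@mulE _ _ _ _ A_monoid _ _ _ _ g (fun i => (tnth (in_tuple l) i).2) d) ?E //;
  last first.
  by rewrite /d /= -pull_raw_comp.
rewrite (@mulE _ _ _ _ A_monoid _ _ _ _ (f \o g) (fun i => (tnth (in_tuple l) i).2) d) //.
by rewrite -[in map_pos f l]E /map_pos -map_comp.
Qed.

Lemma limit_rescale U (f : U -> 'I_m.+2) : injective f -> limit_config (rescale_raw f c).
Proof.
move=> finj.
have [] : FM `[0, 1] U (rescale_raw f c); last by [].
by apply: (@FM_rescale _ _ _ f _ c finj _ ac.1); rewrite card_ord.
Qed.

(** By [pull_ext_rescale] the added end points may be replaced by the first and last inputs of
    [c]. *)
Lemma value_rescale U (f : U -> 'I_m.+2) (a : U -> A) : injective f ->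
  value rho a0 X (rescale_raw f c) a =
  Lx X c ord0 (map_pos f (labelled a (points (rescale_raw f c) (interior (rescale_raw f c)))))
    ord_max (mul rho a0 (rescale_raw f c) (labelled a (points (rescale_raw f c) (at_end
      (rescale_raw f c))))).
Proof.
move=> finj; rewrite /value /Lext; set b := mul _ _ _ _.
set l := labelled a _; have lr := limit_rescale finj.
have fE : full ord0 (map_pos f l) ord_max =
    map (unext f) (full (inl false) (map_pos inr l) (inl true)).
  by rewrite /full !unzip1_map_pos /= map_cat -!map_comp.
have sl : size (map_pos f l) = size (map_pos (@inr bool U) l) by rewrite /map_pos !size_map.
set s := full (inl false) (map_pos (@inr bool U) l) (inl true).
have ss : size s = (size (map_pos (@inr bool U) l)).+2 by rewrite size_full.
rewrite [RHS](LxE X_collapsing c sl (p := unext f \o place (inl true) s)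
  (a := nth b (unzip2 (map_pos (@inr bool U) l)))).
- rewrite -(pull_ext_rescale ac finj) //; first apply: (place_inj ss).
    have : uniq (unzip1 l) by rewrite unzip1_labelled points_uniq.
    rewrite /s /full !unzip1_map_pos /= mem_cat inE orbF cat_uniq /= !andbT orbF.
    rewrite (@map_inj_uniq _ _ (@inr bool U)); last by move=> ? ? [].
    by move=> ->; rewrite /=; apply/andP; split; apply/negP => /mapP[].
  move=> v; have : place (inl true) s v \in s by rewrite mem_nth ?ss.
  rewrite /s /full unzip1_map_pos inE mem_cat inE =>
    /orP[/eqP ->//|/orP[/mapP[u + ->]|/eqP -> //]].
  by rewrite /l unzip1_labelled mem_points.
- by move=> i; rewrite /place fE (nth_map (inl true)) ?ss.
- by move=> i _; rewrite !unzip2_map_pos.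
Qed.

Lemma value_ends U (f : U -> 'I_m.+2) (a : U -> A) (s : seq U) b : injective f ->
  pairwise (fun i j : 'I_m.+2 => (i < j)%N) (full ord0 (map_pos f (labelled a s)) ord_max) ->
  (forall u, interior (rescale_raw f c) u -> u \in s) ->
  Lx X c ord0 (map_pos f (labelled a s)) ord_max b =
  Lx X c ord0 (map_pos f (labelled a (points (rescale_raw f c) (interior (rescale_raw f c)))))
    ord_max (mul rho a0 c (map_pos f (labelled a [seq u <- s | at_end (rescale_raw f c) u])
       ++ [:: (ord_max, b)])).
Proof.
move=> finj ps si; rewrite Lx_ends // !map_pos_labelled !filter_map.
rewrite (@points_eq _ _ _ _ [seq u <- s | interior (rescale_raw f c) u]) //.
- exact: limit_rescale.
- rewrite sorted_pairwise; last exact: before_trans (limit_rescale finj).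
  apply: pairwise_filter; move: ps; rewrite /full unzip1_map_pos unzip1_labelled /=.
  rewrite pairwise_cat pairwise_map => /and3P[_ _ /andP[+ _]]; apply: sub_pairwise => u v.
  rewrite /= -(assoc_before ac) -(before_pull f c u v) => fuv.
  by rewrite /before in fuv *.
- move=> u; rewrite mem_filter; apply/andP/idP => [[]//|iu]; split=> //; exact: si.
Qed.

End Ends.

Lemma full_enum m (a : 'I_m -> A) : full ord0 (map_pos (@middle m) (labelled a (enum
  'I_m))) ord_max =
  enum 'I_m.+2.
Proof.
rewrite /full unzip1_map_pos unzip1_labelled enum_ordSl enum_ordSr map_rcons cats1.
congr cons; rewrite -(map_comp (lift ord0)); congr rcons; last exact/val_inj.
apply: eq_map => i; apply/val_inj; rewrite /middle /= /bump /=.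
by rewrite leqNgt ltn_ord.
Qed.

Lemma pairwise_enum n : pairwise (fun i j : 'I_n => (i < j)%N) (enum 'I_n).
Proof.
have : pairwise ltn (map val (enum 'I_n)).
  rewrite val_enum_ord -sorted_pairwise; first exact: iota_ltn_sorted.
  exact: ltn_trans.
by rewrite pairwise_map.
Qed.

(** The class of [(c; a)] lists all inputs of [c], the value only those located strictly between 0
    and 1; [Lx_ends] passes from one to the other. *)
Lemma value_B_config m (c : assoc R m.+2) (a : 'I_m -> A) :
  value rho a0 (B_class rho a0) (val (B_config c)) a = cls (B_step rho a0) (preB_elt c a).
Proof.
have ac : assoc R m.+2 (val c) := set_valP c.
have minj : injective (@middle m) := @middle_inj m.
rewrite [val _]/= (value_rescale ac (B_collapsing rho a0)) //.
pose l := map_pos (@middle m) (labelled a (enum 'I_m)).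
have sl : size l = m by rewrite /l /map_pos /labelled 2!size_map size_enum_ord.
(* [a0] is a dummy last label, which [B_class] ignores. *)
have <- : Lx (B_class rho a0) (val c) ord0 l ord_max a0 = cls (B_step rho a0) (preB_elt c a).
  rewrite (LxE (B_collapsing rho a0) (val c) sl (p := id) (a := nth a0 (unzip2 l))) //.
    apply: B_classE; first by rewrite pull_raw_id //; exact: assoc_limit.
    move=> i; rewrite /l unzip2_map_pos /labelled /unzip2 -map_comp.
    by rewrite (nth_map i) ?size_enum_ord // nth_ord_enum.
  by move=> i; rewrite /place full_enum nth_ord_enum.
rewrite [RHS](value_ends ac (B_collapsing rho a0)) //.
- apply: B_class_ext => i il; apply: set_nth_default.
  by rewrite unzip2_map_pos; move: il; rewrite /map_pos !size_map.
- by rewrite full_enum pairwise_enum.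
- by move=> u _; rewrite mem_enum.
Qed.

Lemma value_E_config m (c : assoc R m.+2) (a : 'I_m.+1 -> A) :
  value rho a0 (E_class rho a0) (val (E_config c)) a = cls (E_step rho a0) (preE_elt c a).
Proof.
have ac : assoc R m.+2 (val c) := set_valP c.
have linj : injective (lift (ord0 : 'I_m.+2)) by exact: lift_inj.
rewrite [val _]/= (value_rescale ac (E_collapsing rho a0)) //.
(* [s] omits the last input, whose label is the last label of [Lx]. That input is located at 1, so
   in the value it is the last of the twigs multiplied there. *)
set f := lift ord0; pose s := [seq lift ord_max i | i <- enum 'I_m].
pose l := map_pos f (labelled a s).
have lE : l = map_pos (@middle m) (labelled (a \o lift ord_max) (enum 'I_m)).
  by rewrite /l /s !map_pos_labelled -map_comp.
have sl : size l = m by rewrite lE /map_pos /labelled 2!size_map size_enum_ord.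
have <- : Lx (E_class rho a0) (val c) ord0 l ord_max (a ord_max) = cls (E_step rho a0)
  (preE_elt c a).
  rewrite (LxE (E_collapsing rho a0) (val c) sl (p := id) (a := nth (a ord_max) (unzip2
    l))) //.
    apply: E_classE; first by rewrite pull_raw_id //; exact: assoc_limit.
    move=> i; rewrite lE unzip2_map_pos /labelled /unzip2 -map_comp.
    case: (unliftP ord_max i) => [j ->|->].
      rewrite lift_max (nth_map j) ?size_enum_ord //= nth_ord_enum //.
    by rewrite nth_default // size_map size_enum_ord.
  by move=> i; rewrite /place lE full_enum nth_ord_enum.
have sE : s ++ [:: ord_max] = enum 'I_m.+1.
  rewrite enum_ordSr cats1; congr rcons; apply: eq_map => i; apply/val_inj.
  by rewrite /= /bump leqNgt ltn_ord.
have fM : f ord_max = ord_max by apply/val_inj.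
have em : at_end (rescale_raw f (val c)) ord_max.
  by rewrite /at_end /= fM (screen_ord_max ac).
rewrite [RHS](value_ends ac (E_collapsing rho a0)) //.
- congr Lx; rewrite (mul_rescale ac) ?unzip1_labelled ?points_uniq //; congr mul.
  rewrite (@points_eq _ _ _ _ ([seq u <- s | at_end (rescale_raw f (val c)) u] ++ [::
    ord_max])).
  + by rewrite !map_pos_labelled map_cat /= fM.
  + exact: limit_rescale.
  + rewrite sorted_pairwise; last exact: before_trans (limit_rescale ac linj).
    rewrite (_ : _ ++ _ = [seq u <- enum 'I_m.+1 | at_end (rescale_raw f (val c)) u]);
      last first.
      by rewrite -sE filter_cat /= em.
    apply: pairwise_filter; apply: sub_pairwise (pairwise_enum _) => u v uv.
    have : before (pull_raw f (val c)) u v by rewrite before_pull (assoc_before ac);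
      exact: lift_homo.
    by rewrite /before.
  + move=> u; rewrite mem_cat mem_filter inE.
    have : u \in s ++ [:: ord_max] by rewrite sE mem_enum.
    rewrite mem_cat inE => /orP[us|/eqP ->]; last by rewrite eqxx orbT [RHS]em.
    by rewrite us andbT; apply/orP/idP => [[//|/eqP ->//]|]; left.
- by rewrite -/l lE full_enum pairwise_enum.
- move=> u; have : u \in s ++ [:: ord_max] by rewrite sE mem_enum.
  rewrite mem_cat inE => /orP[//|/eqP ->].
  by move: em; rewrite /at_end /interior => /eqP ->; rewrite ltxx andbF.
Qed.

End Scaled.

Lemma perm_off k (s : 'S_k) t : ~ forall j, s j != t.
Proof. by move=> /(_ ((s^-1)%g t)); rewrite permKV eqxx. Qed.

Lemma lift_off k (i t : 'I_k.+1) : (forall j : 'I_k, lift i j != t) -> t = i.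
Proof. by case: (unliftP i t) => // j -> /(_ j); rewrite eqxx. Qed.

Lemma enum_val_off (T : finType) (S : {set T}) t :
  (forall j, enum_val (A := mem S) j != t) -> t \notin S.
Proof.
move=> St; apply/negP => tS; have tS' : t \in mem S by [].
by have := St (enum_rank_in tS' t); rewrite enum_rankK_in // eqxx.
Qed.

(** * Descent of the value to C(I, N; A) *)

Section Forward.
Variables (R : realType) (A : topologicalType).
Variables (rho : forall k, FM1 R k -> ('I_k -> A) -> A) (a0 : A).
Hypothesis A_monoid : one_monoid rho a0.
Implicit Types (T U W : finType).

Lemma merge_labels_inj U T (f : U -> T) (C : conf R U) (a : U -> A) u :
  limit_config C -> injective f -> merge_labels rho a0 f C a (f u) = a u.
Proof.
move=> lC finj; rewrite /merge_labels (@points_eq _ _ _ _ [:: u]) //.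
  by rewrite mul_seq1.
by move=> v; rewrite inE -topredE /= (inj_eq finj).
Qed.

Lemma merge_labels_out U T (f : U -> T) (C : conf R U) (a : U -> A) t :
  limit_config C -> (forall u, f u != t) -> merge_labels rho a0 f C a t = a0.
Proof.
move=> lC ft; rewrite /merge_labels (@points_eq _ _ _ _ [::]) //.
  exact: mul_nil.
by move=> v; rewrite in_nil -topredE /= (negbTE (ft v)).
Qed.

Section Target.
Variables (Q : Type) (X : forall m, conf R 'I_m.+2 -> (nat -> A) -> Q).
Hypothesis X_collapsing : collapsing rho a0 X.
Variable N : set R.
Hypothesis X_away : forall T (c : conf R T) (a a' : T -> A),
  (forall t, ~ N (c.1 t) -> a t = a' t) ->
  value rho a0 X c a = value rho a0 X c a'.

(** Pulling back along an injection is a grafting with at most one twig per tree, so omitted twigs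
    acquire the label [a0]. [X_away] covers those located in [N]. *)
Lemma value_pull U T (f : U -> T) (c : conf R T) (a : T -> A) :
  FM `[0 : R, 1] T c -> injective f ->
  (forall t, (forall u, f u != t) -> a t = a0 \/ N (c.1 t)) ->
  value rho a0 X (pull_raw f c) (a \o f) = value rho a0 X c a.
Proof.
move=> Fc finj af; have lc : limit_config c by case: Fc.
have lp := limit_pull finj lc.
rewrite (value_grafted A_monoid X_collapsing _ lp lc (grafted_pull f c)).
apply: X_away => // t nt.
have [[u <-]|nf] := pselect (exists u, f u = t); first by rewrite merge_labels_inj.
have {}nf u : f u != t by apply/eqP => fu; apply: nf; exists u.
by rewrite merge_labels_out //; case: (af t nf).
Qed.

Definition lvalue (w : lconf `[0 : R, 1] A) : Q :=
  value rho a0 X (val (projT2 w).1) (projT2 w).2.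

Lemma lvalue_forget w w' : forget_step a0 w w' -> lvalue w = lvalue w'.
Proof.
move=> [k s c x|k i c x xi]; rewrite /lvalue /=; symmetry.
  apply: value_pull; [exact: set_valP|exact: perm_inj|by move=> t /perm_off].
by apply: value_pull; [exact: set_valP|exact: lift_inj|move=> t /lift_off ->; left].
Qed.

Lemma lvalue_away w : lvalue (away N w) = lvalue w.
Proof.
apply: value_pull; [exact: set_valP|exact: enum_val_inj|move=> t nt; right].
by have := enum_val_off nt; rewrite inE => /asboolPn/contrapT.
Qed.

Lemma sig_Rank k (p : 'I_k -> nat) i (t : 'I_(p i)) :
  tagnat.sig (@tagnat.Rank k p i t) = Tagged (fun i => 'I_(p i)) t.
Proof. by rewrite -[RHS]tagnat.rankK tagnat.rankE. Qed.

Lemma pull_Rank (L : set R) k (p : 'I_k -> nat) (c : FM L 'I_k)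
    (d : forall i, FM1 R (p i)) i :
  val (d i) = pull_raw (@tagnat.Rank k p i) (centred (val (fm_comp c d))).
Proof.
have [ld d0] := set_valP (d i).
pose G := graft_raw (val c) (fun i => val (d i)).
rewrite -[RHS]/(centred (pull_raw (@tagnat.Rank k p i) (pull_raw (@tagnat.sig k p) G))).
rewrite pull_raw_comp (funext (@sig_Rank k p i) : _ \o _ = _).
rewrite pull_graft_tagged // [LHS]surjective_pairing; congr pair.
by apply/funext => t; exact: d0.
Qed.

(** The composition is [grafted] along [sig1], and the labels it induces on [c] are the values of
    [rho]. *)
Lemma lvalue_graft k (p : 'I_k -> nat) (c : FM `[0 : R, 1] 'I_k)
    (d : forall i, FM1 R (p i)) (x : forall i, 'I_(p i) -> A) :
  lvalue (lab (fm_comp c d) (fun s => x (tagnat.sig1 s) (tagnat.sig2 s))) =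
  lvalue (lab c (fun i => rho (d i) (x i))).
Proof.
have gr : grafted (@tagnat.sig1 k p) (val (fm_comp c d)) (val c).
  exact: grafted_pull_comp (grafted_graft (val c) (fun i => val (d i))).
rewrite /lvalue /= (value_grafted A_monoid X_collapsing _ (FM_limit (fm_comp c d))
  (FM_limit c) gr).
congr value; apply/funext => i; rewrite /merge_labels.
apply: (mulE A_monoid (pull_Rank c d i)); apply: uniq_perm.
- by apply: (map_uniq (f := fst)); rewrite -/(unzip1 _) unzip1_labelled points_uniq.
- rewrite map_inj_uniq ?enum_uniq // => t t' /(congr1 fst) /= tt'.
  have := congr1 (@tagnat.sig k p) tt'.
  by rewrite !sig_Rank => /eqP; rewrite eq_Tagged => /eqP.
move=> [s b]; apply/mapP/mapP => [[s' + [-> ->]]|[t _ [-> ->]]].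
  rewrite mem_points => /eqP; case: _ /; exists (tagnat.sig2 s'); first by rewrite mem_enum.
  by rewrite tagnat.sig2K.
exists (@tagnat.Rank k p i t); first by rewrite mem_points tagnat.Rank1K.
congr pair; pose F (q : {i : 'I_k & 'I_(p i)}) := x (tag q) (tagged q).
have : F (Tagged (fun i => 'I_(p i)) t) = F (tagnat.sig (@tagnat.Rank k p i t)).
  by rewrite sig_Rank.
by rewrite tagnat.sigE12.
Qed.

End Target.

Lemma CMN_rec (L N : set R) (X Q : topologicalType) (x0 : X) (f : lconf L X -> Q) :
  continuous f -> weak_hausdorff Q ->
  (forall w w', forget_step x0 w w' -> f w = f w') ->
  (forall w, f (away N w) = f w) ->
  continuous (fun u : CMN L N x0 => f (cmn_rep u)) /\
  forall w, f (cmn_rep (cmn_cls N x0 w)) = f w.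
Proof.
move=> cf wQ ff fa; pose f1 (u : CX L x0) := f (representative u).
have f1E w : f1 (cls _ w) = f w by exact: cls_rec.
have cf1 : continuous f1 by exact: cls_rec_continuous.
have f1r u v : same_away N (x0 := x0) u v -> f1 u = f1 v.
  by move=> [w [w' [-> -> ww']]]; rewrite !f1E -fa -[RHS]fa -!f1E ww'.
split=> [|w]; first exact: (@cls_rec_continuous _ _ _ f1).
by rewrite -[RHS]f1E; exact: (@cls_rec _ _ _ f1).
Qed.

Lemma CI_rec (N : set R) (Q : topologicalType) (f : lconf `[0 : R, 1] A -> Q) :
  continuous f -> weak_hausdorff Q ->
  (forall w w', forget_step a0 w w' -> f w = f w') ->
  (forall w, f (away N w) = f w) ->
  (forall w, f (graft_labels (x0 := a0) w) = f (lab_map (rho_star rho (a0 := a0)) w)) ->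
  exists h : CI rho a0 N -> Q, continuous h /\ forall w, h (CI_cls rho a0 N w) = f w.
Proof.
move=> cf wQ ff fa fg.
pose f2 (u : CMN `[0 : R, 1] N a0) := f (cmn_rep u).
have [cf2 f2E] : continuous f2 /\ forall w, f2 (cmn_cls N a0 w) = f w by exact: CMN_rec.
have f2r p q : coequalized rho p q -> f2 p = f2 q.
  by move=> [u [-> ->]]; rewrite !f2E fg.
exists (fun u => f2 (representative u)); split; first exact: cls_rec_continuous.
by move=> w; rewrite -[RHS]f2E; exact: cls_rec.
Qed.

Lemma lvalue_graft_labels (N : set R) Q (X : forall m, conf R 'I_m.+2 -> (nat -> A) -> Q) w :
  collapsing rho a0 X ->
  lvalue X (graft_labels (x0 := a0) w) = lvalue X (lab_map (rho_star rho (a0 := a0)) w).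
Proof.
move=> X_collapsing; case: w => k [c y].
exact: (lvalue_graft X_collapsing c (fun i => (projT2 (representative (y i))).1)
  (fun i => (projT2 (representative (y i))).2)).
Qed.

(** Copies of the associahedron, one for each permutation, form a finite compact cover of
    [C_k(I)]. *)
Lemma lconf_continuous (Q : topologicalType) (f : lconf `[0 : R, 1] A -> Q) :
  (forall k (s : 'S_k), continuous ((fun p =>
    f (lab (fm_pull (@perm_inj _ s) (B_config p.1)) p.2))
     : kification (assoc R k.+2 * {ptws 'I_k -> A}) -> Q)) ->
  continuous f.
Proof.
move=> cf; apply: kification_sigT_continuous => k; apply/continuousP => V oV.
pose q (s : 'S_k) (e : assoc R k.+2) := fm_pull (@perm_inj _ s) (B_config e).
apply: (@compact_cover_k_open (FM `[0 : R, 1] 'I_k) {ptws 'I_k ->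
  A} 'S_k (fun=> assoc R k.+2) q).
- by apply: hausdorff_set_type; exact: conf_hausdorff.
- by move=> _; exact/compact_set_type/compact_assoc.
- by move=> _; apply: hausdorff_set_type; exact: conf_hausdorff.
- move=> s e; apply: (@continuous_comp _ _ _ (@B_config R k)).
    exact: B_config_continuous.
  exact: fm_pull_continuous.
- by move=> c; have [s [e eE]] := rescale_surj c; exists s, e.
move=> s; have /continuousP/(_ V oV) := cf k s; exact.
Qed.

End Forward.

(** * Reindexing and grafting of labelled configurations *)

Section Reindexing.
Variables (R : realType) (L : set R) (X : topologicalType) (x0 : X).

Lemma labE k (c c' : FM L 'I_k) (x x' : 'I_k -> X) : val c = val c' -> x =1 x' ->
  lab c x = lab c' x'.
Proof. by move=> cc' xx'; congr lab; [exact: val_inj|exact/funext]. Qed.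

(** If [f] misses some [i], that twig is forgotten and [f] factors through [lift i]; if it misses
    none, it is a permutation. *)
Lemma CX_reindex k k' (f : 'I_k' -> 'I_k) (finj : injective f) (c : FM L 'I_k)
    (x : 'I_k -> X) : (forall i, (forall j, f j != i) -> x i = x0) ->
  cls (forget_step x0) (lab c x) = cls (forget_step x0) (lab (fm_pull finj c) (x \o f)).
Proof.
elim: k => [|k IH] in f finj c x *; move=> off.
  case: k' f finj off => [|k'] f finj off; last by case: (f ord0).
  congr cls; apply: labE => /=; last by case.
  rewrite -[LHS]pull_raw_id; last exact: FM_limit.
  by congr pull_raw; apply/funext => -[].
have [[i fi]|fs] := pselect (exists i, forall j, f j != i).
  have /choice [g gE] : forall j, exists l, f j = lift i l.
    move=> j; have := fi j; case: (unliftP i (f j)) => [l ->|->]; first by exists l.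
    by rewrite eqxx.
  have ginj : injective g by move=> a b gab; apply: finj; rewrite !gE gab.
  rewrite (cls_step (Forget c (off i fi))) (IH g ginj) => [|l gl].
    congr cls; apply: labE => [|j]; last by rewrite /= gE.
    by rewrite /= pull_raw_comp; congr pull_raw; apply/funext => j; rewrite gE.
  apply: off => j; rewrite gE (inj_eq (@lift_inj _ i)); exact: gl.
have kk' : k' = k.+1.
  apply/eqP; rewrite eqn_leq; apply/andP; split.
    by have := leq_card f finj; rewrite !card_ord.
  rewrite leqNgt; apply/negP => kk'; apply: fs.
  apply: contrapT => nf; move: kk'; rewrite ltnNge => /negP; apply.
  rewrite -[X in (X <= _)%N]card_ord -[X in (_ <= X)%N]card_ord -!cardsT.
  apply: leq_trans (leq_imset_card f _); apply: subset_leq_card.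
  apply/fintype.subsetP => i _; apply: contrapT => ni; apply: nf; exists i => j.
  by apply/eqP => fj; apply: ni; rewrite -fj imset_f.
case: _ / (esym kk') f finj {fs off} => f finj.
rewrite (cls_step (Renumber x0 (perm finj) c x)); congr cls.
apply: labE => [|j]; last by rewrite /= permE.
by rewrite /=; congr pull_raw; apply/funext => j; rewrite permE.
Qed.

Variable N : set R.

(** The parts of the two sides away from [N] differ by an injection [h] that misses only twigs
    labelled by [x0], so [CX_reindex] applies to them. *)
Lemma CMN_reindex k k' (f : 'I_k' -> 'I_k) (finj : injective f) (c : FM L 'I_k)
    (x : 'I_k -> X) :
  (forall i, (forall j, f j != i) -> x i = x0 \/ N ((val c).1 i)) ->
  cmn_cls N x0 (lab c x) = cmn_cls N x0 (lab (fm_pull finj c) (x \o f)).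
Proof.
move=> off; apply: cls_step; exists (lab c x), (lab (fm_pull finj c) (x \o f)).
split=> //; rewrite /away /=.
set S := [set i | _]%SET; set S' := [set i | _]%SET.
have fS j : f (enum_val (A := mem S') j) \in mem S.
  by have := enum_valP (A := mem S') j; rewrite !inE.
pose h j := enum_rank_in (fS j) (f (enum_val (A := mem S') j)).
have hE j : enum_val (h j) = f (enum_val (A := mem S') j) by rewrite enum_rankK_in.
have hinj : injective h.
  by move=> i j /(congr1 enum_val); rewrite !hE => /finj /enum_val_inj.
rewrite (CX_reindex hinj) => [|i hi].
  congr cls; apply: labE => [|j]; last by rewrite /= hE.
  by rewrite /= !pull_raw_comp; congr pull_raw; apply/funext => j; rewrite /= hE.
have := enum_valP (A := mem S) i; rewrite inE => /asboolP nN.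
case: (off (enum_val i)) => // j; apply/eqP => fj.
have jS : j \in mem S' by rewrite inE /= fj; exact/asboolP.
have /eqP := hi (enum_rank_in jS j); apply.
by apply: enum_val_inj; rewrite hE enum_rankK_in.
Qed.

End Reindexing.

Section GraftedLabels.
Variables (R : realType) (L : set R) (X : topologicalType) (x0 : X).
Let pt := lconf [set (0 : R)] X.

(** [graft_labels] with explicitly given trees in place of chosen representatives. *)
Definition graft_conf k (c : FM L 'I_k) (z : 'I_k -> pt) : lconf L X :=
  lab (fm_comp c (fun i => (projT2 (z i)).1))
    (fun s => (projT2 (z (tagnat.sig1 s))).2 (tagnat.sig2 s)).

(* [w'] is obtained from [w] by renumbering and forgetting. *)
Definition reindexed (w w' : pt) : Prop :=
  exists g : 'I_(projT1 w') -> 'I_(projT1 w), [/\ injective g,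
    val (projT2 w').1 = pull_raw g (val (projT2 w).1),
    (projT2 w').2 = (projT2 w).2 \o g &
    forall i, (forall j, g j != i) -> (projT2 w).2 i = x0].

Lemma reindexed_refl w : reindexed w w.
Proof.
exists id; split=> // [|i /(_ i)]; last by rewrite eqxx.
by rewrite pull_raw_id //; exact: FM_limit.
Qed.

Lemma reindexed_step w w' : forget_step x0 w w' -> reindexed w w'.
Proof.
move=> [k s c x|k i c x xi] /=.
  by exists s; split=> // [|i /perm_off //]; exact: perm_inj.
by exists (lift i); split=> // [|l /lift_off ->]; first exact: lift_inj.
Qed.

(** The trees and the twigs that carry them are reindexed together, by [Phi] on pairs. A twig can be
    lost in two ways, which are justified differently in C(M, N)(X); hence the alternative at the
    end. *)
Lemma graft_conf_reindex k k' (f : 'I_k' -> 'I_k) (finj : injective f)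
    (c : FM L 'I_k) (z : 'I_k -> pt) (z' : 'I_k' -> pt) :
  (forall j, reindexed (z (f j)) (z' j)) ->
  exists (F : 'I_(\sum_j projT1 (z' j))%N -> 'I_(\sum_i projT1 (z i))%N) (Finj : injective F),
    [/\ val (projT2 (graft_conf (fm_pull finj c) z')).1 =
          pull_raw F (val (projT2 (graft_conf c z)).1),
        (projT2 (graft_conf (fm_pull finj c) z')).2 = (projT2 (graft_conf c z)).2 \o F &
        forall s, (forall u, F u != s) ->
          (forall j, f j != tagnat.sig1 s) \/ (projT2 (graft_conf c z)).2 s = x0].
Proof.
move=> zz'; pose g j := sval (cid (zz' j)).
have gP j := svalP (cid (zz' j)); rewrite -/(g _) in gP.
pose p i := projT1 (z i); pose p' j := projT1 (z' j).
pose Phi (u : {j : 'I_k' & 'I_(p' j)}) : {i : 'I_k & 'I_(p i)} :=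
  Tagged (fun i => 'I_(p i)) (g (tag u) (tagged u)).
have Pinj : injective Phi.
  move=> [j t] [j' t'] E; have jj' : j = j' by apply: finj; exact: (congr1 tag E).
  case: _ / jj' t' E => t' /eqP; rewrite eq_Tagged /= => /eqP.
  by have [ginj _ _ _] := gP j; move=> /ginj ->.
pose d i := (projT2 (z i)).1; pose d' j := (projT2 (z' j)).1.
have gr : graft_raw (val (fm_pull finj c)) (fun j => val (d' j)) =
    pull_raw Phi (graft_raw (val c) (fun i => val (d i))).
  congr pair; apply/funext => S; apply/funext => u /=.
  case: (boolP (u \in S)) => uS //; rewrite imset_f //=.
  have tS : tag @: (Phi @: S) = f @: (tag @: S).
    by rewrite -!imset_comp; apply: eq_imset => v.
  rewrite tS (card_imset _ finj); case: ifP => S1; first by rewrite (imset_f _ uS).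
  have [_ dE _ _] := gP (tag u); rewrite -[val (d' _)]/(val (projT2 (z' (tag u))).1) dE /=.
  rewrite inE; case: u uS {dE} => j t uS; rewrite /Tagged /= uS.
  rewrite (imset_f Phi uS) /=; congr ((val (d (f j))).2 _ _); apply/setP => v;
    rewrite inE; apply/imsetP/imsetP.
    by move=> [b]; rewrite inE => bS ->; exists (Tagged (fun j => 'I_(p' j)) b).
  move=> [[j' b] bS E]; have jj' : j' = j by apply: finj; exact: esym (congr1 tag E).
  case: _ / (esym jj') b bS E => b bS /eqP; rewrite eq_Tagged /= => /eqP ->.
  by exists b; rewrite ?inE.
pose F (u : 'I_(\sum_j p' j)%N) := tagnat.rank (Phi (tagnat.sig u)).
have Finj : injective F.
  by move=> a b /(@tagnat.rank_inj k p) /Pinj /(@tagnat.sig_inj k' p').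
have sF : @tagnat.sig k p \o F = Phi \o @tagnat.sig k' p'.
  by apply/funext => u; rewrite /F /= tagnat.rankK.
exists F, Finj; split.
- rewrite -[LHS]/(pull_raw (@tagnat.sig k' p') (graft_raw (val (fm_pull finj c)) (fun j
  => val (d' j)))).
  rewrite gr pull_raw_comp -sF -[RHS]/(pull_raw F (pull_raw (@tagnat.sig k p)
    (graft_raw (val c) (fun i => val (d i))))).
  by rewrite [RHS]pull_raw_comp.
- apply/funext => u; pose x (q : {i : 'I_k & 'I_(p i)}) := (projT2 (z (tag q))).2 (tagged q).
  rewrite -[RHS]/(x ((@tagnat.sig k p \o F) u)) sF /x /=.
  have [_ _ xE _] := gP (tag (@tagnat.sig k' p' u)).
  rewrite -[LHS]/((projT2 (z' (tag (@tagnat.sig k' p' u)))).2 (tagged (@tagnat.sig k' p' u))).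
  by rewrite xE.
move=> s sF'; have [[j fj]|nf] := pselect (exists j, f j = tagnat.sig1 s); last first.
  by left=> j; apply/eqP => fj; apply: nf; exists j.
right; pose x (q : {i : 'I_k & 'I_(p i)}) := (projT2 (z (tag q))).2 (tagged q).
rewrite -[LHS]/(x (@tagnat.sig k p s)).
have : forall u, Phi u != @tagnat.sig k p s.
  move=> u; have := sF' (tagnat.rank u); apply: contra => /eqP uE.
  by rewrite /F tagnat.rankK uE tagnat.sigK.
have : tag (@tagnat.sig k p s) = f j by rewrite fj.
case: (@tagnat.sig k p s) => i t /= ij; case: _ / (esym ij) t => t Pt.
rewrite /x /=; have [_ _ _ off] := gP j; apply: off => l.
have := Pt (Tagged (fun j => 'I_(p' j)) l); apply: contra => /eqP lt.
by rewrite /Phi /= -lt.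
Qed.

End GraftedLabels.

(** * Grafting on classes, and continuity of lambda *)

Section GraftedClasses.
Variables (R : realType) (L : set R) (X : topologicalType) (x0 : X).
Let pt := lconf [set (0 : R)] X.

Lemma fm_comp_continuous (K : topologicalType) k (p : 'I_k -> nat)
    (c : K -> FM L 'I_k) (d : forall i, K -> FM1 R (p i)) :
  continuous c -> (forall i, continuous (d i)) ->
  continuous (fun x => fm_comp (c x) (fun i => d i x)).
Proof.
move=> cc cd; apply: continuous_set_type.
have cvc : continuous (fun x => val (c x)).
  by move=> x; apply: continuous_comp; [exact: cc|exact: set_val_continuous].
have cvd i : continuous (fun x => val (d i x)).
  by move=> x; apply: continuous_comp; [exact: cd|exact: set_val_continuous].
move=> x; apply: (@continuous_comp _ _ _
  (fun x => graft_raw (val (c x)) (fun i => val (d i x))) (pull_raw _));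
    last exact: pull_raw_continuous.
move: x; apply: continuous_conf => [i|S i] x.
  apply: (@continuous_comp _ _ _ (fun x => val (c x)) (fun e : conf R 'I_k => e.1 (tag i))).
    exact: cvc.
  exact: continuous_location.
rewrite /graft_raw /=; case: (i \notin S); first exact: (@cst_continuous _ R 0).
case: (1 < _)%N.
  apply: (@continuous_comp _ _ _ (fun x => val (c x)) (fun e : conf R 'I_k =>
    e.2 (tag @: S) (tag i))).
    exact: cvc.
  exact: continuous_screen.
apply: (@continuous_comp _ _ _ (fun x => val (d (tag i) x))
  (fun e : conf R 'I_(p (tag i)) => e.2 [set j | Tagged (fun i =>
    'I_(p i)) j \in S]%SET (tagged i))).
  exact: cvd.
exact: continuous_screen.
Qed.

(** The number of twigs of each [z i] is locally constant, so near a point the arities of the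
    composition are fixed. *)
Lemma graft_conf_continuous (K : topologicalType) k (c : K -> FM L 'I_k)
    (z : 'I_k -> K -> pt) : compact [set: K] -> hausdorff_space K ->
  continuous c -> (forall i, continuous (z i)) ->
  continuous ((fun x => graft_conf (c x) (fun i => z i x)) : K -> lconf L X).
Proof.
move=> cK hK cc cz x.
have cz' i : continuous (z i : K -> {k & lconf_of_size [set (0 : R)] X k}).
  move=> y; apply: (@continuous_comp _ _ _ (z i : K -> pt)
    (id : pt -> {k & lconf_of_size [set (0 : R)] X k})); first exact: cz.
  by apply: continuous_from_kification => ?; exact: cvg_id.
pose p i := projT1 (z i x).
have [z' z'E] : exists z' : forall i, K -> lconf_of_size [set (0 : R)] X (p i),
    forall i, continuous (z' i) /\ forall y, projT1 (z i y) = p i ->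
      z i y = existT _ (p i) (z' i y).
  have lift i : exists z' : K -> lconf_of_size [set (0 : R)] X (p i),
    continuous z' /\ forall y, projT1 (z i y) = p i -> z i y = existT _ (p i) (z' y).
    exact: sigT_local_lift (projT2 (z i x)) (cz' i).
  by exists (fun i => sval (cid (lift i))) => i; exact: (svalP (cid (lift i))).
apply: (@near_eq_continuous _ _ (fun y => graft_conf (c y)
  (fun i => existT (lconf_of_size [set (0 : R)] X) (p i) (z' i y)))).
  have : \forall y \near x, forall i, projT1 (z i y) = p i.
    apply: (@filter_forall K 'I_k (fun i y => projT1 (z i y) = p i) _ (nbhs_filter x)) =>
      i; exact: (sigT_near x (cz' i)).
  apply: filterS => y yE; congr graft_conf; apply/funext => i.
  by rewrite (proj2 (z'E i)).
move: x @p z' z'E => x p z' z'E; move: (x).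
apply: continuous_to_kification => //.
rewrite /graft_conf /lab /=.
move=> y; apply: (@continuous_comp _ _ _ _ (existT _ (\sum_i p i)%N));
  last exact: existT_continuous.
move: y; apply: continuous_pair.
  apply: fm_comp_continuous => // i y.
  apply: (@continuous_comp _ _ _ (z' i) fst); first exact: (proj1 (z'E i)).
  exact: cvg_fst.
apply: continuous_prod_topology => s y.
apply: (@continuous_comp _ _ _ (z' (tagnat.sig1 s)) (fun q => q.2 (tagnat.sig2 s))).
  exact: (proj1 (z'E _)).
apply: (@continuous_comp _ _ _ snd (fun q : {ptws _ -> X} => q (tagnat.sig2 s)));
  first exact: cvg_snd.
exact: (@continuous_coord _ (fun=> X)).
Qed.

Definition graft_class k (c : FM L 'I_k) (z : 'I_k -> pt) : CX L x0 :=
  cls _ (graft_conf c z).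

Lemma graft_class_step k (c : FM L 'I_k) (z z' : 'I_k -> pt) :
  (forall i, reindexed x0 (z i) (z' i)) -> graft_class c z = graft_class c z'.
Proof.
move=> zz'; have idinj : injective (@id 'I_k) by [].
have -> : graft_class c z' = graft_class (fm_pull idinj c) z'.
  by congr graft_class; apply: fm_eqP; rewrite /= pull_raw_id //; exact: FM_limit.
have [F [Finj [E1 E2 E3]]] := graft_conf_reindex idinj c zz'.
rewrite /graft_class {1}/graft_conf (CX_reindex Finj) => [|s sF].
  by congr cls; apply: labE => // s; rewrite -[LHS]/((_ \o F) s) -E2.
by case: (E3 s sF) => // /(_ (tagnat.sig1 s)); rewrite eqxx.
Qed.

(** The trees are exchanged one at a time: with the others fixed, grafting is a continuous map to a
    weak Hausdorff space that is invariant under steps, so [cls_lift] applies. *)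
Lemma graft_class_cls k (c : FM L 'I_k) (z z' : 'I_k -> pt) :
  (forall i, cls (forget_step x0) (z i) = cls (forget_step x0) (z' i)) ->
  graft_class c z = graft_class c z'.
Proof.
move=> zz'; pose upd (z : 'I_k -> pt) i w l := if l == i then w else z l.
have one y i w : cls (forget_step x0) (y i) = cls (forget_step x0) w ->
    graft_class c y = graft_class c (upd y i w).
  move=> yw; have {1}-> : y = upd y i (y i).
    by apply/funext => l; rewrite /upd; case: eqP => // ->.
  apply: (@cls_lift _ (forget_step x0) _ (fun w => graft_class c (upd y i w))) yw.
  - apply/kification_continuousP => K g cK hK cg x.
    apply: (@continuous_comp _ _ _ (fun x => graft_conf c (fun l =>
      upd y i (g x) l)) (cls _)); last exact: cls_continuous.
    apply: graft_conf_continuous => // [|l]; first exact: cst_continuous.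
    rewrite /upd; case: eqP => _; last exact: cst_continuous.
    exact: continuous_to_kification.
  - exact: cgwh_quotient_weak_hausdorff.
  - move=> u v uv; apply: graft_class_step => l; rewrite /upd.
    by case: eqP => _; [exact: reindexed_step|exact: reindexed_refl].
(* The first [n] trees are already exchanged. *)
pose mix n (l : 'I_k) := if (l < n)%N then z' l else z l.
have mixE n : (n <= k)%N -> graft_class c z = graft_class c (mix n).
  elim: n => [|n IH] nk; first by congr graft_class; apply/funext.
  rewrite (IH (ltnW nk)) (one _ (Ordinal nk) (z' (Ordinal nk))).
    congr graft_class; apply/funext => l; rewrite /upd /mix -val_eqE /=.
    have [ln|ln] := eqVneq (l : nat) n; last by rewrite ltnS [(l <= n)%N]leq_eqVlt (negbTE ln).
    by rewrite ln ltnSn; congr z'; exact/val_inj.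
  by rewrite /mix ltnn.
by rewrite (mixE k) //; congr graft_class; apply/funext => l; rewrite /mix ltn_ord.
Qed.

(** Chosen representatives need not vary continuously. For labels that are lifted continuously to
    [pt] they may be replaced by the lifts, and by [power_quotient_k_open] such labels suffice. *)
Lemma graft_labels_continuous :
  continuous (fun w : lconf L (Fstar R x0) => cls (forget_step x0) (graft_labels w)).
Proof.
apply: kification_sigT_continuous => k; apply/continuousP => V oV.
apply: (@power_quotient_k_open (FM L 'I_k) pt (Fstar R x0) (cls (forget_step x0)) 'I_k).
- exact: cls_surj.
- by move=> U oU; exact: oU.
- exact: kification_compactly_generated.
- exact: cls_continuous.
move=> K c x cK hK cc cx.
rewrite (_ : [set _ | _] = (fun k => graft_class (c k) (fun i => x i k)) @^-1` V).
  apply: open_comp oV => y _.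
  apply: (@continuous_comp _ _ _ (fun k => graft_conf (c k) (fun i => x i k)) (cls _));
    last exact: cls_continuous.
  exact: graft_conf_continuous.
apply/seteqP; split=> y /=;
  rewrite -[cls _ (graft_labels _)]/(graft_class (c y) (fun i =>
    representative (cls (forget_step x0) (x i y))));
  rewrite (@graft_class_cls _ _ _ (fun i => x i y)) // => i; by rewrite cls_representative.
Qed.

Variable N : set R.

Lemma graft_labels_reindex k k' (f : 'I_k' -> 'I_k) (finj : injective f)
    (c : FM L 'I_k) (y : 'I_k -> Fstar R x0) :
  (forall i, (forall j, f j != i) -> y i = Fstar_base R x0 \/ N ((val c).1 i)) ->
  cmn_cls N x0 (graft_labels (lab c y)) =
  cmn_cls N x0 (graft_labels (lab (fm_pull finj c) (y \o f))).
Proof.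
(* The representative chosen for the base point might have twigs; the empty configuration takes its
   place, so that no twig of the grafting lies over a twig labelled by the base point. *)
move=> off; pose e : pt := lab (fm_empty [set 0]) (fun=> x0).
pose z i := if `[< y i = Fstar_base R x0 >] then e else representative (y i).
have zE i : cls (forget_step x0) (z i) = y i.
  by rewrite /z; case: asboolP => [->|_] //; rewrite cls_representative.
have grE k0 (c0 : FM L 'I_k0) y0 z0 : (forall i, cls (forget_step x0) (z0 i) = y0 i) ->
    cls (forget_step x0) (graft_labels (lab c0 y0)) = graft_class c0 z0.
  move=> z0E; apply: graft_class_cls => i; by rewrite z0E cls_representative.
rewrite /cmn_cls (grE _ _ _ z) // (grE _ _ _ (z \o f)); last by move=> i; exact: zE.
have [F [Finj [E1 E2 E3]]] := graft_conf_reindex finj c (fun j => reindexed_refl x0 (z (f j))).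
rewrite /graft_class -![cls _ (cls _ _)]/(cmn_cls N x0 _).
rewrite {1}/graft_conf (CMN_reindex Finj) => [|s sF].
  by congr cmn_cls; apply: labE => // s; rewrite -[LHS]/((_ \o F) s) -E2.
case: (E3 s sF) => [nf|]; last by left.
case: (off _ nf) => [yb|]; last by right.
have z0 : projT1 (z (tagnat.sig1 s)) = 0%N by rewrite /z; case: asboolP.
by have := ltn_ord (tagnat.sig2 s); rewrite [X in (_ < X)%N]z0.
Qed.

Lemma lambdaE (w : lconf L (Fstar R x0)) :
  lambda (cmn_cls N (Fstar_base R x0) w) = cmn_cls N x0 (graft_labels w).
Proof.
apply: (proj2 (@CMN_rec R L N _ (CMN L N x0) (Fstar_base R x0)
  (fun w => cmn_cls N x0 (graft_labels w)) _ _ _ _)).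
- move=> u; apply: (@continuous_comp _ _ _ (fun w =>
  cls (forget_step x0) (graft_labels w)) (cls _)).
    exact: graft_labels_continuous.
  exact: cls_continuous.
- exact: cgwh_quotient_weak_hausdorff.
- move=> _ _ [k s c x|k i c x xi]; apply: graft_labels_reindex => t.
    by move=> /perm_off.
  by move=> /lift_off ->; left.
- move=> [k [c y]]; symmetry; apply: graft_labels_reindex => t nt; right.
  by have := enum_val_off nt; rewrite inE => /asboolPn/contrapT.
Qed.

Lemma lambda_lab k (c : FM L 'I_k) (z : 'I_k -> pt) :
  lambda (cmn_cls N (Fstar_base R x0) (lab c (fun i => cls (forget_step x0) (z i)))) =
  cmn_cls N x0 (graft_conf c z).
Proof.
rewrite lambdaE; congr cls; apply: graft_class_cls => i.
by rewrite cls_representative.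
Qed.

End GraftedClasses.

(** * Relations in C(I, N; A) *)

Section Coequalizer.
Variables (R : realType) (A : topologicalType).
Variables (rho : forall k, FM1 R k -> ('I_k -> A) -> A) (a0 : A).
Hypothesis A_monoid : one_monoid rho a0.
Hypothesis A_wh : weak_hausdorff A.

Lemma rho_fiber (L : set R) n k (h : 'I_n -> 'I_k) (C : FM L 'I_n) (a : 'I_n -> A) i :
  rho (fiber_config h C i) (a \o enum_val (A := mem (fiber h i))) =
  merge_labels rho a0 h (val C) a i.
Proof.
symmetry; apply: (@mulE _ _ _ _ A_monoid _ _ _ _ (enum_val (A := mem (fiber h i)))) => //.
apply: uniq_perm.
- by apply: (map_uniq (f := fst)); rewrite -/(unzip1 _) unzip1_labelled points_uniq.
- by rewrite map_inj_uniq ?enum_uniq // => t t' [/enum_val_inj].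
move=> [s b]; apply/mapP/mapP => [[s' + [-> ->]]|[t _ [-> ->]]].
  rewrite mem_points => hs; have sf : s' \in mem (fiber h i) by rewrite inE.
  by exists (enum_rank_in sf s'); rewrite ?mem_enum //= enum_rankK_in.
exists (enum_val t) => //; rewrite mem_points.
by have := enum_valP t; rewrite inE.
Qed.

(** Forgetting [i] grafts the empty tree on it and single twigs elsewhere. *)
Lemma rho_forget k (i : 'I_k.+1) (c : FM1 R k.+1) (a : 'I_k.+1 -> A) : a i = a0 ->
  rho c a = rho (fm_pull (@lift_inj _ i) c) (a \o lift i).
Proof.
move=> ai; have gr : grafted (lift i) (val (fm_pull (@lift_inj _ i) c)) (val c) by exact:
  grafted_pull.
rewrite (rho_grafted A_monoid _ gr).
congr (rho _); apply/funext => t; rewrite rho_fiber.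
have lp := FM_limit (fm_pull (@lift_inj _ i) c).
case: (unliftP i t) => [j ->|->]; first by rewrite merge_labels_inj //; exact: lift_inj.
by rewrite merge_labels_out // => j; rewrite eq_sym neq_lift.
Qed.

Let act (w : lconf [set (0 : R)] A) : A := rho (projT2 w).1 (projT2 w).2.

Lemma act_continuous : continuous act.
Proof. by apply: kification_sigT_continuous => k; exact: (monoid_continuous A_monoid). Qed.

Lemma act_forget w w' : forget_step a0 w w' -> act w = act w'.
Proof.
move=> [k s c x|k i c x xi]; last exact: rho_forget.
by rewrite /act /= (monoid_equivariant A_monoid).
Qed.

Lemma rho_star_cls w : rho_star rho (a0 := a0) (cls _ w) = act w.
Proof. exact: (cls_rec act_continuous A_wh act_forget). Qed.

Lemma rho_star_continuous : continuous (rho_star rho (a0 := a0)).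
Proof. exact: (cls_rec_continuous act_continuous A_wh act_forget). Qed.

Lemma cmn_map_lab (N : set R) k (c : FM `[0 : R, 1] 'I_k) (y : 'I_k -> Fstar R a0) :
  cmn_map a0 (rho_star rho (a0 := a0)) (cmn_cls N (Fstar_base R a0) (lab c y)) =
  cmn_cls N a0 (lab c (rho_star rho (a0 := a0) \o y)).
Proof.
have base : rho_star rho (a0 := a0) (Fstar_base R a0) = a0.
  by rewrite rho_star_cls /act /= (monoid_base A_monoid).
apply: (proj2 (@CMN_rec R _ N _ (CMN `[0 : R, 1] N a0) (Fstar_base R a0)
  (fun w => cmn_cls N a0 (lab_map (rho_star rho (a0 := a0)) w)) _ _ _ _)).
- apply: kification_sigT_continuous => m x.
  apply: (@continuous_comp (kification (lconf_of_size `[0 : R, 1] (Fstar R a0) m)) (lconf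
    `[0 : R, 1] A) _
    (fun x => lab x.1 (rho_star rho (a0 := a0) \o x.2)) (cmn_cls N a0)); last first.
    by apply: continuous_comp; exact: cls_continuous.
  move: x; apply: kification_existT_continuous; apply: continuous_pair;
    first by move=> x; exact: cvg_fst.
  apply: continuous_prod_topology => i x.
  apply: (@continuous_comp _ _ _ (fun x : lconf_of_size _ _ m => x.2 i));
    last exact: rho_star_continuous.
  apply: (@continuous_comp _ _ _ snd (fun q : {ptws _ -> Fstar R a0} => q i));
    first exact: cvg_snd.
  exact: (@continuous_coord _ (fun=> Fstar R a0)).
- exact: cgwh_quotient_weak_hausdorff.
- move=> _ _ [m s e x|m i e x xi]; apply: CMN_reindex => t.
    by move=> /perm_off.
  by move=> /lift_off ->; left; rewrite /= xi.
- move=> [m [e x]]; symmetry; apply: CMN_reindex => t nt; right.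
  by have := enum_val_off nt; rewrite inE => /asboolPn/contrapT.
Qed.

Variable N : set R.

(** The coequalizer relation at [c] labelled by the classes of the [z i]: [lambda] grafts them,
    [rho_star] multiplies them out. *)
Lemma CI_graft k (c : FM `[0 : R, 1] 'I_k) (z : 'I_k -> lconf [set (0 : R)] A) :
  CI_cls rho a0 N (graft_conf c z) =
  CI_cls rho a0 N (lab c (fun i => rho (projT2 (z i)).1 (projT2 (z i)).2)).
Proof.
apply: cls_step; exists (cmn_cls N (Fstar_base R a0) (lab c (fun i =>
  cls (forget_step a0) (z i)))).
rewrite lambda_lab cmn_map_lab; split=> //; congr cmn_cls; congr lab.
by apply/funext => i; rewrite /= rho_star_cls.
Qed.

Lemma CI_pull k k' (f : 'I_k' -> 'I_k) (finj : injective f) (c : FM `[0 : R, 1] 'I_k)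
    (x : 'I_k -> A) :
  (forall i, (forall j, f j != i) -> x i = a0 \/ N ((val c).1 i)) ->
  CI_cls rho a0 N (lab c x) = CI_cls rho a0 N (lab (fm_pull finj c) (x \o f)).
Proof. by move=> off; congr cls; exact: CMN_reindex. Qed.

(** Renumbered fibre by fibre, [C] is an operadic composition, to which [CI_graft] applies. *)
Lemma CI_grafted n k (h : 'I_n -> 'I_k) (C : FM `[0 : R, 1] 'I_n) (c : FM `[0 : R, 1] 'I_k)
    (a : 'I_n -> A) : grafted h (val C) (val c) ->
  CI_cls rho a0 N (lab C a) = CI_cls rho a0 N (lab c (merge_labels rho a0 h (val C) a)).
Proof.
move=> hCc; rewrite (CI_pull (@fiber_index_inj n k h)) => [|u nu]; last first.
  have [s su] := fiber_elt_surj h u; have := nu (tagnat.rank s).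
  by rewrite /= tagnat.rankK su eqxx.
rewrite -(fm_comp_fiber hCc).
transitivity (CI_cls rho a0 N (graft_conf c (fun i => lab (fiber_config h C i)
   (a \o enum_val (A := mem (fiber h i)))))) => //.
rewrite CI_graft; congr CI_cls; congr lab; apply/funext => i; exact: rho_fiber.
Qed.

End Coequalizer.

(** * Scaling of faces and degeneracies *)

Section Rescaling.
Variable R : realType.

(** The locations of a scaled configuration are its root screen, and the set of all twigs meets
    several trees, so this screen is read off from [c]. *)
Lemma rescale_grafted (T T' U U' : finType) (e : conf R T) (c : conf R T') (p : T -> T')
    (f : U -> T) (f' : U' -> T') (h : U -> U') :
  limit_config e -> grafted p e c -> p @: [set: T]%SET = [set: T']%SET -> (1 < #|T'|)%N ->
  injective f' -> (forall u, p (f u) = f' (h u)) ->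
  grafted h (rescale_raw f e) (rescale_raw f' c).
Proof.
move=> le [_ pe] pT T1 f'inj pf; split=> [u|S u uS S1] /=.
  by rewrite pe ?inE // ?pT ?cardsT // pf.
have E : p @: (f @: S) = f' @: (h @: S).
  by rewrite -!imset_comp; apply: eq_imset => v; exact: pf.
rewrite uS imset_f // pe ?imset_f // E ?(card_imset _ f'inj) //.
by rewrite pf.
Qed.

Lemma rescale_section (T T' U U' : finType) (e : conf R T) (c : conf R T') (p : T -> T')
    (f : U -> T) (f' : U' -> T') (g : U' -> U) :
  limit_config e -> limit_config c ->
  grafted p e c -> p @: [set: T]%SET = [set: T']%SET -> (1 < #|T'|)%N ->
  injective f' -> (forall u, p (f (g u)) = f' u) ->
  pull_raw g (rescale_raw f e) = rescale_raw f' c.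
Proof.
move=> le lc [_ pe] pT T1 f'inj pf; congr pair; apply/funext.
  by move=> u /=; rewrite pe ?inE // ?pT ?cardsT // pf.
move=> S; apply/funext => u /=; case: ifP => uS //; rewrite imset_f //.
have E : p @: (f @: (g @: S)) = f' @: S.
  by rewrite -!imset_comp; apply: eq_imset => v; exact: pf.
have [S1|S1] := leqP #|S| 1; last by rewrite pe ?imset_f // E ?(card_imset _ f'inj) // pf.
rewrite !limit_screen1 ?(card_imset _ f'inj) //.
by rewrite (leq_trans (leq_imset_card _ _)) // (leq_trans (leq_imset_card _ _)).
Qed.

Section Face.
Variables (r s : nat) (j : 'I_r.+2).

Lemma face_tagE (i : 'I_(r + s).+3) : face_tag j i =
  (if i < j then i : nat else if i < j + s.+2 then j : nat else i - s.+1)%N :> nat.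
Proof.
have := ltn_ord i; have := ltn_ord j; rewrite /face_tag /face_index => jr ir.
by case: ifP => // ij; [|case: ifP => // ij']; rewrite /= inordK //; lia.
Qed.

Lemma face_tag_surj : @face_tag r s j @: [set: 'I_(r + s).+3]%SET = [set: 'I_r.+2]%SET.
Proof.
apply/setP => a; rewrite [RHS]inE; apply/imsetP; exists (skip_face j (ord0 : 'I_s.+2) a) => //.
apply/val_inj; rewrite /= face_tagE skip_faceE /face_pos -val_eqE /=.
have := ltn_ord a; have := ltn_ord j.
by case: (ltngtP a j) => ?; repeat case: ifP; lia.
Qed.

Variables (c : assoc R r.+2) (d : assoc R s.+2).

Lemma assoc_comp_grafted : grafted (@face_tag r s j) (val (assoc_comp j c d)) (val c).
Proof. exact: grafted_pull_comp (grafted_graft (val c) (fun=> val d)). Qed.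

Lemma pull_in_face : pull_raw (in_face j) (val (assoc_comp j c d)) = val d.
Proof.
have [[ld d0] _] := set_valP d; have [[_ c0] _] := set_valP c.
rewrite /= pull_raw_comp (_ : _ \o _ = Tagged (fun=> 'I_s.+2) (i := j)).
  rewrite pull_graft_tagged // [RHS]surjective_pairing; congr pair; apply/funext => t /=.
  by rewrite d0; exact: c0.
apply/funext => t /=; have := ltn_ord t; have := ltn_ord j; move=> jr ts.
rewrite /face_index in_faceE ltnNge leq_addr /= ltn_add2l ts.
by congr existT; apply/val_inj; rewrite /= addKn inordK.
Qed.

End Face.

(** The forgotten input is neither the first nor the last, so the root screen still runs from 0 to 1
    and normalising it again changes nothing. *)
Lemma rescale_degen m n (f : 'I_n -> 'I_m.+3) (f' : 'I_n.-1 -> 'I_m.+2) (g : 'I_n.-1 -> 'I_n)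
    (i : 'I_m.+1) (c : assoc R m.+3) : injective f' ->
  (forall l, f (g l) = lift (middle i) (f' l)) ->
  pull_raw g (rescale_raw f (val c)) = rescale_raw f' (val (assoc_degen (middle i) c)).
Proof.
move=> f'inj fg; have ac : assoc R m.+3 (val c) := set_valP c; have lc := assoc_limit ac.
set k := lift (middle i); set z := (val c).2 [set: 'I_m.+3]%SET.
have E (S : {set 'I_n.-1}) : f @: (g @: S) = k @: (f' @: S).
  by rewrite -!imset_comp; apply: eq_imset => l; exact: fg.
congr pair; apply/funext.
  move=> l; rewrite /= fg [f' l \in _]inE.
  have k0 : ord0 = k ord0 by apply/val_inj.
  have kM : ord_max = k ord_max.
    by apply/val_inj; rewrite /= /bump /=; have := ltn_ord i; lia.
  have S0 : ord0 \in k @: [set: 'I_m.+2]%SET by rewrite k0 imset_f.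
  have SM : ord_max \in k @: [set: 'I_m.+2]%SET by rewrite kM imset_f.
  have lS : k (f' l) \in k @: [set: 'I_m.+2]%SET by rewrite imset_f.
  rewrite (limit_screen lc (finset.subsetT _) lS S0 SM) -/z.
    rewrite (direction_id lS S0 SM (screen_ord0 ac) (screen_ord_max ac)) // => w _.
    exact: (screenT_itv ac).
  by rewrite /z (screen_ord0 ac) (screen_ord_max ac) eq_sym oner_eq0.
by move=> S; apply/funext => l /=; case: ifP => lS //; rewrite !imset_f // E fg.
Qed.

End Rescaling.

(** * Stasheff's relations in C(I, N; A) *)

Section Relations.
Variables (R : realType) (A : topologicalType).
Variables (rho : forall k, FM1 R k -> ('I_k -> A) -> A) (a0 : A).
Hypothesis A_monoid : one_monoid rho a0.
Hypothesis A_wh : weak_hausdorff A.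
Variable N : set R.

Lemma merge_labels1 (U T : finType) (h : U -> T) (C : conf R U) (a : U -> A) t u :
  limit_config C -> (forall v, (h v == t) = (v == u)) -> merge_labels rho a0 h C a t = a u.
Proof.
move=> lC hu; rewrite /merge_labels (@points_eq _ _ _ _ [:: u]) //; first by rewrite mul_seq1.
by move=> v; rewrite inE -topredE /= hu.
Qed.

(* The labelled inputs of an element of [B] (for [n' = r]) or of [E] (for
   [n' = r.+1]) are those in the image of [f], of a face those in the image of
   [f']. *)
Section Face.
Variables (r s n' : nat) (j : 'I_r.+2) (c : assoc R r.+2) (d : assoc R s.+2).
Variables (f : 'I_(n' + s).+1 -> 'I_(r + s).+3) (f' : 'I_n' -> 'I_r.+2).
Hypotheses (fE : forall u, f u = u.+1 :> nat) (f'E : forall u, f' u = u.+1 :> nat).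
Variables (C : FM `[0 : R, 1] 'I_(n' + s).+1) (c' : FM `[0 : R, 1] 'I_n').
Hypotheses (CE : val C = rescale_raw f (val (assoc_comp j c d)))
  (c'E : val c' = rescale_raw f' (val c)).
Variable a : 'I_(n' + s).+1 -> A.

Let f'inj : injective f'.
Proof. by move=> u v uv; apply/val_inj; apply: succn_inj; rewrite -!f'E uv. Qed.

Let le : limit_config (val (assoc_comp j c d)) := assoc_limit (set_valP _).
Let lc : limit_config (val c) := assoc_limit (set_valP _).

(** The scaled composition is [grafted] on the scaled outer factor; the tree over input [j] is [d],
    all others are single twigs. *)
Lemma CI_inner : (0 < j <= n')%N ->
  CI_cls rho a0 N (lab C a) = CI_cls rho a0 N (lab c' (splice a j s
    (structure_map rho d (fun t => a (inord (j.-1 + t)))))).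
Proof.
move=> /andP[j0 jn].
(* Labelled inputs are counted from input 1, hence the predecessor; as [0 < j], none of them belongs
   to the block of input 0. *)
have hP u : ((face_tag j (f u)).-1 < n')%N.
  rewrite face_tagE fE; have := ltn_ord u; repeat case: ifP; lia.
pose h u := Ordinal (hP u).
have hE u : face_tag j (f u) = f' (h u).
  apply/val_inj; rewrite /= f'E /= prednK // face_tagE fE; repeat case: ifP; lia.
have gr : grafted h (val C) (val c').
  rewrite CE c'E; apply: (rescale_grafted le (assoc_comp_grafted j c d)) => //.
    exact: face_tag_surj.
  by rewrite card_ord.
rewrite (CI_grafted A_monoid A_wh _ _ gr); congr CI_cls; congr lab; apply/funext => l.
have lC := FM_limit C; have ln := ltn_ord l.
have hl u : (h u == l) = ((if u.+1 < j then u.+1 else if u.+1 < j + s.+2 then j : nat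
  else u - s) == l.+1)%N.
  by rewrite -val_eqE /= face_tagE fE; case: ifP; [|case: ifP]; lia.
rewrite /splice; case: ifP => lj; [|case: ifP => [/eqP lj'|lj']].
- apply: merge_labels1 => // u; rewrite hl -val_eqE /= inordK; last by lia.
  by case: ifP; [|case: ifP]; lia.
- pose g (t : 'I_s.+2) : 'I_(n' + s).+1 := inord (j.-1 + t).
  have gE t : g t = (j.-1 + t)%N :> nat by rewrite inordK //; have := ltn_ord t; lia.
  have ginj : injective g.
    by move=> t t' /(congr1 val) /=; rewrite !gE => /addnI /val_inj.
  apply: (@mulE _ _ _ _ A_monoid _ _ _ _ g (a \o g) (assoc_FM1 d)).
    have [[_ d0] _] := set_valP d.
    have E : f \o g = in_face j.
      by apply/funext => t; apply/val_inj; rewrite /= fE gE in_faceE; lia.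
    rewrite -[LHS]/(val d) -(pull_in_face j c d) -E -pull_raw_comp CE.
    congr pair; apply/funext => t /=; have [[_ e0] _] := set_valP (assoc_comp j c d).
    exact: e0.
  apply: uniq_perm.
  + by apply: (map_uniq (f := fst)); rewrite -/(unzip1 _) unzip1_labelled points_uniq.
  + by rewrite map_inj_uniq ?enum_uniq // => t t' [/ginj].
  move=> [u b]; apply/mapP/mapP => [[u' + [-> ->]]|[t _ [-> ->]]].
    rewrite mem_points hl => uj; have tP : (u' - j.-1 < s.+2)%N.
      by move: uj; case: ifP; [|case: ifP]; lia.
    have gt : g (Ordinal tP) = u'.
      by apply/val_inj; rewrite /= gE /=; move: uj; case: ifP; [|case: ifP]; lia.
    by exists (Ordinal tP); rewrite ?mem_enum //= gt.
  exists (g t) => //; rewrite mem_points hl gE; have := ltn_ord t.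
  by case: ifP; [|case: ifP]; lia.
- apply: merge_labels1 => // u; rewrite hl -val_eqE /= inordK; last by lia.
  by case: ifP; [|case: ifP]; lia.
Qed.

(* The case of the faces containing an input located in [N]. *)
Lemma CI_outer (g : 'I_n' -> 'I_(n' + s).+1) : injective g ->
  (forall l, face_tag j (f (g l)) = f' l) ->
  (forall u, (forall l, g l != u) -> N ((val c).2 [set: 'I_r.+2]%SET (face_tag j (f u)))) ->
  CI_cls rho a0 N (lab C a) = CI_cls rho a0 N (lab c' (a \o g)).
Proof.
move=> ginj gE off; rewrite (CI_pull rho (N := N) ginj) => [|u gu].
  congr CI_cls; apply: labE => //; rewrite /= CE c'E.
  apply: (rescale_section le lc (assoc_comp_grafted j c d)) => //; first exact: face_tag_surj.
  by rewrite card_ord.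
right; have [_ pe] := assoc_comp_grafted j c d.
have -> : (val C).1 u = (val (assoc_comp j c d)).2 [set: 'I_(r + s).+3]%SET (f u) by
  rewrite CE.
by rewrite pe ?inE // face_tag_surj ?cardsT ?card_ord //; exact: off.
Qed.

(** The face is located at 0, so its labelled inputs, which are the first [s.+1], may be
    forgotten. *)
Lemma CI_first : j = ord0 -> N 0 ->
  CI_cls rho a0 N (lab C a) = CI_cls rho a0 N (lab c' (fun l => a (inord (l + s.+1)))).
Proof.
move=> j0 N0; pose g (l : 'I_n') : 'I_(n' + s).+1 := inord (l + s.+1).
have gE l : g l = (l + s.+1)%N :> nat by rewrite inordK //; have := ltn_ord l; lia.
apply: (@CI_outer g) => [l l' ll'|l|u gu].
- apply/val_inj; have := congr1 val ll'; rewrite /= !gE; lia.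
- by apply/val_inj; rewrite /= face_tagE fE f'E gE j0 /= ifF; lia.
have us : (u < s.+1)%N.
  rewrite ltnNge; apply/negP => su; have un : (u - s.+1 < n')%N by have := ltn_ord u; lia.
  by have /eqP := gu (Ordinal un); apply; apply/val_inj; rewrite /= gE /=; lia.
have -> : face_tag j (f u) = ord0.
  by apply/val_inj; rewrite /= face_tagE fE j0 /= ifT //; lia.
by rewrite (screen_ord0 (set_valP c)).
Qed.

Lemma CI_last : j = ord_max -> n' = r -> N 1 ->
  CI_cls rho a0 N (lab C a) = CI_cls rho a0 N (lab c' (fun l => a (inord l))).
Proof.
move=> jM n'r N1; pose g (l : 'I_n') : 'I_(n' + s).+1 := inord l.
have gE l : g l = l :> nat by rewrite inordK //; have := ltn_ord l; lia.
apply: (@CI_outer g) => [l l' ll'|l|u gu].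
- by apply/val_inj; have := congr1 val ll'; rewrite /= !gE.
- have ln := ltn_ord l.
  by apply/val_inj; rewrite /= face_tagE fE f'E gE jM /= ifT //; lia.
have ur : (r <= u)%N.
  rewrite leqNgt; apply/negP => ur; have un : (u < n')%N by lia.
  by have /eqP := gu (Ordinal un); apply; apply/val_inj; rewrite /= gE.
have -> : face_tag j (f u) = ord_max.
  have un := ltn_ord u.
  by apply/val_inj; rewrite /= face_tagE fE jM /= ifF; [rewrite ifT //|]; lia.
by rewrite (screen_ord_max (set_valP c)).
Qed.

End Face.

End Relations.

(** * The homeomorphisms *)

Section Homeomorphisms.
Variables (R : realType) (A : topologicalType).
Variables (rho : forall k, FM1 R k -> ('I_k -> A) -> A) (a0 : A).
Hypothesis A_monoid : one_monoid rho a0.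
Hypothesis A_wh : weak_hausdorff A.

Lemma middleE m (i : 'I_m) : middle i = i.+1 :> nat.
Proof. by rewrite /= /bump /= leqNgt ltn_ord. Qed.

Definition B_word (w : preB R A) : CI rho a0 [set 0; 1] :=
  CI_cls rho a0 [set 0; 1] (lab (B_config (projT2 w).1) (projT2 w).2).

Definition E_word (w : preE R A) : CI rho a0 [set 0] :=
  CI_cls rho a0 [set 0] (lab (E_config (projT2 w).1) (projT2 w).2).

Lemma B_word_step w w' : B_step rho a0 w w' -> B_word w = B_word w'.
Proof.
move=> [r s j c d a /andP[j0 jr]|r s c d a|r s c d a|m i c a ai].
- apply: (@CI_inner _ _ _ _ A_monoid A_wh _ r s r j c d (@middle _) (@middle _)) => //;
  try exact: middleE.
  by rewrite j0.
- by apply: (@CI_first _ _ _ _ _ r s r ord0 c d (@middle _) (@middle _)) => //;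
  [exact: middleE|exact: middleE|left].
- by apply: (@CI_last _ _ _ _ _ r s r ord_max c d (@middle _) (@middle _)) => //;
  [exact: middleE|exact: middleE|right].
transitivity (CI_cls rho a0 [set 0;
  1] (lab (fm_pull (@lift_inj _ i) (B_config c)) (a \o lift i))); last first.
  congr CI_cls; apply: labE => //.
  apply: (@rescale_degen _ m m.+1 (@middle m.+1) (@middle m) (lift i) i c);
    first exact: middle_inj.
  by move=> l; apply/val_inj;
    rewrite [LHS]middleE -[RHS]/(bump (middle i) (middle l)) !middleE bumpS.
by apply: CI_pull => l /lift_off ->; left.
Qed.

Lemma E_word_step w w' : E_step rho a0 w w' -> E_word w = E_word w'.
Proof.
move=> [r s j c d a j0|r s c d a|m i c a ai].
- apply: (@CI_inner _ _ _ _ A_monoid A_wh _ r s r.+1 j c d (lift ord0) (lift ord0)) => //.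
  by rewrite j0 -ltnS ltn_ord.
- exact: (@CI_first _ _ _ _ _ r s r.+1 ord0 c d (lift ord0) (lift ord0)).
transitivity (CI_cls rho a0 [set 0]
    (lab (fm_pull (@lift_inj _ (lift ord_max i)) (E_config c)) (a \o lift (lift ord_max
      i)))); last first.
  congr CI_cls; apply: labE => //.
  apply: (@rescale_degen _ m m.+2 (lift ord0) (lift ord0) (lift (lift ord_max i)) i c);
    first exact: lift_inj.
  move=> l; apply/val_inj; rewrite -[LHS]/(bump (lift ord_max i) l).+1 lift_max.
  by rewrite -[RHS]/(bump (middle i) l.+1) middleE bumpS.
by apply: CI_pull => l /lift_off ->; left.
Qed.

Lemma CI_config_continuous (N : set R) m n (f : assoc R m.+2 -> FM `[0 : R, 1] 'I_n) :
  continuous f -> continuous ((fun p => CI_cls rho a0 N (lab (f p.1) p.2)) :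
    kification (assoc R m.+2 * {ptws 'I_n -> A}) -> CI rho a0 N).
Proof.
move=> cf p; apply: (@continuous_comp (kification (assoc R m.+2 * {ptws 'I_n -> A}))
  (lconf `[0 : R, 1] A) _ (fun p => lab (f p.1) p.2) (CI_cls rho a0 N)); last first.
  by do 2! (apply: continuous_comp; last exact: cls_continuous); exact: cls_continuous.
move: p; apply: kification_existT_continuous; apply: continuous_pair => p; last exact: cvg_snd.
by apply: (@continuous_comp _ _ _ fst f); [exact: cvg_fst|exact: cf].
Qed.

Lemma B_word_continuous : continuous B_word.
Proof.
apply: kification_sigT_continuous => m.
exact: (CI_config_continuous (@B_config_continuous R m)).
Qed.

Lemma E_word_continuous : continuous E_word.
Proof.
apply: kification_sigT_continuous => m.
exact: (CI_config_continuous (@E_config_continuous R m)).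
Qed.

(** [F] and [g] descend to the quotients. They are inverse to each other since [F (g v)] is the
    class of [v] and [g] reaches every class of C(I, N; A). *)
Lemma CI_homeomorphism (N : set R) (P : topologicalType) (r : P -> P -> Prop)
    (g : P -> lconf `[0 : R, 1] A) (F : lconf `[0 : R, 1] A -> cgwh_quotient r) :
  continuous F ->
  (forall w w', forget_step a0 w w' -> F w = F w') ->
  (forall w, F (away N w) = F w) ->
  (forall w, F (graft_labels (x0 := a0) w) = F (lab_map (rho_star rho (a0 := a0)) w)) ->
  continuous (fun v => CI_cls rho a0 N (g v)) ->
  (forall v v', r v v' -> CI_cls rho a0 N (g v) = CI_cls rho a0 N (g v')) ->
  (forall v, F (g v) = cls r v) ->
  (forall w, exists v, CI_cls rho a0 N w = CI_cls rho a0 N (g v)) ->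
  exists h : CI rho a0 N -> cgwh_quotient r,
    homeomorphism h /\ forall w, h (CI_cls rho a0 N w) = F w.
Proof.
move=> cF Ff Fa Fg cg gr Fgv gsurj.
have [h [ch hE]] := CI_rec cF (@cgwh_quotient_weak_hausdorff _ _) Ff Fa Fg.
exists h; split=> //; split=> //.
have wh : weak_hausdorff (CI rho a0 N) by exact: cgwh_quotient_weak_hausdorff.
exists (fun q => CI_cls rho a0 N (g (representative q))); split.
- exact: (cls_rec_continuous cg wh gr).
- move=> u; have [w ->] : exists w, u = CI_cls rho a0 N w.
    by exists (cmn_rep (representative u)); rewrite /CI_cls /cmn_cls !cls_representative.
  have [v ->] := gsurj w; rewrite hE Fgv; exact: (cls_rec cg wh gr).
- by move=> q; rewrite hE Fgv cls_representative.
Qed.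

Lemma E_away T (c : conf R T) (a a' : T -> A) :
  (forall t, ~ [set 0] (c.1 t) -> a t = a' t) ->
  value rho a0 (E_class rho a0) c a = value rho a0 (E_class rho a0) c a'.
Proof.
move=> aa'; have same (P : pred T) : (forall t, P t -> c.1 t <> 0) ->
    labelled a (points c P) = labelled a' (points c P).
  move=> Pc; apply/eq_in_map => t; rewrite mem_points => /Pc ct; congr pair; exact: aa'.
rewrite /value !same // => t; first by rewrite /at_end => /eqP ->; exact/eqP/oner_neq0.
by move=> /andP[t0 _] t0'; move: t0; rewrite t0' ltxx.
Qed.

Lemma B_away T (c : conf R T) (a a' : T -> A) :
  (forall t, ~ [set 0; 1] (c.1 t) -> a t = a' t) ->
  value rho a0 (B_class rho a0) c a = value rho a0 (B_class rho a0) c a'.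
Proof.
move=> aa'; rewrite /value.
have -> : labelled a (points c (interior c)) = labelled a' (points c (interior c)).
  apply/eq_in_map => t; rewrite mem_points => /andP[t0 t1]; congr pair.
  by apply: aa' => /= -[tE|tE]; [move: t0|move: t1]; rewrite tE ltxx.
apply: B_class_ext => i il; apply: set_nth_default.
by rewrite unzip2_map_pos size_map; move: il; rewrite /map_pos size_map.
Qed.

(** In E(A) the last input has a label. A configuration given by [B_config] has no twig there, and
    is completed by one with the unit label. *)
Definition append m (a : 'I_m -> A) (i : 'I_m.+1) : A :=
  if unlift ord_max i is Some j then a j else a0.

Lemma append_lift m (a : 'I_m -> A) : append a \o lift ord_max = a.
Proof. by apply/funext => i; rewrite /append /= liftK. Qed.

Lemma append_max m (a : 'I_m -> A) : append a ord_max = a0.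
Proof. by rewrite /append unlift_none. Qed.

Lemma pull_E_config m (c : assoc R m.+2) :
  fm_pull (@lift_inj _ ord_max) (E_config c) = B_config c.
Proof.
apply: fm_eqP; rewrite /=; congr pair; apply/funext => S; apply/funext => i /=.
case: ifP => iS //; rewrite imset_f // -imset_comp.
by [].
Qed.

Lemma value_E_B_config m (c : assoc R m.+2) (a : 'I_m -> A) :
  value rho a0 (E_class rho a0) (val (B_config c)) a = cls (E_step rho a0) (preE_elt c
    (append a)).
Proof.
rewrite -value_E_config // -pull_E_config.
rewrite -[X in value _ _ _ _ X = _]append_lift.
apply: (value_pull A_monoid (E_collapsing rho a0) E_away (f := lift ord_max)).
- exact: set_valP.
- exact: lift_inj.
- by move=> t /lift_off ->; left; exact: append_max.
Qed.

Lemma lvalue_perm (Q : Type) (X : forall m, conf R 'I_m.+2 -> (nat -> A) -> Q) (N : set R)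
    k (s : 'S_k) (e : assoc R k.+2) (y : 'I_k -> A) : collapsing rho a0 X ->
  (forall (T : finType) (c : conf R T) (a a' : T -> A),
    (forall t, ~ N (c.1 t) -> a t = a' t) -> value rho a0 X c a = value rho a0 X c a') ->
  lvalue rho a0 X (lab (fm_pull (@perm_inj _ s) (B_config e)) y) =
  value rho a0 X (val (B_config e)) (y \o (s^-1)%g).
Proof.
move=> Xc Xa; have E := lvalue_forget A_monoid Xc Xa (Renumber a0 s (B_config e) (y \o
  (s^-1)%g)).
by rewrite -[RHS]/(lvalue rho a0 X (lab (B_config e) (y \o (s^-1)%g))) E;
  congr lvalue; apply: labE => // i; rewrite /= permK.
Qed.

(** [None] stands for the constant label [a0]; this covers permuting, restricting and appending
    labels. *)
Lemma relabel_continuous (C : topologicalType) m n (g : 'I_m -> option 'I_n) :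
  continuous ((fun p => (p.1, fun i => if g i is Some j then p.2 j else a0)) :
    C * {ptws 'I_n -> A} -> C * {ptws 'I_m -> A}).
Proof.
apply: continuous_pair => [p|]; first exact: cvg_fst.
apply: continuous_prod_topology => i; case: (g i) => [j|]; last exact: cst_continuous.
move=> p; apply: (@continuous_comp _ _ _ snd (fun q : {ptws 'I_n -> A} => q j)).
  exact: cvg_snd.
exact: (@continuous_coord _ (fun=> A)).
Qed.

Lemma B_lvalue_continuous : continuous (lvalue rho a0 (B_class rho a0)).
Proof.
apply: lconf_continuous => k s.
rewrite (_ : (fun p => _) = fun p =>
  cls (B_step rho a0) (preB_elt p.1 (p.2 \o (s^-1)%g))); last first.
  by apply/funext => p;
    rewrite (lvalue_perm _ _ _ (B_collapsing rho a0) B_away) value_B_config.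
move=> p; apply: (@continuous_comp (kification (assoc R k.+2 * {ptws 'I_k -> A})) (preB R A) _
  (fun p => preB_elt p.1 (p.2 \o (s^-1)%g)) (cls _)); last exact: cls_continuous.
move: p; apply: kification_existT_continuous.
exact: (@relabel_continuous _ k k (fun i => Some ((s^-1)%g i))).
Qed.

Lemma E_lvalue_continuous : continuous (lvalue rho a0 (E_class rho a0)).
Proof.
apply: lconf_continuous => k s.
rewrite (_ : (fun p => _) = fun p => cls (E_step rho a0) (preE_elt p.1 (fun i =>
    if omap (fun j => (s^-1)%g j) (unlift ord_max i) is Some j then p.2 j else a0))).
  move=> p; apply: (@continuous_comp (kification (assoc R k.+2 * {ptws 'I_k ->
    A})) (preE R A) _
    (fun p => preE_elt p.1 _) (cls _)); last exact: cls_continuous.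
  move: p; apply: kification_existT_continuous.
  exact: (@relabel_continuous _ k.+1 k).
apply/funext => p; rewrite (lvalue_perm _ _ _ (E_collapsing rho a0) E_away) value_E_B_config.
congr (cls _ (preE_elt _ _)); apply/funext => i; rewrite /append; by case: unlift.
Qed.

Lemma CI_B_config (N : set R) (w : lconf `[0 : R, 1] A) :
  exists m (e : assoc R m.+2) (y : 'I_m -> A),
    CI_cls rho a0 N w = CI_cls rho a0 N (lab (B_config e) y).
Proof.
case: w => k [c x]; have [s [e <-]] := rescale_surj c.
exists k, e, (x \o (s^-1)%g).
transitivity (CI_cls rho a0 N
    (lab (fm_pull (@perm_inj _ s) (B_config e)) ((x \o (s^-1)%g) \o s))).
  by congr CI_cls; apply: labE => // i; rewrite /= permK.
by symmetry; apply: CI_pull => i /perm_off.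
Qed.

Lemma B_homeomorphism :
  exists h : CI rho a0 [set 0; 1] -> stasheff_B rho a0, homeomorphism h /\
    forall w, h (CI_cls rho a0 [set 0; 1] w) = lvalue rho a0 (B_class rho a0) w.
Proof.
apply: (@CI_homeomorphism _ (preB R A) (B_step rho a0)
  (fun w => lab (B_config (projT2 w).1) (projT2 w).2) (lvalue rho a0 (B_class rho a0))).
- exact: B_lvalue_continuous.
- exact: (lvalue_forget A_monoid (B_collapsing rho a0) B_away).
- exact: (lvalue_away A_monoid (B_collapsing rho a0) B_away).
- by move=> w; apply: (lvalue_graft_labels A_monoid [set 0; 1]); exact: B_collapsing.
- exact: B_word_continuous.
- exact: B_word_step.
- by move=> [m [c a]]; exact: value_B_config.
- move=> w; have [m [e [y ->]]] := CI_B_config [set 0; 1] w.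
  by exists (preB_elt e y).
Qed.

Lemma E_homeomorphism :
  exists h : CI rho a0 [set 0] -> stasheff_E rho a0, homeomorphism h /\
    forall w, h (CI_cls rho a0 [set 0] w) = lvalue rho a0 (E_class rho a0) w.
Proof.
apply: (@CI_homeomorphism _ (preE R A) (E_step rho a0)
  (fun w => lab (E_config (projT2 w).1) (projT2 w).2) (lvalue rho a0 (E_class rho a0))).
- exact: E_lvalue_continuous.
- exact: (lvalue_forget A_monoid (E_collapsing rho a0) E_away).
- exact: (lvalue_away A_monoid (E_collapsing rho a0) E_away).
- by move=> w; apply: (lvalue_graft_labels A_monoid [set 0]); exact: E_collapsing.
- exact: E_word_continuous.
- exact: E_word_step.
- by move=> [m [c a]]; exact: value_E_config.
- move=> w; have [m [e [y ->]]] := CI_B_config [set 0] w.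
  exists (preE_elt e (append y)).
  transitivity (CI_cls rho a0 [set 0]
      (lab (fm_pull (@lift_inj _ ord_max) (E_config e)) (append y \o lift ord_max))).
    by rewrite pull_E_config append_lift.
  by symmetry; apply: CI_pull => t /lift_off ->; left; exact: append_max.
Qed.

Let forget_last (w : preE R A) : stasheff_B rho a0 :=
  cls _ (preB_elt (projT2 w).1 ((projT2 w).2 \o lift ord_max)).

Lemma forget_last_continuous : continuous forget_last.
Proof.
apply: kification_sigT_continuous => m p.
apply: (@continuous_comp (kification (preE_of_size R A m)) (preB R A) _
  (fun p => preB_elt p.1 (p.2 \o lift ord_max)) (cls _)); last exact: cls_continuous.
move: p; apply: kification_existT_continuous.
exact: (@relabel_continuous _ m m.+1 (fun i => Some (lift ord_max i))).
Qed.

Lemma forget_last_step w w' : E_step rho a0 w w' -> forget_last w = forget_last w'.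
Proof.
move=> [r s j c d a j0|r s c d a|m i c a ai]; rewrite /forget_last /=.
- have [jr|jr] := ltnP j r.+1.
    rewrite (cls_step (B_inner rho a0 c d _ _)) ?j0 //; congr (cls _ (preB_elt _ _)).
    apply/funext => l; have ln := ltn_ord l.
    rewrite -[RHS]/(splice a j s _ (lift ord_max l)) /splice lift_max.
    case: ifP => lj; [|case: ifP => lj'].
    + by congr a; apply: ord_inj; rewrite lift_max !inordK //; lia.
    + congr (structure_map _ _ _); apply/funext => t; congr a; apply: ord_inj.
      by have := ltn_ord t; rewrite lift_max => ts; rewrite !inordK //; lia.
    + by congr a; apply: ord_inj; rewrite lift_max !inordK //; lia.
  (* At the last input, relation (i) of E(A) becomes the second relation in (ii) of B(A). *)
  have -> : j = ord_max by apply/val_inj/eqP; rewrite eqn_leq jr -ltnS ltn_ord.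
  rewrite (cls_step (B_last rho a0 c d _)); congr (cls _ (preB_elt _ _)).
  apply/funext => l; have ln := ltn_ord l.
  rewrite -[RHS]/(splice a _ s _ (lift ord_max l)) /splice lift_max ifT;
    last by rewrite /=; lia.
  by congr a; apply: ord_inj; rewrite lift_max !inordK //; lia.
- rewrite (cls_step (B_first rho a0 c d _)); congr (cls _ (preB_elt _ _)).
  apply/funext => l; have ln := ltn_ord l; rewrite -[RHS]/(a (inord (lift ord_max l + s.+1))).
  by congr a; apply: ord_inj; rewrite !lift_max !inordK //; lia.
- rewrite (cls_step (B_degen (i := i) (a0 := a0) rho c _)) //; congr (cls _ (preB_elt _ _)).
  apply/funext => l; congr a; apply: ord_inj.
  by rewrite [LHS]lift_max -[RHS]/(bump (lift ord_max i) (lift ord_max l)) !lift_max.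
Qed.

Lemma universal_arrow_cls m (c : assoc R m.+2) (a : 'I_m.+1 -> A) :
  universal_arrow (cls (E_step rho a0) (preE_elt c a)) =
  cls (B_step rho a0) (preB_elt c (a \o lift ord_max)).
Proof.
exact: (cls_rec forget_last_continuous (@cgwh_quotient_weak_hausdorff _ _)
  forget_last_step (preE_elt c a)).
Qed.

(** Both values come from the same point of the associahedron and the same labels; [E_class] reads
    one label more. *)
Lemma universal_arrow_lvalue (w : lconf `[0 : R, 1] A) :
  universal_arrow (lvalue rho a0 (E_class rho a0) w) = lvalue rho a0 (B_class rho a0) w.
Proof.
rewrite /lvalue /value /Lext /Lx /E_class /B_class.
case: pselect => [pf|nf]; rewrite universal_arrow_cls; congr (cls _ (preB_elt _ _)).
by apply/funext => i; rewrite -[LHS]/(nth _ _ (lift ord_max i)) lift_max.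
Qed.

End Homeomorphisms.

Theorem proposition5p11 (R : realType) (A : topologicalType)
    (rho : forall k : nat, FM1 R k -> ('I_k -> A) -> A) (a0 : A)
    (A_cgwh : cgwh A) (A_monoid : one_monoid rho a0)
    (A_well_pointed : well_pointed R a0) :
  exists (hE : CI rho a0 [set 0] -> stasheff_E rho a0)
         (hB : CI rho a0 [set 0; 1] -> stasheff_B rho a0),
    [/\ homeomorphism hE,
        homeomorphism hB,
        forall u : CI rho a0 [set 0],
          hB (CI_quotient_map [set 0; 1] u) = universal_arrow (hE u),
        forall (m : nat) (c : assoc R m.+2) (a : 'I_m.+1 -> A),
          hE (CI_cls rho a0 [set 0] (lab (E_config c) a)) =
          cls _ (preE_elt c a)
      & forall (m : nat) (c : assoc R m.+2) (a : 'I_m -> A),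
          hB (CI_cls rho a0 [set 0; 1] (lab (B_config c) a)) =
          cls _ (preB_elt c a)].
Proof.
have [hE [homE hEE]] := E_homeomorphism A_monoid A_cgwh.2.
have [hB [homB hBE]] := B_homeomorphism A_monoid A_cgwh.2.
exists hE, hB; split=> // [u|m c a|m c a].
(* The quotient map is computed on a representative, and for labelled configurations the square is
   [universal_arrow_lvalue]. *)
- rewrite hBE -universal_arrow_lvalue //; congr universal_arrow; rewrite -hEE; congr hE.
  by rewrite /CI_cls /cmn_cls !cls_representative.
- by rewrite hEE; exact: value_E_config.
- by rewrite hBE; exact: value_B_config.
Qed.
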